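(* Let $(M,[h])$ be a conformal manifold of dimension $n\ge2$, endowed with a Möbius structure $[\mathbb P]$ when $n=2$, and let $\nabla$ be the conformal (Möbius when $n=2$) tractor connection on the conformal tractor bundle $\mathcal E^I$. Fix a conformal scale and let $\boldsymbol\nabla$ be a connection on $\mathcal E^I$ of the form $$\boldsymbol\nabla_\alpha U^J=\nabla_\alpha U^J-\tilde A_{\alpha K}{}^JU^K,\qquad \tilde A_{\alpha K}{}^J=\begin{pmatrix} 0 & 0 & 0 \\ {E_\alpha}{}^\beta & A_{\alpha\gamma}{}^\beta & 0 \\ {F_\alpha} & G_{\alpha\gamma} & 0 \end{pmatrix}$$ with some tensors $E_{\alpha\beta}\in\mathcal E_{(\alpha\beta)}$, $G_{\alpha\beta}\in\mathcal E_{(\alpha\beta)}$, $F_\alpha\in\mathcal E_\alpha[-2]$ and $A_{\alpha\beta\gamma}\in\mathcal E_{(\alpha\beta\gamma)_0}[2]$. Assume that $E_\gamma{}^\gamma+G_\gamma{}^\gamma=0$, and when $n=2$ assume also that $\mathrm{tf}(E_{\alpha\beta}-G_{\alpha\beta})=0$. Then $\boldsymbol\nabla$ is flat if and only if the following two conditions hold: (i) The tensors $E_{\alpha\beta},G_{\alpha\beta},F_\alpha$ satisfy $$E_{\alpha\beta}=-\tfrac1n(\delta A)_{\alpha\beta}+P^A_{\alpha\beta},\qquad G_{\alpha\beta}=-\tfrac1n(\delta A)_{\alpha\beta}-P^A_{\alpha\beta},$$ $$F_\alpha=\tfrac1{n(n-1)}(\delta^2A)_\alpha+\tfrac1{n-1}A_\alpha{}^{\mu\nu}(P^h_{\mu\nu}-P^A_{\mu\nu}),$$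 where $P^A_{\alpha\beta}=\frac1{n-2}\bigl(A_{\alpha\mu\nu}A_\beta{}^{\mu\nu}-\frac{|A|^2}{2(n-1)}\boldsymbol h_{\alpha\beta}\bigr)$ for $n\ge3$ and $P^A_{\alpha\beta}=\frac14|A|^2\boldsymbol h_{\alpha\beta}$ for $n=2$. (ii) The tensor $A_{\alpha\beta\gamma}$ satisfies the Gauss equation $$2\,\mathrm{tf}(A_{\nu\gamma[\alpha}A_{\beta]\mu}{}^\nu)+W^h_{\alpha\beta\gamma\mu}=0\quad(n\ge4),$$ $$\nabla^h_{[\alpha}P^A_{\beta]\gamma}+\tfrac13A_{\mu\gamma[\alpha}(\delta A)_{\beta]}{}^\mu-Y_{\alpha\beta\gamma}=0\quad(n=3),$$ $$\nabla^h_\alpha|A|^2+2A_\alpha{}^{\mu\nu}(\delta A)_{\mu\nu}-8Y_{\alpha\mu}{}^\mu=0\quad(n=2),$$ and the Codazzi equation $$\nabla^h_{[\alpha}A_{\beta]\gamma\mu}-\tfrac1n\bigl(\boldsymbol h_{\mu[\alpha}(\delta A)_{\beta]\gamma}+\boldsymbol h_{\gamma[\alpha}(\delta A)_{\beta]\mu}\bigr)=0\quad(n\ge3),$$ $$\nabla^h_{[\alpha}(\delta^2A)_{\beta]}+4P^h_{\mu[\alpha}(\delta A)_{\beta]}{}^\mu-2A^{\gamma\mu}{}_{[\alpha}\nabla^h_{\beta]}P^h_{\gamma\mu}=0\quad(n=2).$$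
   Context: $\mathcal E[w]=(\wedge^nT^*M)^{-w/n}$ is the conformal density bundle; appending $[w]$ means tensoring with $\mathcal E[w]$; $\boldsymbol h_{\alpha\beta}\in\mathcal E_{(\alpha\beta)}[2]$ is the conformal metric, used to raise and lower indices. A conformal scale is a positive section $\kappa$ of $\mathcal E[1]$; it gives the metric $h=\kappa^{-2}\boldsymbol h\in[h]$ with Levi-Civita connection $\nabla^h$ (acting on densities with $\nabla^h\kappa=0$) and curvature $(\nabla^h_\alpha\nabla^h_\beta-\nabla^h_\beta\nabla^h_\alpha)X^\gamma=R^h_{\alpha\beta}{}^\gamma{}_\delta X^\delta$, $\mathrm{Ric}^h_{\beta\delta}=R^h_{\alpha\beta}{}^\alpha{}_\delta$, $\mathrm{Scal}_h=\boldsymbol h^{\alpha\beta}\mathrm{Ric}^h_{\alpha\beta}$. Parentheses/brackets on indices denote symmetrization/skew-symmetrization, $\mathcal E_{(\alpha\beta\gamma)_0}$ trace-free symmetric tensors, $\mathrm{tf}$ the trace-free part. $(\delta A)_{\alpha\beta}=\nabla^h_\gamma A_{\alpha\beta}{}^\gamma$, $(\delta^2A)_\alpha=\nabla^h_\gamma(\delta A)_\alpha{}^\gamma$, $|A|^2=A_{\alpha\beta\gamma}A^{\alpha\beta\gamma}$. For $n\ge3$, $P^h_{\alpha\beta}=\frac1{n-2}\bigl(\mathrm{Ric}^h_{\alpha\beta}-\frac{\mathrm{Scal}_h}{2(n-1)}\boldsymbol h_{\alpha\beta}\bigr)$. For $n=2$, a Möbius structure $[\mathbb P]$ assigns to each conformal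 scale $\kappa$ a symmetric tensor $\mathbb P_{\alpha\beta}$ with $\mathbb P_\alpha{}^\alpha=\frac12\mathrm{Scal}_h$ and, for $\hat\kappa=e^{-\Upsilon}\kappa$, $\hat{\mathbb P}_{\alpha\beta}=\mathbb P_{\alpha\beta}-\nabla^h_\alpha\Upsilon_\beta+\Upsilon_\alpha\Upsilon_\beta-\frac12\Upsilon_\gamma\Upsilon^\gamma\boldsymbol h_{\alpha\beta}$; one sets $P^h_{\alpha\beta}:=\mathbb P_{\alpha\beta}$. $Y_{\alpha\beta\gamma}=\nabla^h_{[\alpha}P^h_{\beta]\gamma}$; $W^h_{\alpha\beta\gamma\delta}=R^h_{\alpha\beta\gamma\delta}-2(\boldsymbol h_{\gamma[\alpha}P^h_{\beta]\delta}-\boldsymbol h_{\delta[\alpha}P^h_{\beta]\gamma})$. Conformal tractor bundle: in a scale $\kappa$, $\mathcal E^I=\mathcal E[1]\oplus\mathcal E^\alpha[-1]\oplus\mathcal E[-1]\ni{}^t(\sigma,\mu^\alpha,\varphi)$; for $\hat\kappa=e^{-\Upsilon}\kappa$ the components become ${}^t(\sigma,\ \mu^\alpha+\Upsilon^\alpha\sigma,\ \varphi-\Upsilon_\gamma\mu^\gamma-\frac12\Upsilon_\gamma\Upsilon^\gamma\sigma)$, with $\Upsilon_\alpha=\nabla^h_\alpha\Upsilon$. The conformal (Möbius) tractor connection is $$\nabla_\alpha\begin{pmatrix} \sigma \\ \mu^\beta \\ \varphi \end{pmatrix}=\begin{pmatrix} \nabla^h_\alpha\sigma-\mu_\alpha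 \\ \nabla^h_\alpha\mu^\beta+\delta_\alpha{}^\beta\varphi+P^h_\alpha{}^\beta\sigma \\ \nabla^h_\alpha\varphi-P^h_{\alpha\gamma}\mu^\gamma \end{pmatrix}.$$ The matrix $\tilde A_{\alpha K}{}^J$ acts on column vectors ${}^t(\sigma,\mu^\gamma,\varphi)$, i.e. $\tilde A_{\alpha K}{}^JU^K={}^t(0,\ E_\alpha{}^\beta\sigma+A_{\alpha\gamma}{}^\beta\mu^\gamma,\ F_\alpha\sigma+G_{\alpha\gamma}\mu^\gamma)$. *)

(* Defs.v *)
From HB Require Import structures.
From mathcomp Require Import all_boot all_order all_algebra.
From mathcomp Require Import all_classical all_reals all_analysis.

Set Implicit Arguments.
Unset Strict Implicit.
Unset Printing Implicit Defensive.

Import Order.TTheory GRing.Theory Num.Theory.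
Import numFieldNormedType.Exports.

Local Open Scope classical_set_scope.
Local Open Scope ring_scope.

(** Smooth manifolds are given by an atlas; tensor fields and densities are
    families of component functions, one for each chart, obeying the
    transformation law on overlaps.  Components live on the coordinate image
    [img i] of the chart [i]; their values outside [img i] are irrelevant. *)

Definition pd (R : realType) (n : nat) (a : 'I_n) (f : 'rV[R]_n -> R)
  (x : 'rV[R]_n) : R := 'D_(delta_mx 0 a) f x.

(** C^oo on the open set [D]: every iterated partial derivative is (Frechet)
    differentiable at every point of [D]. *)
Definition smooth_on (R : realType) (n : nat) (D : set 'rV[R]_n)
  (f : 'rV[R]_n -> R) : Prop :=
  forall (s : seq 'I_n) x, D x -> differentiable (foldr (@pd R n) f s) x.

Record manifold (R : realType) (n : nat) := Manifold {
  carrier :> topologicalType;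
  carrier_hausdorff : hausdorff_space carrier;
  carrier_countable : @second_countable carrier;
  chart : Type;
  dom : chart -> set carrier;
  coord : chart -> carrier -> 'rV[R]_n;
  param : chart -> 'rV[R]_n -> carrier;
  dom_open : forall i, open (dom i);
  dom_cover : forall p, exists i, dom i p;
  coord_open : forall i, open (coord i @` dom i);
  coordK : forall i p, dom i p -> param i (coord i p) = p;
  coord_continuous : forall i p, dom i p -> {for p, continuous (coord i)};
  param_continuous : forall i x, (coord i @` dom i) x ->
    {for x, continuous (param i)};
  trans_smooth : forall i j b,
    smooth_on [set x | (coord i @` dom i) x /\ dom j (param i x)]
              (fun x => coord j (param i x) 0 b)
}.

Section Fields.
Variables (R : realType) (n : nat) (M : manifold R n).
Implicit Types (i j : chart M) (x : 'rV[R]_n) (w : R).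

Definition img i : set 'rV[R]_n := coord i @` dom i.

Definition overlap i j : set 'rV[R]_n :=
  [set x | img i x /\ dom j (param i x)].

Definition trans i j x : 'rV[R]_n := coord j (param i x).

(** [jac i j x b a] is d y^b / d x^a, with x and y the coordinates of the
    charts i and j. *)
Definition jac i j x : 'M[R]_n :=
  \matrix_(b, a) pd a (fun z => trans i j z 0 b) x.

(** E[w] is the (-w/n)-th power of the bundle of volume densities: the section
    with component f in the chart x is f |dx^1 ... dx^n|^(-w/n).  Real weights
    make sense because only absolute values of Jacobians enter. *)
Definition wfactor w i j x : R := `|\det (jac i j x)| `^ (- w / n%:R).

(** Sections of E[w], E_a[w], E_ab[w] and E_abc[w]. *)
Record density w := Density {
  dens :> chart M -> 'rV[R]_n -> R;
  dens_smooth : forall i, smooth_on (img i) (dens i);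
  dens_law : forall i j x, overlap i j x ->
    dens i x = wfactor w i j x * dens j (trans i j x)
}.

Record covector w := Covector {
  cov :> chart M -> 'I_n -> 'rV[R]_n -> R;
  cov_smooth : forall i a, smooth_on (img i) (cov i a);
  cov_law : forall i j a x, overlap i j x ->
    cov i a x = wfactor w i j x *
      \sum_(d < n) jac i j x d a * cov j d (trans i j x)
}.

Record tensor2 w := Tensor2 {
  ten2 :> chart M -> 'I_n -> 'I_n -> 'rV[R]_n -> R;
  ten2_smooth : forall i a b, smooth_on (img i) (ten2 i a b);
  ten2_law : forall i j a b x, overlap i j x ->
    ten2 i a b x = wfactor w i j x *
      \sum_(d < n) \sum_(e < n)
        jac i j x d a * jac i j x e b * ten2 j d e (trans i j x)
}.

Record tensor3 w := Tensor3 {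
  ten3 :> chart M -> 'I_n -> 'I_n -> 'I_n -> 'rV[R]_n -> R;
  ten3_smooth : forall i a b c, smooth_on (img i) (ten3 i a b c);
  ten3_law : forall i j a b c x, overlap i j x ->
    ten3 i a b c x = wfactor w i j x *
      \sum_(d < n) \sum_(e < n) \sum_(f < n)
        jac i j x d a * jac i j x e b * jac i j x f c *
        ten3 j d e f (trans i j x)
}.

Definition symmetric2 w (T : tensor2 w) : Prop :=
  forall i x, img i x -> forall a b, T i a b x = T i b a x.

Definition symmetric3 w (T : tensor3 w) : Prop :=
  forall i x, img i x -> forall a b c,
    T i a b c x = T i b a c x /\ T i a b c x = T i a c b x.

(** A conformal structure is given by its conformal metric, the section of
    E_(ab)[2] for which the metrics of the class are kappa^-2 h_ab, with kappa
    a positive section of E[1].  The determinant of a section of E_ab[2] is a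
    function, and it is +1 or -1 for the conformal metric, since kappa^-n is
    the volume density of kappa^-2 h_ab.  The signature is arbitrary. *)
Record conformal := Conformal {
  cmetric :> tensor2 2;
  cmetric_sym : symmetric2 cmetric;
  cmetric_det : forall i x, img i x ->
    `|\det (\matrix_(a, b) cmetric i a b x)| = 1
}.

Record scale := Scale {
  kappa :> density 1;
  kappa_gt0 : forall i x, img i x -> 0 < kappa i x
}.

(** The function Upsilon with khat = exp (- Upsilon) k, in the chart [i]. *)
Definition Upsilon (k khat : scale) i x : R := ln (k i x / khat i x).

End Fields.

Definition skew2 (R : realType) (n : nat) (T : 'I_n -> 'I_n -> R) (a b : 'I_n)
  : R := 2^-1 * (T a b - T b a).

(** Tensor calculus of a scale in one chart.  [bh g] are the components of the
    conformal metric, which raises and lowers indices and has weight 2;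
    [ks g] is the component of the conformal scale. *)
Record geom (R : realType) (n : nat) := Geom {
  bh : 'I_n -> 'I_n -> 'rV[R]_n -> R;
  ks : 'rV[R]_n -> R
}.

Section Calculus.
Variables (R : realType) (n : nat) (g : geom R n).
Implicit Types (x : 'rV[R]_n) (w : R) (a b c d : 'I_n).

Definition bhinv a b x : R := invmx (\matrix_(c, d) bh g c d x) a b.

Definition metric a b x : R := ks g x ^- 2 * bh g a b x.

(** [christoffel c a b] is Gamma^c_ab, for the metric kappa^-2 h_ab. *)
Definition christoffel c a b x : R :=
  2^-1 * \sum_(d < n) invmx (\matrix_(e, f) metric e f x) c d *
    (pd a (metric b d) x + pd b (metric a d) x - pd d (metric a b) x).

(** Covariant derivatives of weighted fields.  On a section f of E[w] the
    condition nabla kappa = 0 gives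
    nabla_a f = kappa^w d_a (kappa^-w f) = d_a f - w kappa^-1 (d_a kappa) f.
    The index of differentiation is the first of [nabla1], [nabla2] and
    [nabla3]; [nablaV w V a c] is nabla_a V^c, for V in E^c[w]. *)
Definition nabla0 w (f : 'rV[R]_n -> R) a x : R :=
  pd a f x - w * (pd a (ks g) x / ks g x) * f x.

Definition nabla1 w (T : 'I_n -> 'rV[R]_n -> R) a b x : R :=
  nabla0 w (T b) a x - \sum_(e < n) christoffel e a b x * T e x.

Definition nabla2 w (T : 'I_n -> 'I_n -> 'rV[R]_n -> R) a b c x : R :=
  nabla0 w (T b c) a x - \sum_(e < n) christoffel e a b x * T e c x
                       - \sum_(e < n) christoffel e a c x * T b e x.

Definition nabla3 w (T : 'I_n -> 'I_n -> 'I_n -> 'rV[R]_n -> R) a b c d x : R :=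
  nabla0 w (T b c d) a x - \sum_(e < n) christoffel e a b x * T e c d x
                         - \sum_(e < n) christoffel e a c x * T b e d x
                         - \sum_(e < n) christoffel e a d x * T b c e x.

Definition nablaV w (V : 'I_n -> 'rV[R]_n -> R) a c x : R :=
  nabla0 w (V c) a x + \sum_(e < n) christoffel c a e x * V e x.

(** Contractions with the inverse conformal metric. *)
Definition ip1 x (u v : 'I_n -> R) : R :=
  \sum_(c < n) \sum_(d < n) bhinv c d x * u c * v d.

Definition ip2 x (S T : 'I_n -> 'I_n -> R) : R :=
  \sum_(c < n) \sum_(d < n) \sum_(e < n) \sum_(f < n)
    bhinv c e x * bhinv d f x * S c d * T e f.

Definition tr2 x (T : 'I_n -> 'I_n -> R) : R :=
  \sum_(a < n) \sum_(b < n) bhinv a b x * T a b.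

(** [riem a b c d] is R_ab^c_d, the component along d_c of
    nabla_a nabla_b X - nabla_b nabla_a X for the coordinate field X = d_d. *)
Definition riem a b c d x : R :=
  let X : 'I_n -> 'rV[R]_n -> R := fun e _ => (e == d)%:R in
  nablaV 0 (nablaV 0 X b) a c x - nablaV 0 (nablaV 0 X a) b c x.

Definition riem_low a b c d x : R :=
  \sum_(e < n) bh g c e x * riem a b e d x.

Definition ric b d x : R := \sum_(a < n) riem a b a d x.

Definition scal x : R := tr2 x (fun b d => ric b d x).

Definition schouten a b x : R :=
  (n%:R - 2)^-1 * (ric a b x - scal x / (2 * (n%:R - 1)) * bh g a b x).

(** 2 (h_c[a Q_b]d - h_d[a Q_b]c) *)
Definition kulkarni x (Q : 'I_n -> 'I_n -> R) a b c d : R :=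
  2 * (skew2 (fun a b => bh g c a x * Q b d) a b
       - skew2 (fun a b => bh g d a x * Q b c) a b).

Definition tf2 x (T : 'I_n -> 'I_n -> R) a b : R :=
  T a b - n%:R^-1 * tr2 x T * bh g a b x.

(** Trace-free part, for n >= 3, of a tensor T_abcd with the symmetries of a
    curvature tensor: what remains after removing the unique [kulkarni] term
    with the same traces, exactly as Weyl is obtained from Riemann. *)
Definition tf4 x (T : 'I_n -> 'I_n -> 'I_n -> 'I_n -> R) a b c d : R :=
  let r := fun b d => tr2 x (fun a c => T a b c d) in
  T a b c d - kulkarni x (fun a b => (n%:R - 2)^-1 *
    (r a b - tr2 x r / (2 * (n%:R - 1)) * bh g a b x)) a b c d.

Section Rho.
Variable P : 'I_n -> 'I_n -> 'rV[R]_n -> R.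

Definition weyl a b c d x : R :=
  riem_low a b c d x - kulkarni x (fun a b => P a b x) a b c d.

Definition cotton a b c x : R := skew2 (fun a b => nabla2 0 P a b c x) a b.

(** A local section of the tractor bundle, in the splitting
    E[1] + E^a[-1] + E[-1] given by a scale, and in a chart. *)
Record slots := Slots {
  sigma : 'rV[R]_n -> R;
  mu : 'I_n -> 'rV[R]_n -> R;
  phi : 'rV[R]_n -> R
}.

Definition tractor_nabla a (U : slots) : slots := Slots
  (fun x => nabla0 1 (sigma U) a x - \sum_(c < n) bh g a c x * mu U c x)
  (fun b x => nablaV (-1) (mu U) a b x + (a == b)%:R * phi U x
              + (\sum_(c < n) bhinv b c x * P a c x) * sigma U x)
  (fun x => nabla0 (-1) (phi U) a x - \sum_(c < n) P a c x * mu U c x).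

End Rho.

Section Deformation.
Variables (P E G : 'I_n -> 'I_n -> 'rV[R]_n -> R).
Variables (A : 'I_n -> 'I_n -> 'I_n -> 'rV[R]_n -> R) (F : 'I_n -> 'rV[R]_n -> R).

Definition tildeA a (U : slots) : slots := Slots
  (fun=> 0)
  (fun b x => (\sum_(c < n) bhinv b c x * E a c x) * sigma U x
    + \sum_(c < n) (\sum_(d < n) bhinv b d x * A a c d x) * mu U c x)
  (fun x => F a x * sigma U x + \sum_(c < n) G a c x * mu U c x).

Definition bold_nabla a (U : slots) : slots :=
  let V := tractor_nabla P a U in let W := tildeA a U in
  Slots (fun x => sigma V x - sigma W x) (fun b x => mu V b x - mu W b x)
        (fun x => phi V x - phi W x).

End Deformation.

Section Cubic.
Variable A : 'I_n -> 'I_n -> 'I_n -> 'rV[R]_n -> R.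

(** [A] has weight 2; delta A has weight 0, |A|^2 weight -2. *)
Definition delta a b x : R :=
  tr2 x (fun c d => nabla3 2 A c a b d x).

Definition delta2 a x : R :=
  tr2 x (fun c d => nabla2 0 delta c a d x).

Definition AA a b x : R := ip2 x (fun c d => A a c d x) (fun c d => A b c d x).

Definition normsq x : R := tr2 x (fun a b => AA a b x).

Definition PA a b x : R :=
  if n == 2%N then 4^-1 * normsq x * bh g a b x
  else (n%:R - 2)^-1 * (AA a b x - normsq x / (2 * (n%:R - 1)) * bh g a b x).

End Cubic.

End Calculus.

Section Conformal.
Variables (R : realType) (n : nat) (M : manifold R n) (C : conformal M).

Definition local (k : scale M) (i : chart M) : geom R n := Geom (C i) (k i).

Record mobius := Mobius {
  mob :> scale M -> tensor2 M 0;
  mob_sym : forall k, symmetric2 (mob k);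
  mob_trace : forall k i x, img i x ->
    tr2 (local k i) x (fun a b => mob k i a b x) = 2^-1 * scal (local k i) x;
  mob_law : forall k khat i x, img i x -> forall a b,
    let dU := fun a x => pd a (Upsilon k khat i) x in
    mob khat i a b x = mob k i a b x - nabla1 (local k i) 0 dU a b x
      + dU a x * dU b x
      - 2^-1 * ip1 (local k i) x (dU ^~ x) (dU ^~ x) * C i a b x
}.

(** The tensor P_ab: the Schouten tensor when n >= 3, the tensor prescribed by
    the Moebius structure when n = 2. *)
Definition rho (Mo : n = 2%N -> mobius) (k : scale M) (i : chart M)
  : 'I_n -> 'I_n -> 'rV[R]_n -> R :=
  match n =P 2%N with
  | ReflectT n2 => mob (Mo n2) k i
  | ReflectF _ => schouten (local k i)
  end.

(** Smooth sections of the tractor bundle over the domain of the chart [i]. *)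
Record tractor (i : chart M) := Tractor {
  slot :> scale M -> slots R n;
  slot_smooth : forall k, [/\ smooth_on (img i) (sigma (slot k)),
    forall a, smooth_on (img i) (mu (slot k) a) &
    smooth_on (img i) (phi (slot k))];
  slot_law : forall k khat x, img i x ->
    let dU := fun a => pd a (Upsilon k khat i) x in
    [/\ sigma (slot khat) x = sigma (slot k) x,
      forall a, mu (slot khat) a x = mu (slot k) a x
        + (\sum_(c < n) bhinv (local k i) a c x * dU c) * sigma (slot k) x &
      phi (slot khat) x = phi (slot k) x - \sum_(c < n) dU c * mu (slot k) c x
        - 2^-1 * ip1 (local k i) x dU dU * sigma (slot k) x]
}.

(** Vanishing of the curvature of a connection, given in the scale [k] by its
    action [D i a] along the coordinate fields d_a of the charts [i].
    Coordinate fields commute, so that the curvature is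
    D_a D_b - D_b D_a. *)
Definition flat (k : scale M) (D : chart M -> 'I_n -> slots R n -> slots R n)
  : Prop :=
  forall i (U : tractor i) x, img i x -> forall a b,
    let V := D i a (D i b (U k)) in let W := D i b (D i a (U k)) in
    [/\ sigma V x = sigma W x, forall c, mu V c x = mu W c x &
        phi V x = phi W x].

End Conformal.

Arguments flat {R n M} C k D.

(* Main.v *)
Require Import Defs.
From HB Require Import structures.
From mathcomp Require Import all_boot all_order all_algebra.
From mathcomp Require Import all_classical all_reals all_analysis.
From mathcomp Require Import ring lra.
Import Order.TTheory GRing.Theory Num.Theory.
Import numFieldNormedType.Exports.
Local Open Scope ring_scope.

Set Implicit Arguments.
Unset Strict Implicit.
Unset Printing Implicit Defensive.

(* In the splitting of a scale the connection acts on slots (sigma, mu, phi) by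
   tensors Q = P - E, S = P + G, A and F, and its curvature has four tensors as
   coefficients: X (sigma to mu), Y (mu to mu), N (sigma to phi), Z (mu to phi).
   The part of Y_abcd symmetric in cd is the Codazzi equation, the skew part is
   the Gauss equation, and their traces give E and G; the trace of X + Z gives F.
   Conversely, for n >= 3 the Jacobi identity of the connection, evaluated on
   mu and on sigma, expresses that h_[e|c| Z_ab]d + X_[ab|c| h_e]d = 0 as soon as
   Y = 0.  Its traces give X + Z = 0, then X = 0 for n >= 4, and then N = 0.  In
   dimensions 2 and 3 the tensors that must vanish are determined by their
   traces.
   All computations take place in a commutative ring with commuting derivations;
   it is instantiated by the smooth functions on the image of a chart. *)

(** * Contractions with a metric *)

(** The dimensions separate because of coefficients in the traces. Once X + Z = 0, the Jacobi
    identity says that (n - 3) X is a pure trace, and later that (n - 2) N = 0. In dimension 3 the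
    first says nothing about the trace-free part of X, so X - Z = 0 has to be imposed: this is the
    differential Gauss equation, while the algebraic one becomes automatic. In dimension 2 N escapes
    as well, and N = 0 is the second-order Codazzi equation. The same n - 2 multiplies E - G in the
    trace of the skew part of Y, so in dimension 2 this trace determines only the trace of E - G;
    the trace-free part vanishes by assumption. A pure trace in E + G cancels from the symmetric
    part of Y in every dimension, whence the normalisation of the trace of E + G. E + G = S - Q and
    2P - (E - G) = S + Q are the natural unknowns: exchanging the last two indices of Y exchanges S
    and Q up to sign, so S - Q goes to the Codazzi part and S + Q to the Gauss part. The same sums
    and differences separate X and Z, F being left only in X + Z. *)

Section MetricAlgebra.
Variables (K : comUnitRingType) (n : nat) (h H : 'I_n -> 'I_n -> K).
Hypothesis h_sym : forall a b, h a b = h b a.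
Hypothesis H_sym : forall a b, H a b = H b a.
Hypothesis hH : forall a b, \sum_(c < n) h a c * H c b = (a == b)%:R.
Implicit Types (T : 'I_n -> 'I_n -> K) (u v w : 'I_n -> K).

Definition atr T : K := \sum_(a < n) \sum_(b < n) H a b * T a b.
Definition adot u v : K := \sum_(c < n) \sum_(d < n) H c d * u c * v d.
Definition adot2 S T : K :=
  \sum_(c < n) \sum_(d < n) \sum_(e < n) \sum_(f < n)
    H c e * H d f * S c d * T e f.

Lemma sum_delta (a : 'I_n) (f : 'I_n -> K) :
  \sum_(c < n) (a == c)%:R * f c = f a.
Proof.
rewrite (bigD1 a) //= eqxx mul1r big1 ?addr0 // => i.
by rewrite eq_sym => /negbTE ->; rewrite mul0r.
Qed.

Lemma Hh a b : \sum_(c < n) H a c * h c b = (a == b)%:R.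
Proof.
rewrite eq_sym -hH; apply: eq_bigr => c _.
by rewrite mulrC h_sym H_sym.
Qed.

Lemma eq_tr T T' : (forall a b, T a b = T' a b) -> atr T = atr T'.
Proof. by move=> e; apply: eq_bigr => a _; apply: eq_bigr => b _; rewrite e. Qed.

Lemma tr0 : atr (fun _ _ => 0) = 0.
Proof. by rewrite /atr big1 // => a _; rewrite big1 // => b _; rewrite mulr0. Qed.

Lemma trD T T' : atr (fun a b => T a b + T' a b) = atr T + atr T'.
Proof.
rewrite -big_split; apply: eq_bigr => a _ /=; rewrite -big_split.
by apply: eq_bigr => b _ /=; rewrite mulrDr.
Qed.

Lemma trN T : atr (fun a b => - T a b) = - atr T.
Proof.
rewrite /atr -sumrN; apply: eq_bigr => a _ /=; rewrite -sumrN.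
by apply: eq_bigr => b _ /=; rewrite mulrN.
Qed.

Lemma trB T T' : atr (fun a b => T a b - T' a b) = atr T - atr T'.
Proof. by rewrite trD trN. Qed.

Lemma trZl c T : atr (fun a b => c * T a b) = c * atr T.
Proof.
rewrite mulr_sumr; apply: eq_bigr => a _ /=; rewrite mulr_sumr.
by apply: eq_bigr => b _ /=; rewrite mulrCA.
Qed.

Lemma trZr c T : atr (fun a b => T a b * c) = atr T * c.
Proof. by rewrite mulrC -trZl; apply: eq_tr => a b; rewrite mulrC. Qed.

Lemma tr_sum (I : finType) (T : I -> 'I_n -> 'I_n -> K) :
  atr (fun a b => \sum_i T i a b) = \sum_i atr (T i).
Proof.
rewrite exchange_big /=; apply: eq_bigr => a _.
rewrite exchange_big /=; apply: eq_bigr => b _.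
by rewrite mulr_sumr.
Qed.

Lemma trC T : atr (fun a b => T b a) = atr T.
Proof.
rewrite /atr exchange_big; apply: eq_bigr => a _; apply: eq_bigr => b _.
by rewrite H_sym.
Qed.

Lemma dotE u v : adot u v = atr (fun c d => u c * v d).
Proof. by apply: eq_bigr => a _; apply: eq_bigr => b _; rewrite mulrA. Qed.

Lemma eq_dot u u' v v' : (forall a, u a = u' a) -> (forall a, v a = v' a) ->
  adot u v = adot u' v'.
Proof. by move=> e f; rewrite !dotE; apply: eq_tr => a b; rewrite e f. Qed.

Lemma dotC u v : adot u v = adot v u.
Proof. by rewrite !dotE -trC; apply: eq_tr => a b; rewrite mulrC. Qed.

Lemma dotDr u v w : adot u (fun a => v a + w a) = adot u v + adot u w.
Proof. by rewrite !dotE -trD; apply: eq_tr => a b; rewrite mulrDr. Qed.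

Lemma dotNr u v : adot u (fun a => - v a) = - adot u v.
Proof. by rewrite !dotE -trN; apply: eq_tr => a b; rewrite mulrN. Qed.

Lemma dotBr u v w : adot u (fun a => v a - w a) = adot u v - adot u w.
Proof. by rewrite dotDr dotNr. Qed.

Lemma dotZr u c v : adot u (fun a => c * v a) = c * adot u v.
Proof. by rewrite !dotE -trZl; apply: eq_tr => a b; rewrite mulrCA. Qed.

Lemma dotZrr u c v : adot u (fun a => v a * c) = adot u v * c.
Proof. by rewrite mulrC -dotZr; apply: eq_dot => // a; rewrite mulrC. Qed.

Lemma dot0r u : adot u (fun=> 0) = 0.
Proof. by rewrite dotE; under eq_tr do rewrite mulr0; rewrite tr0. Qed.

Lemma dotDl u v w : adot (fun a => v a + w a) u = adot v u + adot w u.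
Proof. by rewrite !(dotC _ u) dotDr. Qed.

Lemma dotNl u v : adot (fun a => - v a) u = - adot v u.
Proof. by rewrite !(dotC _ u) dotNr. Qed.

Lemma dotBl u v w : adot (fun a => v a - w a) u = adot v u - adot w u.
Proof. by rewrite dotDl dotNl. Qed.

Lemma dotZl u c v : adot (fun a => c * v a) u = c * adot v u.
Proof. by rewrite !(dotC _ u) dotZr. Qed.

Lemma dot0l u : adot (fun=> 0) u = 0.
Proof. by rewrite dotC dot0r. Qed.

Lemma dot_suml (I : finType) (u : I -> 'I_n -> K) v :
  adot (fun a => \sum_i u i a) v = \sum_i adot (u i) v.
Proof.
rewrite dotE; under [RHS]eq_bigr do rewrite dotE.
by rewrite -tr_sum; apply: eq_tr => a b; rewrite mulr_suml.
Qed.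

Lemma dot_sumr (I : finType) (u : I -> 'I_n -> K) v :
  adot v (fun a => \sum_i u i a) = \sum_i adot v (u i).
Proof. by rewrite dotC dot_suml; apply: eq_bigr => i _; rewrite dotC. Qed.

(** Raising an index with [H] undoes lowering it with [h]. The rows of [h] thus act as basis
    vectors; inserting them reads off components. *)
Lemma dot_h a v : adot (h a) v = v a.
Proof.
rewrite /adot exchange_big /= -[RHS](sum_delta a); apply: eq_bigr => d _.
by rewrite -hH mulr_suml; apply: eq_bigr => c _; ring.
Qed.

Lemma dot_hr a v : adot v (h a) = v a.
Proof. by rewrite dotC dot_h. Qed.

Lemma dot_h' a v : adot (h^~ a) v = v a.
Proof. by rewrite -dot_h; apply: eq_dot => // b; rewrite h_sym. Qed.

Lemma dot_nondeg u : (forall v, adot u v = 0) -> forall a, u a = 0.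
Proof. by move=> e a; rewrite -(dot_hr a u). Qed.

Lemma tr_h : atr h = n%:R.
Proof.
rewrite /atr (eq_bigr (fun=> 1)) ?sumr_const ?card_ord // => a _.
transitivity (\sum_b H a b * h b a); last by rewrite Hh eqxx.
by apply: eq_bigr => b _; rewrite h_sym.
Qed.

Lemma dot2E S T : adot2 S T = atr (fun c e => adot (S c) (T e)).
Proof.
apply: eq_bigr => c _; rewrite exchange_big; apply: eq_bigr => e _ /=.
rewrite mulr_sumr; apply: eq_bigr => d _; rewrite mulr_sumr.
by apply: eq_bigr => f _; rewrite !mulrA.
Qed.

Lemma eq_dot2 S S' T T' : (forall a b, S a b = S' a b) ->
  (forall a b, T a b = T' a b) -> adot2 S T = adot2 S' T'.
Proof. by move=> e f; rewrite !dot2E; apply: eq_tr => a b; apply: eq_dot. Qed.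

Lemma dot2C S T : adot2 S T = adot2 T S.
Proof. by rewrite !dot2E -trC; apply: eq_tr => a b; rewrite dotC. Qed.

Lemma tr_trC (T : 'I_n -> 'I_n -> 'I_n -> 'I_n -> K) :
  atr (fun a b => atr (T a b)) = atr (fun c e => atr (fun a b => T a b c e)).
Proof.
rewrite {1 2}/atr.
under eq_bigr => a _ do under eq_bigr => b _ do rewrite -trZl.
under eq_bigr => a _ do rewrite -tr_sum.
rewrite -tr_sum; apply: eq_tr => c e.
by apply: eq_bigr => a _; apply: eq_bigr => b _.
Qed.

Lemma dot_tr u (T : 'I_n -> 'I_n -> 'I_n -> K) :
  adot u (fun c => atr (T c)) = atr (fun a b => adot u (fun c => T c a b)).
Proof.
rewrite dotE.
rewrite (eq_tr (T' := fun c d => atr (fun a b => u c * T d a b))); last first.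
  by move=> c d; rewrite trZl.
by rewrite tr_trC; apply: eq_tr => a b; rewrite dotE.
Qed.

Lemma dot2DR S T T' : adot2 S (fun a b => T a b + T' a b) = adot2 S T + adot2 S T'.
Proof. by rewrite !dot2E -trD; apply: eq_tr => a b; rewrite dotDr. Qed.

Lemma dot2ZR S c T : adot2 S (fun a b => c * T a b) = c * adot2 S T.
Proof. by rewrite !dot2E -trZl; apply: eq_tr => a b; rewrite dotZr. Qed.

Lemma dot2NR S T : adot2 S (fun a b => - T a b) = - adot2 S T.
Proof. by rewrite !dot2E -trN; apply: eq_tr => a b; rewrite dotNr. Qed.

Lemma dot2BR S T T' : adot2 S (fun a b => T a b - T' a b) = adot2 S T - adot2 S T'.
Proof. by rewrite dot2DR dot2NR. Qed.

Lemma dot2_h S : adot2 S h = atr S.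
Proof. by rewrite dot2E; apply: eq_tr => a b; rewrite dot_hr. Qed.

Lemma dot2_sym S T : (forall a b, T a b = T b a) ->
  adot2 S T = adot2 (fun a b => S b a) T.
Proof.
move=> Ts; rewrite /adot2 exchange_big /=.
under eq_bigr => d _ do under eq_bigr => c _ do rewrite exchange_big /=.
apply: eq_bigr => d _; apply: eq_bigr => c _; apply: eq_bigr => f _.
apply: eq_bigr => e _; rewrite Ts; ring.
Qed.

Lemma tr_hl b u : atr (fun a c => h a b * u c) = u b.
Proof. by rewrite -(dot_h' b u) dotE. Qed.

Lemma tr_hl' b u : atr (fun a c => h b a * u c) = u b.
Proof. by rewrite -(dot_h b u) dotE. Qed.

Lemma tr_hr b u : atr (fun a c => h b c * u a) = u b.
Proof. by rewrite -(tr_hl' b u) -[RHS]trC. Qed.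

(** The Kulkarni-Nomizu product of [h] and [Q], expanded so that no halves occur. *)
Definition kn Q a b c d :=
  h c a * Q b d - h c b * Q a d - h d a * Q b c + h d b * Q a c.

Lemma eq_kn Q Q' : (forall a b, Q a b = Q' a b) ->
  forall a b c d, kn Q a b c d = kn Q' a b c d.
Proof. by move=> e a b c d; rewrite /kn !e. Qed.

(** The coefficient [n - 2] is where dimension 2 becomes special: there only the trace of [Q]
    survives. *)
Lemma tr_kn Q b d : (forall a b, Q a b = Q b a) ->
  atr (fun a c => kn Q a b c d) = (n%:R - 2) * Q b d + atr Q * h b d.
Proof.
move=> Qs; rewrite trD 2!trB trZr trZl (eq_tr (fun a c => h_sym c a)) tr_h.
rewrite -(trC (fun a c => h c b * _)) /=.
have -> : atr (fun a c => h a b * Q c d) = Q b d.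
  by rewrite -(dot_h' b (Q^~ d)) dotE.
have -> : atr (fun a c => h d a * Q b c) = Q b d by rewrite -(dot_h d) dotE.
by rewrite (h_sym d b); ring.
Qed.

End MetricAlgebra.

(** * Dimensions two and three *)

Section LowDimension.
Variable K : comUnitRingType.
Hypothesis two_unit : (2 : K) \is a GRing.unit.

Lemma ord2_ind (P : 'I_2 -> Prop) :
  P ord0 -> P (lift ord0 ord0) -> forall i, P i.
Proof.
move=> P0 P1 [[|[|//]] lt].
- by rewrite (_ : Ordinal lt = ord0) //; apply: val_inj.
- by rewrite (_ : Ordinal lt = lift ord0 ord0) //; apply: val_inj.
Qed.

Lemma ord3_ind (P : 'I_3 -> Prop) :
  P ord0 -> P (lift ord0 ord0) -> P (lift ord0 (lift ord0 ord0)) ->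
  forall i, P i.
Proof.
move=> P0 P1 P2 [[|[|[|//]]] lt].
- by rewrite (_ : Ordinal lt = ord0) //; apply: val_inj.
- by rewrite (_ : Ordinal lt = lift ord0 ord0) //; apply: val_inj.
- by rewrite (_ : Ordinal lt = lift ord0 (lift ord0 ord0)) //; apply: val_inj.
Qed.

Lemma opp_eq0 (x : K) : x = - x -> x = 0.
Proof.
by move=> e; apply: (mulrI two_unit); rewrite mulr0 mulr_natl mulr2n {2}e subrr.
Qed.

(** Skewness leaves the single covector [D 0 1 c]. The two trace conditions say that [H] annihilates
    it, and [H] is invertible. *)
Lemma skew3_dim2 n (n2 : n = 2%N) (h H : 'I_n -> 'I_n -> K)
    (D : 'I_n -> 'I_n -> 'I_n -> K) :
  (forall a b, \sum_c h a c * H c b = (a == b)%:R) ->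
  (forall a b c, D a b c = - D b a c) -> (forall a, atr H (D a) = 0) ->
  forall a b c, D a b c = 0.
Proof.
subst n; move=> hH skew tr0.
have diag a c : D a a c = 0 by apply: opp_eq0; apply: skew.
set o1 := lift ord0 ord0 : 'I_2.
have Hu b : \sum_c H b c * D ord0 o1 c = 0.
  elim/ord2_ind: b.
  - have := tr0 o1; rewrite /atr big_ord_recl big_ord1 [X in _ + X]big1.
      rewrite addr0 => e; rewrite -[RHS]oppr0 -{}[in RHS]e -sumrN.
      by apply: eq_bigr => c _; rewrite skew mulrN.
    by move=> c _; rewrite diag mulr0.
  - have := tr0 ord0; rewrite /atr big_ord_recl big_ord1 big1 ?add0r //.
    by move=> c _; rewrite diag mulr0.
have D01 c : D ord0 o1 c = 0.
  rewrite -(sum_delta c (D ord0 o1)).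
  under eq_bigr => e _ do rewrite -hH mulr_suml.
  rewrite exchange_big big1 // => e _ /=.
  by under eq_bigr do rewrite -mulrA; rewrite -mulr_sumr Hu mulr0.
elim/ord2_ind => b c; elim/ord2_ind: b.
- exact: diag.
- exact: D01.
- by rewrite skew D01 oppr0.
- exact: diag.
Qed.

(** Only [D 0 1 0 1] remains, and the double trace is [2 det H] times it, where [det H] is inverse
    to [det h]. *)
Lemma skew4_dim2 n (n2 : n = 2%N) (h H : 'I_n -> 'I_n -> K)
    (D : 'I_n -> 'I_n -> 'I_n -> 'I_n -> K) :
  (forall a b, \sum_c h a c * H c b = (a == b)%:R) ->
  (forall a b c d, D a b c d = - D b a c d) ->
  (forall a b c d, D a b c d = - D a b d c) ->
  atr H (fun b d => atr H (fun a c => D a b c d)) = 0 ->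
  forall a b c d, D a b c d = 0.
Proof.
subst n; move=> hH sk1 sk2 tr0.
have diag1 a c d : D a a c d = 0 by apply: opp_eq0; apply: sk1.
have diag2 a b c : D a b c c = 0 by apply: opp_eq0; apply: sk2.
set o1 := lift ord0 ord0 : 'I_2.
have det : (h ord0 ord0 * h o1 o1 - h ord0 o1 * h o1 ord0) *
    (H ord0 ord0 * H o1 o1 - H ord0 o1 * H o1 ord0) = 1.
  have := (hH ord0 ord0, hH ord0 o1, hH o1 ord0, hH o1 o1).
  rewrite !big_ord_recl !big_ord0 -!/o1 /= !addr0 => -[[[e1 e2] e3] e4].
  transitivity ((h ord0 ord0 * H ord0 ord0 + h ord0 o1 * H o1 ord0) *
    (h o1 ord0 * H ord0 o1 + h o1 o1 * H o1 o1) -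
    (h ord0 ord0 * H ord0 o1 + h ord0 o1 * H o1 o1) *
    (h o1 ord0 * H ord0 ord0 + h o1 o1 * H o1 ord0)); first by ring.
  by rewrite e1 e2 e3 e4 mulr1 mul0r subr0.
have f0 : D ord0 o1 ord0 o1 = 0.
  apply: (mulrI two_unit); rewrite mulr0.
  rewrite -[D _ _ _ _]mul1r -[1 in X in _ * X]det -mulrA mulrCA.
  rewrite [X in _ * X](_ : _ = 0) ?mulr0 // -tr0 /atr.
  rewrite !big_ord_recl !big_ord0 -!/o1 !addr0 !diag1 !diag2.
  have E10 c d : D o1 ord0 c d = - D ord0 o1 c d by apply: sk1.
  have F10 : D ord0 o1 o1 ord0 = - D ord0 o1 ord0 o1 by apply: sk2.
  by rewrite !E10 !F10; ring.
elim/ord2_ind => b c d; elim/ord2_ind: b; rewrite ?diag1 // -/o1.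
- elim/ord2_ind: c; elim/ord2_ind: d; rewrite ?diag2 // -/o1.
  by rewrite sk2 f0 oppr0.
- rewrite sk1; elim/ord2_ind: c; elim/ord2_ind: d; rewrite ?diag2 ?oppr0 // -/o1.
    by rewrite f0 oppr0.
  by rewrite sk2 f0 !oppr0.
Qed.

(* D is a 3 x 3 matrix N, with rows and columns indexed by pairs of indices, and
   its trace M is the derivative at H of the cofactor matrix in the direction N.
   [key] is what one gets by differentiating adj(X) X = det(X) at X = H. *)
Lemma skew4_dim3 n (n3 : n = 3%N) (h H : 'I_n -> 'I_n -> K)
    (D : 'I_n -> 'I_n -> 'I_n -> 'I_n -> K) :
  (forall a b, \sum_c h a c * H c b = (a == b)%:R) ->
  (forall a b, H a b = H b a) ->
  (forall a b c d, D a b c d = - D b a c d) ->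
  (forall a b c d, D a b c d = - D a b d c) ->
  (forall b d, atr H (fun a c => D a b c d) = 0) ->
  forall a b c d, D a b c d = 0.
Proof.
subst n; move=> hH Hs sk1 sk2 tr0.
have diag1 a c d : D a a c d = 0 by apply: opp_eq0; apply: sk1.
have diag2 a b c : D a b c c = 0 by apply: opp_eq0; apply: sk2.
set o0 := ord0 : 'I_3.
set o1 := lift ord0 ord0 : 'I_3; set o2 := lift ord0 (lift ord0 ord0) : 'I_3.
pose detm (X : 'I_3 -> 'I_3 -> K) :=
  X o0 o0 * (X o1 o1 * X o2 o2 - X o1 o2 * X o2 o1)
  - X o0 o1 * (X o1 o0 * X o2 o2 - X o1 o2 * X o2 o0)
  + X o0 o2 * (X o1 o0 * X o2 o1 - X o1 o1 * X o2 o0).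
have det : detm h * detm H = 1.
  pose X a b := h a o0 * H o0 b + h a o1 * H o1 b + h a o2 * H o2 b.
  have XE a b : X a b = (a == b)%:R.
    by rewrite -hH !big_ord_recl big_ord0 addr0 addrA.
  transitivity (detm X); first by rewrite /detm /X; ring.
  by rewrite /detm !XE /=; ring.
pose M b d := atr H (fun a c => D a b c d).
have ME b d : M b d = \sum_a \sum_c H a c * D a b c d by [].
(* The pairs are ordered cyclically, so that all cofactors carry the sign [+]. *)
pose p (i : 'I_3) := if i == o0 then (o1, o2) else if i == o1 then (o2, o0) else (o0, o1).
pose N i j := D (p i).1 (p i).2 (p j).1 (p j).2.
pose trM := \sum_a \sum_b M a b * H b a.
have E10 c d : D o1 o0 c d = - D o0 o1 c d by apply: sk1.
have E02 c d : D o0 o2 c d = - D o2 o0 c d by apply: sk1.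
have E21 c d : D o2 o1 c d = - D o1 o2 c d by apply: sk1.
have F10 a b : D a b o1 o0 = - D a b o0 o1 by apply: sk2.
have F02 a b : D a b o0 o2 = - D a b o2 o0 by apply: sk2.
have F21 a b : D a b o2 o1 = - D a b o1 o2 by apply: sk2.
have key i j : 2 * (detm H * N i j) =
    H i j * trM - 2 * \sum_a \sum_b H i a * M b a * H b j.
  rewrite /trM !big_ord_recl !big_ord0 !addr0 -!/o0 -!/o1 -!/o2 !ME.
  rewrite !big_ord_recl !big_ord0 !addr0 -!/o0 -!/o1 -!/o2.
  rewrite !diag1 !diag2 !E10 !E02 !E21 !F10 !F02 !F21 /detm.
  rewrite !(Hs o1 o0) !(Hs o2 o0) !(Hs o2 o1).
  elim/ord3_ind: i; elim/ord3_ind: j; rewrite /N /p /= -!/o0 -!/o1 -!/o2;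
  rewrite ?(Hs o1 o0) ?(Hs o2 o0) ?(Hs o2 o1); ring.
have M0 b d : M b d = 0 by apply: tr0.
have N0 i j : N i j = 0.
  apply: (mulrI two_unit); rewrite mulr0 -[N i j]mul1r -[1 in X in _ * X]det -mulrA mulrCA key.
  rewrite /trM (eq_bigr (fun=> 0)) => [|a _]; last first.
    by rewrite big1 // => b _; rewrite M0 mul0r.
  rewrite big1 // mulr0 [X in 2 * X]big1 ?mulr0 ?subr0 ?mulr0 // => a _.
  by rewrite big1 // => b _; rewrite M0 mulr0 mul0r.
have := (N0 o0 o0, N0 o0 o1, N0 o0 o2, (N0 o1 o0, N0 o1 o1, N0 o1 o2),
  (N0 o2 o0, N0 o2 o1, N0 o2 o2)); rewrite /N /p /= => Nz.
by elim/ord3_ind => b c d; elim/ord3_ind: b; elim/ord3_ind: c; elim/ord3_ind: d;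
  rewrite -!/o0 -!/o1 -!/o2 ?diag1 ?diag2 ?E10 ?E02 ?E21 ?F10 ?F02 ?F21 ?Nz ?oppr0.
Qed.
End LowDimension.

(** * Tractor curvature over a differential ring *)

Section WeylCalculus.
Variables (K : comUnitRingType) (n : nat) (d : 'I_n -> K -> K).
Hypothesis dD : forall a x y, d a (x + y) = d a x + d a y.
Hypothesis dM : forall a x y, d a (x * y) = d a x * y + x * d a y.
Hypothesis dC : forall a b x, d a (d b x) = d b (d a x).
Hypothesis nat_unit : forall m, (m.+1%:R : K) \is a GRing.unit.
Variables (h H : 'I_n -> 'I_n -> K) (th : 'I_n -> K)
  (Gm : 'I_n -> 'I_n -> 'I_n -> K).

(* The counterparts of [nabla0] to [nabla3] and [nablaV] over the ring K: [th] is
   the logarithmic derivative of the scale, and [Gm] are the Christoffel symbols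
   of a torsion-free connection with nabla h = 0, where h has weight 2. *)
Definition cov0 (w : K) f a : K := d a f - w * th a * f.

Definition cov1 w T a b : K := cov0 w (T b) a - \sum_(e < n) Gm e a b * T e.

Definition cov2 w (T : 'I_n -> 'I_n -> K) a b c : K :=
  cov0 w (T b c) a - \sum_(e < n) Gm e a b * T e c
                 - \sum_(e < n) Gm e a c * T b e.

Definition cov3 w (T : 'I_n -> 'I_n -> 'I_n -> K) a b c e : K :=
  cov0 w (T b c e) a - \sum_(p < n) Gm p a b * T p c e
                   - \sum_(p < n) Gm p a c * T b p e
                   - \sum_(p < n) Gm p a e * T b c p.

Definition covV w V a c : K := cov0 w (V c) a + \sum_(e < n) Gm c a e * V e.

Definition ariem (a b c e : 'I_n) : K :=
  covV 0 (covV 0 (fun p => (p == e)%:R) b) a c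
  - covV 0 (covV 0 (fun p => (p == e)%:R) a) b c.

Definition arlow a b c e : K := \sum_(p < n) h c p * ariem a b p e.

Definition aric b e : K := \sum_(a < n) ariem a b a e.

Hypothesis h_sym : forall a b, h a b = h b a.
Hypothesis H_sym : forall a b, H a b = H b a.
Hypothesis hH : forall a b, \sum_(c < n) h a c * H c b = (a == b)%:R.
Hypothesis Gm_sym : forall e a b, Gm e a b = Gm e b a.
Hypothesis th_closed : forall a b, d a (th b) = d b (th a).
Hypothesis nabla_h : forall a b c,
  d a (h b c) = 2 * th a * h b c + \sum_(e < n) Gm e a b * h e c
                + \sum_(e < n) Gm e a c * h b e.

Local Notation tr := (atr H).
Local Notation dot := (adot H).

(** * Covariant derivatives and contractions *)

Lemma d_0 a : d a 0 = 0.
Proof. by apply: (addrI (d a 0)); rewrite -dD !addr0. Qed.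

Lemma d_N a x : d a (- x) = - d a x.
Proof. by apply/eqP; rewrite -addr_eq0 -dD addNr d_0. Qed.

Lemma d_B a x y : d a (x - y) = d a x - d a y.
Proof. by rewrite dD d_N. Qed.

Lemma d_sum a (I : Type) (r : seq I) P (F : I -> K) :
  d a (\sum_(i <- r | P i) F i) = \sum_(i <- r | P i) d a (F i).
Proof. exact: (big_morph (d a) (dD a) (d_0 a)). Qed.

Lemma d_1 a : d a 1 = 0.
Proof.
by apply: (addrI (d a 1)); rewrite addr0 -[in RHS](mulr1 1) dM mulr1 mul1r.
Qed.

Lemma d_nat a m : d a m%:R = 0.
Proof. by elim: m => [|m IH]; rewrite ?d_0 // mulrSr dD IH d_1 addr0. Qed.

Lemma d_natV a m : d a (m.+1%:R^-1) = 0.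
Proof.
have : d a (m.+1%:R * m.+1%:R^-1) = 0 by rewrite divrr // d_1.
by rewrite dM d_nat mul0r add0r => /(congr1 ( *%R m.+1%:R^-1)); rewrite mulKr // mulr0.
Qed.

Lemma two_unit : (2 : K) \is a GRing.unit.
Proof. exact: nat_unit 1%N. Qed.

Lemma cov0D w x y a : cov0 w (x + y) a = cov0 w x a + cov0 w y a.
Proof. rewrite /cov0 dD; ring. Qed.

Lemma cov0N w x a : cov0 w (- x) a = - cov0 w x a.
Proof. rewrite /cov0 d_N; ring. Qed.

Lemma cov0M w1 w2 x y a : cov0 (w1 + w2) (x * y) a = cov0 w1 x a * y + x * cov0 w2 y a.
Proof. rewrite /cov0 dM; ring. Qed.

(** Weights are elements of [K], so that they are constant has to be a hypothesis. They contribute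
    no curvature because [th] is closed. *)
Lemma cov0_comm w1 w2 f a b : (d a w1 = 0) -> (d b w1 = 0) -> w1 = w2 ->
  cov0 w1 (cov0 w2 f b) a = cov0 w1 (cov0 w2 f a) b.
Proof. move=> ha hb <-; rewrite /cov0 !d_B !dM dC ha hb th_closed; ring. Qed.

Lemma cov1_ext w u v a b : (forall c, u c = v c) -> cov1 w u a b = cov1 w v a b.
Proof.
by move=> e; rewrite /cov1 e; congr (_ - _); apply: eq_bigr => p _; rewrite e.
Qed.

Lemma cov2_ext w S T a b c : (forall p q, S p q = T p q) ->
  cov2 w S a b c = cov2 w T a b c.
Proof.
move=> e; rewrite /cov2 e; congr (_ - _ - _); apply: eq_bigr => p _; rewrite e //.
Qed.

Lemma cov1D w u v a b : cov1 w (fun c => u c + v c) a b = cov1 w u a b + cov1 w v a b.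
Proof.
rewrite /cov1 cov0D; under eq_bigr do rewrite mulrDr.
rewrite big_split /=; ring.
Qed.

Lemma cov1N w u a b : cov1 w (fun c => - u c) a b = - cov1 w u a b.
Proof.
rewrite /cov1 cov0N; under eq_bigr do rewrite mulrN.
rewrite sumrN; ring.
Qed.

Lemma cov1B w u v a b : cov1 w (fun c => u c - v c) a b = cov1 w u a b - cov1 w v a b.
Proof. by rewrite cov1D cov1N. Qed.

Lemma cov1Zr w w1 w2 u f a b : w = w1 + w2 ->
  cov1 w (fun c => u c * f) a b = cov1 w1 u a b * f + u b * cov0 w2 f a.
Proof.
move=> ->; rewrite /cov1 cov0M; under eq_bigr do rewrite mulrA.
rewrite -mulr_suml; ring.
Qed.

Lemma cov2D w S T a b c :
  cov2 w (fun p q => S p q + T p q) a b c = cov2 w S a b c + cov2 w T a b c.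
Proof.
rewrite /cov2 cov0D; under eq_bigr do rewrite mulrDr.
under [X in _ - _ - X]eq_bigr do rewrite mulrDr.
rewrite !big_split /=; ring.
Qed.

Lemma cov2N w T a b c : cov2 w (fun p q => - T p q) a b c = - cov2 w T a b c.
Proof.
rewrite /cov2 cov0N; under eq_bigr do rewrite mulrN.
under [X in _ - _ - X]eq_bigr do rewrite mulrN.
rewrite !sumrN; ring.
Qed.

Lemma cov2B w S T a b c :
  cov2 w (fun p q => S p q - T p q) a b c = cov2 w S a b c - cov2 w T a b c.
Proof. by rewrite cov2D cov2N. Qed.

Lemma cov2Zr w w1 w2 T f a b c : w = w1 + w2 ->
  cov2 w (fun p q => T p q * f) a b c = cov2 w1 T a b c * f + T b c * cov0 w2 f a.
Proof.
move=> ->; rewrite /cov2 cov0M; under eq_bigr do rewrite mulrA.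
under [X in _ - _ - X]eq_bigr do rewrite mulrA.
rewrite -!mulr_suml; ring.
Qed.

Lemma cov2Zl k w T a b c : d a k = 0 ->
  cov2 w (fun p q => k * T p q) a b c = k * cov2 w T a b c.
Proof.
move=> e; under cov2_ext do rewrite mulrC.
rewrite (cov2Zr (w1 := w) (w2 := 0)) ?addr0 // /cov0 e; ring.
Qed.

Lemma cov1Zl k w T a b : d a k = 0 ->
  cov1 w (fun p => k * T p) a b = k * cov1 w T a b.
Proof.
move=> e; under cov1_ext do rewrite mulrC.
rewrite (cov1Zr (w1 := w) (w2 := 0)) ?addr0 // /cov0 e; ring.
Qed.

Lemma cov2_tensor w w1 w2 u v a b c : w = w1 + w2 ->
  cov2 w (fun p q => u p * v q) a b c = cov1 w1 u a b * v c + u b * cov1 w2 v a c.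
Proof.
move=> ->; rewrite /cov2 cov0M /cov1; under eq_bigr do rewrite mulrA.
under [X in _ - _ - X]eq_bigr do rewrite mulrCA.
rewrite -mulr_suml -mulr_sumr; ring.
Qed.

Lemma cov2_h a b c : cov2 2 h a b c = 0.
Proof. rewrite /cov2 /cov0 nabla_h; ring. Qed.

(** From [h H = 1]: as [h] is parallel of weight 2, its inverse is parallel of weight -2. *)
Lemma d_H a b c : d a (H b c) =
  - (2 * th a * H b c + \sum_(e < n) Gm b a e * H e c
     + \sum_(e < n) Gm c a e * H b e).
Proof.
(* The derivative of [h H = 1], solved for the term with [d a H]; contracting with [H] then isolates
   [d a (H b c)]. *)
have E p : \sum_(q < n) h p q * d a (H q c) =
    - (2 * th a * (p == c)%:R + Gm c a p
       + \sum_(e < n) h p e * \sum_(q < n) Gm e a q * H q c).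
  have : d a (\sum_(q < n) h p q * H q c) = 0.
    by rewrite hH d_nat.
  rewrite d_sum; under eq_bigr do rewrite dM.
  rewrite big_split /= => /eqP; rewrite addrC addr_eq0 => /eqP ->.
  congr (- _); under eq_bigr do rewrite nabla_h 2!mulrDl.
  rewrite !big_split /=; congr (_ + _ + _).
  - by under eq_bigr do rewrite -mulrA; rewrite -mulr_sumr hH.
  - under eq_bigr do rewrite mulr_suml.
    rewrite exchange_big /=.
    under eq_bigr => e _.
      under eq_bigr do rewrite -mulrA.
      rewrite -mulr_sumr hH mulrC eq_sym.
    over.
    by rewrite sum_delta.
  - under eq_bigr do rewrite mulr_suml.
    rewrite exchange_big /=; apply: eq_bigr => e _; rewrite mulr_sumr.
    by apply: eq_bigr => q _; ring.
rewrite -[LHS](sum_delta b (fun q => d a (H q c))).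
under eq_bigr => q _ do rewrite -(Hh h_sym H_sym hH) mulr_suml.
rewrite exchange_big /=.
under eq_bigr => p _.
  under eq_bigr do rewrite -mulrA.
  rewrite -mulr_sumr E mulrN 2!mulrDr.
over.
rewrite sumrN !big_split /= -addrA [X in _ + X]addrC addrA.
congr (- (_ + _ + _)).
- under eq_bigr => p _ do rewrite mulrCA [H b p * _]mulrC eq_sym.
  by rewrite -mulr_sumr sum_delta.
- under eq_bigr do rewrite mulr_sumr.
  rewrite exchange_big /=.
  under eq_bigr => e _.
    under eq_bigr do rewrite mulrA.
    rewrite -mulr_suml (Hh h_sym H_sym hH).
  over.
  by rewrite sum_delta.
- by apply: eq_bigr => p _; rewrite mulrC.
Qed.

(** Trace and derivative commute because [H] is parallel; its weight -2 accounts for the shift. *)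
Lemma cov0_tr w w' T a : w' = w - 2 -> cov0 w' (tr T) a = tr (cov2 w T a).
Proof.
move=> ->.
have S1 : \sum_b \sum_c (\sum_(e < n) Gm b a e * H e c) * T b c =
    tr (fun b c => \sum_(e < n) Gm e a b * T e c).
  rewrite /tr; under eq_bigr do under eq_bigr do rewrite mulr_suml.
  under [RHS]eq_bigr do under eq_bigr do rewrite mulr_sumr.
  under eq_bigr do rewrite exchange_big.
  rewrite exchange_big; apply: eq_bigr => e _ /=.
  rewrite exchange_big; apply: eq_bigr => c _ /=.
  by apply: eq_bigr => b _; ring.
have S2 : \sum_b \sum_c (\sum_(e < n) Gm c a e * H b e) * T b c =
    tr (fun b c => \sum_(e < n) Gm e a c * T b e).
  rewrite /tr; apply: eq_bigr => b _.
  under eq_bigr do rewrite mulr_suml.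
  under [RHS]eq_bigr do rewrite mulr_sumr.
  rewrite exchange_big; apply: eq_bigr => e _ /=.
  by apply: eq_bigr => c _; ring.
rewrite /cov2 !trB -S1 -S2 /cov0 trZl /tr d_sum.
under eq_bigr => b _.
  rewrite d_sum; under eq_bigr => c _.
    rewrite dM d_H (_ : _ + _ = H b c * d a (T b c)
      - 2 * th a * (H b c * T b c)
      - (\sum_(e < n) Gm b a e * H e c) * T b c
      - (\sum_(e < n) Gm c a e * H b e) * T b c); last by ring.
  over.
  rewrite !sumrB -mulr_sumr.
over.
rewrite !sumrB -mulr_sumr; ring.
Qed.

Lemma cov0_dot w w1 w2 u v a : w = w1 + w2 - 2 ->
  cov0 w (dot u v) a = dot (cov1 w1 u a) v + dot u (cov1 w2 v a).
Proof.
move=> ->; rewrite dotE (cov0_tr _ _ erefl) !dotE -trD.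
by apply: eq_tr => b c; rewrite (cov2_tensor _ _ _ _ _ erefl).
Qed.

Lemma cov1_dot w w1 w2 (B : 'I_n -> 'I_n -> K) m a c : w = w1 + w2 - 2 ->
  cov1 w (fun c => dot (B c) m) a c =
  dot (cov2 w1 B a c) m + dot (B c) (cov1 w2 m a).
Proof.
move=> e; rewrite {1}/cov1 (cov0_dot _ _ _ e).
rewrite (_ : dot (cov2 w1 B a c) m =
  dot (fun p => cov1 w1 (B c) a p - \sum_(e < n) Gm e a c * B e p) m); last first.
  by apply: eq_dot => // p; rewrite /cov2 /cov1; ring.
rewrite dotBl //.
have -> : dot (fun p => \sum_(e < n) Gm e a c * B e p) m =
    \sum_(e < n) Gm e a c * dot (B e) m.
  by apply: etrans (dot_suml _ _ _) _; apply: eq_bigr => p _; exact: dotZl.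
ring.
Qed.

Lemma cov1_tr w w' (T : 'I_n -> 'I_n -> 'I_n -> K) a c : w' = w - 2 ->
  cov1 w' (fun c => tr (T c)) a c = tr (cov3 w T a c).
Proof.
move=> e; rewrite {1}/cov1 (cov0_tr _ _ e).
rewrite (_ : tr (cov3 w T a c) =
  tr (fun p q => cov2 w (T c) a p q - \sum_(e < n) Gm e a c * T e p q)); last first.
  by apply: eq_tr => p q; rewrite /cov3 /cov2; ring.
by rewrite trB tr_sum; congr (_ - _); apply: eq_bigr => p _; rewrite trZl.
Qed.

(** * Symmetries of the Riemann tensor *)

Lemma covV_ext w u v a b : (forall c, u c = v c) -> covV w u a b = covV w v a b.
Proof.
by move=> e; rewrite /covV e; congr (_ + _); apply: eq_bigr => p _; rewrite e.
Qed.

Lemma riemE a b c e : ariem a b c e = d a (Gm c b e) - d b (Gm c a e)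
  + \sum_(p < n) Gm c a p * Gm p b e - \sum_(p < n) Gm c b p * Gm p a e.
Proof.
have E x y : covV 0 (fun p => (p == e)%:R) x y = Gm y x e.
  rewrite /covV /cov0 d_nat (eq_bigr (fun p => (e == p)%:R * Gm y x p)).
    by rewrite sum_delta; ring.
  by move=> p _; rewrite mulrC eq_sym.
rewrite /ariem !(covV_ext _ _ _ (E _)) /covV /cov0; ring.
Qed.

Lemma bianchi1 a b c e : ariem a b c e + ariem b e c a + ariem e a c b = 0.
Proof.
rewrite !riemE (Gm_sym c e b) (Gm_sym c e a) (Gm_sym c b a).
rewrite (eq_bigr (fun p => Gm c a p * Gm p e b)).
2: by move=> p _; rewrite (Gm_sym p b).
rewrite [X in _ - X + _ + _](eq_bigr (fun p => Gm c b p * Gm p e a)).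
2: by move=> p _; rewrite (Gm_sym p a).
rewrite [X in _ + (_ - X) + _](eq_bigr (fun p => Gm c e p * Gm p a b)).
2: by move=> p _; rewrite (Gm_sym p a).
ring.
Qed.

(** The index of the inner derivative is treated as a mere label, as for coordinate fields: the
    omitted terms with [Gm e a b] would cancel in the commutator. *)
Lemma cov1_curv w m a b c : (d a w = 0) -> (d b w = 0) ->
  cov1 w (cov1 w m b) a c - cov1 w (cov1 w m a) b c = - \sum_(e < n) ariem a b e c * m e.
Proof.
move=> wa wb.
(* Grouped so that, thanks to [dC] and [th_closed], every summand except the one with
   [d x (Gm e y c)] and the last one is symmetric in [x] and [y]. *)
have E x y : d x w = 0 -> cov1 w (cov1 w m y) x c = (d x (d y (m c)) - w * d x (th y) * m c
    - w * (th y * d x (m c) + th x * d y (m c)) + w * w * th x * th y * m c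
    - \sum_(e < n) d x (Gm e y c) * m e
    - (\sum_(e < n) Gm e y c * d x (m e) + \sum_(e < n) Gm e x c * d y (m e))
    + w * (th y * \sum_(e < n) Gm e x c * m e + th x * \sum_(e < n) Gm e y c * m e)
    + \sum_(e < n) (\sum_(p < n) Gm e y p * Gm p x c) * m e).
  move=> wx; rewrite /cov1 -/(cov1 _ _ _ _) {1}/cov0.
  have -> : d x (cov1 w m y c) = d x (d y (m c))
      - w * (d x (th y) * m c + th y * d x (m c))
      - (\sum_(e < n) d x (Gm e y c) * m e + \sum_(e < n) Gm e y c * d x (m e)).
    rewrite /cov1 /cov0 !d_B !dM wx d_sum -big_split /=.
    by under eq_bigr do rewrite dM; ring.
  have -> : \sum_(e < n) Gm e x c * cov1 w m y e = \sum_(e < n) Gm e x c * d y (m e)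
      - w * th y * (\sum_(e < n) Gm e x c * m e)
      - \sum_(e < n) (\sum_(p < n) Gm e y p * Gm p x c) * m e.
    rewrite mulr_sumr; under [X in _ - X]eq_bigr do rewrite mulr_suml.
    rewrite exchange_big -!sumrB; apply: eq_bigr => p _ /=.
    rewrite /cov1 /cov0 !mulrBr mulr_sumr; congr (_ - _ - _); first by ring.
    by apply: eq_bigr => q _; ring.
  rewrite /cov1 /cov0; ring.
rewrite !E // dC th_closed.
have -> : \sum_(e < n) ariem a b e c * m e =
    \sum_(e < n) d a (Gm e b c) * m e - \sum_(e < n) d b (Gm e a c) * m e
    + \sum_(e < n) (\sum_(p < n) Gm e a p * Gm p b c) * m e
    - \sum_(e < n) (\sum_(p < n) Gm e b p * Gm p a c) * m e.
  rewrite -sumrB -big_split -sumrB /=; apply: eq_bigr => e _.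
  by rewrite riemE; ring.
ring.
Qed.

Lemma rlow_skew12 a b c e : arlow a b c e = - arlow b a c e.
Proof.
by rewrite /arlow -sumrN; apply: eq_bigr => p _; rewrite !riemE; ring.
Qed.

Lemma riem_rlow a b c e : ariem a b c e = \sum_p H c p * arlow a b p e.
Proof.
rewrite -(sum_delta c (fun p => ariem a b p e)).
under eq_bigr => q _ do rewrite -(Hh h_sym H_sym hH) mulr_suml.
rewrite exchange_big; apply: eq_bigr => p _; rewrite mulr_sumr.
by apply: eq_bigr => q _; rewrite mulrA.
Qed.

(** For [u] and [v] of weight 1 the contraction [dot u v] has weight 0 and its second derivatives
    commute. By the Leibniz rule the curvature acts skewly on the pair, and rows of [h] in place of
    [u] and [v] give the components. *)
Lemma rlow_skew a b c e : arlow a b c e = - arlow a b e c.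
Proof.
have E x y u v : cov0 0 (cov0 0 (dot u v) y) x =
    dot (cov1 1 (cov1 1 u y) x) v + dot u (cov1 1 (cov1 1 v y) x)
    + (dot (cov1 1 u y) (cov1 1 v x) + dot (cov1 1 u x) (cov1 1 v y)).
  have w0 : (0 : K) = 1 + 1 - 2 by ring.
  by rewrite (cov0_dot _ _ _ w0) cov0D !(cov0_dot _ _ _ w0); ring.
have S u v : dot (fun c => \sum_(e < n) ariem a b e c * u e) v
    + dot u (fun c => \sum_(e < n) ariem a b e c * v e) = 0.
  have : cov0 0 (cov0 0 (dot u v) b) a = cov0 0 (cov0 0 (dot u v) a) b.
    by apply: cov0_comm; rewrite ?d_0.
  rewrite !E => /eqP; rewrite -subr_eq0 => /eqP e0.
  have C w (x : 'I_n) : \sum_(e < n) ariem a b e x * w e =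
      cov1 1 (cov1 1 w a) b x - cov1 1 (cov1 1 w b) a x.
    by rewrite -[RHS]opprB cov1_curv ?d_1 // opprK.
  rewrite (eq_dot _ (C u) (fun=> erefl)) (eq_dot _ (fun=> erefl) (C v)).
  rewrite dotBl // dotBr; apply: oppr_inj; rewrite oppr0 -[RHS]e0; ring.
apply/eqP; rewrite -addr_eq0; apply/eqP; rewrite -(S (h e) (h c)) addrC.
rewrite dot_h // dot_hr //.
by congr (_ + _); apply: eq_bigr => p _; rewrite mulrC.
Qed.

Lemma tr_rlow b e : tr (fun a c => arlow a b c e) = aric b e.
Proof.
apply: eq_bigr => a _; rewrite -[ariem a b a e](sum_delta a (fun p => ariem a b p e)).
under [RHS]eq_bigr => q _ do rewrite -(Hh h_sym H_sym hH) mulr_suml.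
rewrite exchange_big; apply: eq_bigr => p _; rewrite mulr_sumr.
by apply: eq_bigr => q _; rewrite mulrA.
Qed.

(** Contract the first Bianchi identity; the term [ariem b e a a] sums to zero because [arlow] is
    skew in its last pair. *)
Lemma ric_sym b e : aric b e = aric e b.
Proof.
have T0 : \sum_(a < n) ariem b e a a = 0.
  apply: (opp_eq0 two_unit); under eq_bigr do rewrite riem_rlow.
  rewrite -[RHS](trN H (fun p a => arlow b e a p)) -[RHS](trC H_sym).
  by apply: eq_bigr => a _; apply: eq_bigr => p _; rewrite rlow_skew.
have : \sum_(a < n) (ariem a b a e + ariem b e a a + ariem e a a b) = 0.
  by rewrite big1 // => a _; apply: bianchi1.
rewrite 2!big_split /= T0 addr0 => /eqP; rewrite addr_eq0 => /eqP.
rewrite -/(aric b e) => ->; rewrite -sumrN; apply: eq_bigr => a _.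
by rewrite !riemE; ring.
Qed.

Lemma cov1_curv_dot m a b c :
  cov1 1 (cov1 1 m b) a c - cov1 1 (cov1 1 m a) b c = dot (arlow a b c) m.
Proof.
rewrite cov1_curv ?d_1 // /adot exchange_big -sumrN; apply: eq_bigr => e _ /=.
rewrite riem_rlow -mulNr -sumrN mulr_suml; apply: eq_bigr => p _.
by rewrite H_sym (rlow_skew a b p) mulrN opprK H_sym.
Qed.

(** * The deformed tractor connection and its curvature *)

Variables (A : 'I_n -> 'I_n -> 'I_n -> K) (F : 'I_n -> K)
  (Q S : 'I_n -> 'I_n -> K).
Hypothesis A_sym12 : forall a b c, A a b c = A b a c.
Hypothesis A_sym23 : forall a b c, A a b c = A a c b.
Hypothesis Q_sym : forall a b, Q a b = Q b a.
Hypothesis S_sym : forall a b, S a b = S b a.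

(* Slots with the index of mu lowered by h. *)
Record aslots := Tract { ts : K; tm : 'I_n -> K; tp : K }.

Definition conn a (U : aslots) := Tract
  (cov0 1 (ts U) a - tm U a)
  (fun b => cov1 1 (tm U) a b + h a b * tp U + Q a b * ts U - dot (A a b) (tm U))
  (cov0 (-1) (tp U) a - dot (S a) (tm U) - F a * ts U).

Definition curvX a b c := cov2 0 Q a b c - cov2 0 Q b a c
  - (h a c * F b - h b c * F a) - (dot (A a c) (Q b) - dot (A b c) (Q a)).

Definition curvY a b c e := arlow a b c e - (cov3 2 A a b c e - cov3 2 A b a c e)
  - (h a c * S b e - h b c * S a e) - (Q a c * h b e - Q b c * h a e)
  + (dot (A a c) (A b e) - dot (A b c) (A a e)).

Definition curvN a b := - (cov1 (-2) F a b - cov1 (-2) F b a)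
  - (dot (S a) (Q b) - dot (S b) (Q a)).

Definition curvZ a b e := - (cov2 0 S a b e - cov2 0 S b a e)
  + (dot (S a) (A b e) - dot (S b) (A a e)) + (F a * h b e - F b * h a e).

Lemma dot_dot u (B : 'I_n -> 'I_n -> K) m :
  dot u (fun e => dot (B e) m) = dot (fun f => dot u (fun e => B e f)) m.
Proof.
rewrite dotE; under eq_tr do rewrite dotE -trZl.
rewrite tr_trC [RHS]dotE; apply: eq_tr => p q.
by rewrite dotE -trZr; apply: eq_tr => a b; ring.
Qed.

Lemma Gm_sum a b f : \sum_(e < n) Gm e a b * f e = \sum_(e < n) Gm e b a * f e.
Proof. by apply: eq_bigr => e _; rewrite Gm_sym. Qed.

(** The symmetry of [Gm], [Q], [A] and [h] removes every term, so this slot yields no equation. *)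
Lemma conn_ts a b U : ts (conn a (conn b U)) = ts (conn b (conn a U)).
Proof.
have E x y : cov0 1 (ts (conn y U)) x = cov0 1 (cov0 1 (ts U) y) x - cov0 1 (tm U y) x.
  by rewrite /= cov0D cov0N.
rewrite /= -/(ts (conn b U)) -/(ts (conn a U)) !E (cov0_comm (w1 := 1)) ?d_1 //.
rewrite (eq_dot _ (A_sym12 b a) (fun=> erefl)) /cov1 (h_sym b a) (Q_sym b a).
rewrite (Gm_sum b a); ring.
Qed.

Lemma conn_tmE a b U c : tm (conn a (conn b U)) c =
  cov1 1 (cov1 1 (tm U) b) a c
  + ((\sum_(e < n) Gm e a b * h e c) * tp U + h b c * cov0 (-1) (tp U) a)
  + ((cov2 0 Q a b c + \sum_(e < n) Gm e a b * Q e c) * ts U + Q b c * cov0 1 (ts U) a)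
  - (dot (cov3 2 A a b c) (tm U) + \sum_(e < n) Gm e a b * dot (A e c) (tm U)
     + dot (A b c) (cov1 1 (tm U) a))
  + h a c * (cov0 (-1) (tp U) b - dot (S b) (tm U) - F b * ts U)
  + Q a c * (cov0 1 (ts U) b - tm U b)
  - (dot (A a c) (cov1 1 (tm U) b) + A a c b * tp U + dot (A a c) (Q b) * ts U
     - dot (fun e => dot (A a c) (A b e)) (tm U)).
Proof.
rewrite {1}/conn /= -/(conn b U).
rewrite cov1B !cov1D.
rewrite (cov1Zr (w1 := 2) (w2 := -1)); last by ring.
rewrite (cov1Zr (w1 := 0) (w2 := 1)); last by ring.
rewrite (cov1_dot (w1 := 2) (w2 := 1)); last by ring.
rewrite dotBr // !dotDr // !dotZrr // dot_hr // dot_dot.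
have -> : cov1 2 (h b) a c = \sum_(e < n) Gm e a b * h e c.
  rewrite /cov1 /cov0 nabla_h; ring.
have -> : cov1 0 (Q b) a c = cov2 0 Q a b c + \sum_(e < n) Gm e a b * Q e c.
  rewrite /cov1 /cov2; ring.
have -> : dot (cov2 2 (A b) a c) (tm U) = dot (cov3 2 A a b c) (tm U)
    + \sum_(e < n) Gm e a b * dot (A e c) (tm U).
  rewrite (_ : \sum_(e < n) _ = dot (fun p => \sum_(e < n) Gm e a b * A e c p) (tm U)).
    rewrite -dotDl //; apply: eq_dot => // p; rewrite /cov2 /cov3; ring.
  by symmetry; apply: etrans (dot_suml _ _ _) _; apply: eq_bigr => e _; rewrite dotZl.
have -> : dot (fun f => dot (A a c) (fun e => A b e f)) (tm U) =
    dot (fun e => dot (A a c) (A b e)) (tm U).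
  by apply: eq_dot => // e; apply: eq_dot => // f; rewrite A_sym23.
ring.
Qed.

Lemma conn_tm a b U c : tm (conn a (conn b U)) c - tm (conn b (conn a U)) c =
  curvX a b c * ts U + dot (curvY a b c) (tm U).
Proof.
have -> : dot (curvY a b c) (tm U) = dot (arlow a b c) (tm U)
    - (dot (cov3 2 A a b c) (tm U) - dot (cov3 2 A b a c) (tm U))
    - (h a c * dot (S b) (tm U) - h b c * dot (S a) (tm U))
    - (Q a c * tm U b - Q b c * tm U a)
    + (dot (fun e => dot (A a c) (A b e)) (tm U)
       - dot (fun e => dot (A b c) (A a e)) (tm U)).
  (* Writing [tm U b] as a contraction with [h b] lets all terms merge into one [dot]. *)
  rewrite -{1}(dot_h hH b (tm U)) -{1}(dot_h hH a (tm U)).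
  rewrite -!dotZl // -!dotBl // -dotDl //.
rewrite !conn_tmE -cov1_curv_dot /curvX (A_sym23 a c b) (A_sym23 b c a) (A_sym12 b a c).
rewrite !(Gm_sum b a); ring.
Qed.

Lemma conn_tpE a b U : tp (conn a (conn b U)) =
  cov0 (-1) (cov0 (-1) (tp U) b) a
  - (dot (cov2 0 S a b) (tm U) + \sum_(e < n) Gm e a b * dot (S e) (tm U)
     + dot (S b) (cov1 1 (tm U) a))
  - (cov0 (-2) (F b) a * ts U + F b * cov0 1 (ts U) a)
  - (dot (S a) (cov1 1 (tm U) b) + S a b * tp U + dot (S a) (Q b) * ts U
     - dot (fun e => dot (S a) (A b e)) (tm U))
  - F a * (cov0 1 (ts U) b - tm U b).
Proof.
rewrite /=.
have -> : cov0 (-1) (cov0 (-1) (tp U) b - dot (S b) (tm U) - F b * ts U) a =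
    cov0 (-1) (cov0 (-1) (tp U) b) a - cov0 (-1) (dot (S b) (tm U)) a
    - cov0 (-1) (F b * ts U) a.
  by rewrite (cov0D _ (_ - _)) (cov0D _ (cov0 _ _ _)) !cov0N.
rewrite (cov0_dot (w1 := 0) (w2 := 1)); last by ring.
rewrite (_ : cov0 (-1) (F b * ts U) a = cov0 (-2) (F b) a * ts U + F b * cov0 1 (ts U) a).
2: by rewrite -cov0M; congr (cov0 _ _ _); ring.
rewrite dotBr // !dotDr // !dotZrr // dot_hr // dot_dot.
have -> : dot (cov1 0 (S b) a) (tm U) = dot (cov2 0 S a b) (tm U)
    + \sum_(e < n) Gm e a b * dot (S e) (tm U).
  rewrite (_ : \sum_(e < n) _ = dot (fun p => \sum_(e < n) Gm e a b * S e p) (tm U)).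
    rewrite -dotDl //; apply: eq_dot => // p; rewrite /cov2 /cov1; ring.
  by symmetry; apply: etrans (dot_suml _ _ _) _; apply: eq_bigr => e _; rewrite dotZl.
have -> : dot (fun f => dot (S a) (fun e => A b e f)) (tm U) =
    dot (fun e => dot (S a) (A b e)) (tm U).
  by apply: eq_dot => // e; apply: eq_dot => // f; rewrite A_sym23.
ring.
Qed.

Lemma conn_tp a b U : tp (conn a (conn b U)) - tp (conn b (conn a U)) =
  curvN a b * ts U + dot (curvZ a b) (tm U).
Proof.
have -> : dot (curvZ a b) (tm U) =
    - (dot (cov2 0 S a b) (tm U) - dot (cov2 0 S b a) (tm U))
    + (dot (fun e => dot (S a) (A b e)) (tm U)
       - dot (fun e => dot (S b) (A a e)) (tm U))
    + (F a * tm U b - F b * tm U a).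
  rewrite -{1}(dot_h hH b (tm U)) -{1}(dot_h hH a (tm U)).
  by rewrite -!dotZl // -!dotBl // -dotNl // -!dotDl.
rewrite !conn_tpE (cov0_comm (w1 := -1)) ?d_N ?d_1 ?oppr0 //.
rewrite /curvN /cov1 !(Gm_sum b a) (S_sym b a); ring.
Qed.

(** * The Jacobi identity of the connection *)

Lemma conn_tmB a U V c : tm (conn a U) c - tm (conn a V) c =
  tm (conn a (Tract (ts U - ts V) (fun b => tm U b - tm V b) (tp U - tp V))) c.
Proof. rewrite /= cov1B dotBr //; ring. Qed.

Lemma eq_conn_tm a U V c : ts U = ts V -> (forall b, tm U b = tm V b) ->
  tp U = tp V -> tm (conn a U) c = tm (conn a V) c.
Proof.
by move=> es em ep /=; rewrite es ep (cov1_ext _ _ _ em) (eq_dot _ (fun=> erefl) em).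
Qed.

Definition curv a b U := Tract 0
  (fun c => curvX a b c * ts U) (curvN a b * ts U + dot (curvZ a b) (tm U)).

(* The Jacobi identity for the operators [conn e], [conn a], [conn b], whose
   commutators are given by [curv]. *)
Lemma bianchi2 e a b U c : (forall a b c f, curvY a b c f = 0) ->
  (tm (conn e (curv a b U)) c - curvX a b c * ts (conn e U))
  + (tm (conn a (curv b e U)) c - curvX b e c * ts (conn a U))
  + (tm (conn b (curv e a U)) c - curvX e a c * ts (conn b U)) = 0.
Proof.
move=> Y0.
have C p q V f : curvX p q f * ts V =
    tm (conn p (conn q V)) f - tm (conn q (conn p V)) f.
  by rewrite conn_tm (eq_dot _ (Y0 p q f) (fun=> erefl)) dot0l // addr0.
(* Each of the six terms is a difference of two triple products [f p q r], since the slots of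
   [curv q r U] are those of the commutator applied to [U] when [curvY] is zero. The products cancel
   in the cyclic sum. *)
have [f [fE fC]] : exists f, (forall p q r, tm (conn p (curv q r U)) c = f p q r - f p r q)
    /\ (forall p q r, curvX p q c * ts (conn r U) = f p q r - f q p r).
  exists (fun p q r => tm (conn p (conn q (conn r U))) c); split=> p q r //.
  rewrite conn_tmB; apply: eq_conn_tm => [|s|]; rewrite [LHS]/=.
  - by rewrite conn_ts subrr.
  - exact: C.
  - by rewrite -conn_tp.
rewrite !fC !fE; ring.
Qed.

(* [bianchi2] at (sigma, mu, phi) = (0, h_f, 0). *)
Lemma bianchi2_XZ e a b c f : (forall a b c f, curvY a b c f = 0) ->
  h e c * curvZ a b f + curvX a b c * h e f
  + (h a c * curvZ b e f + curvX b e c * h a f)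
  + (h b c * curvZ e a f + curvX e a c * h b f) = 0.
Proof.
move=> Y0; rewrite -(bianchi2 e a b (Tract 0 (h f) 0) c Y0).
have E p q r : tm (conn p (curv q r (Tract 0 (h f) 0))) c
    - curvX q r c * ts (conn p (Tract 0 (h f) 0)) =
    h p c * curvZ q r f + curvX q r c * h p f.
  rewrite /= (_ : cov1 1 _ p c = cov1 1 (fun=> 0) p c).
  2: by apply: cov1_ext => s; rewrite mulr0.
  have -> : cov1 1 (fun=> 0) p c = 0.
    by rewrite /cov1 /cov0 d_0 big1 => [|s _]; rewrite ?mulr0 ?subr0.
  rewrite (_ : dot (A p c) _ = dot (A p c) (fun=> 0)).
  2: by apply: eq_dot => // s; rewrite mulr0.
  rewrite dot0r // dot_hr // /cov0 d_0 (h_sym f p); ring.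
by rewrite !E.
Qed.

(* [bianchi2] at (sigma, mu, phi) = (1, 0, 0). *)
Lemma bianchi2_N e a b c : (forall a b c f, curvY a b c f = 0) ->
  (forall a b c, curvX a b c = 0) ->
  h e c * curvN a b + h a c * curvN b e + h b c * curvN e a = 0.
Proof.
move=> Y0 X0; rewrite -(bianchi2 e a b (Tract 1 (fun=> 0) 0) c Y0).
have E p q r : tm (conn p (curv q r (Tract 1 (fun=> 0) 0))) c
    - curvX q r c * ts (conn p (Tract 1 (fun=> 0) 0)) = h p c * curvN q r.
  rewrite /= (_ : cov1 1 _ p c = cov1 1 (fun=> 0) p c).
  2: by apply: cov1_ext => s; rewrite X0 mul0r.
  have -> : cov1 1 (fun=> 0) p c = 0.
    by rewrite /cov1 /cov0 d_0 big1 => [|s _]; rewrite ?mulr0 ?subr0.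
  rewrite (_ : dot (A p c) _ = dot (A p c) (fun=> 0)).
  2: by apply: eq_dot => // s; rewrite X0 mul0r.
  rewrite !dot0r // X0; ring.
by rewrite !E.
Qed.

(** * The equations of the theorem over the ring *)

Variables P E G : 'I_n -> 'I_n -> K.
Hypothesis n_gt1 : (1 < n)%N.
Hypothesis QE : forall a b, Q a b = P a b - E a b.
Hypothesis SE : forall a b, S a b = P a b + G a b.
Hypothesis P_sym : forall a b, P a b = P b a.
Hypothesis A_tf : forall c, tr (fun a b => A a b c) = 0.
Hypothesis EG_tr : tr E + tr G = 0.
Hypothesis EG_tf : n = 2%N -> forall a b,
  E a b - G a b - n%:R^-1 * tr (fun a b => E a b - G a b) * h a b = 0.
Hypothesis P_schouten : n <> 2%N -> forall a b,
  P a b = (n%:R - 2)^-1 * (aric a b - tr aric / (2 * (n%:R - 1)) * h a b).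
Hypothesis P_moebius : n = 2%N -> tr P = 2^-1 * tr aric.

Definition adelta a b : K := tr (fun c e => cov3 2 A c a b e).
Definition adelta2 a : K := tr (fun c e => cov2 0 adelta c a e).
Definition aAA a b : K := adot2 H (A a) (A b).
Definition anormsq : K := tr aAA.
Definition aPA a b : K :=
  if n == 2%N then 4^-1 * anormsq * h a b
  else (n%:R - 2)^-1 * (aAA a b - anormsq / (2 * (n%:R - 1)) * h a b).
Definition askew (T : 'I_n -> 'I_n -> K) a b : K := 2^-1 * (T a b - T b a).
Definition akulkarni (T : 'I_n -> 'I_n -> K) a b c e : K :=
  2 * (askew (fun a b => h c a * T b e) a b - askew (fun a b => h e a * T b c) a b).
Definition atf4 (T : 'I_n -> 'I_n -> 'I_n -> 'I_n -> K) a b c e : K :=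
  let r := fun b e => tr (fun a c => T a b c e) in
  T a b c e - akulkarni (fun a b => (n%:R - 2)^-1 *
    (r a b - tr r / (2 * (n%:R - 1)) * h a b)) a b c e.
Definition aweyl a b c e : K := arlow a b c e - akulkarni P a b c e.
Definition acotton a b c : K := askew (fun a b => cov2 0 P a b c) a b.

Definition gauss4 a b c e : K :=
  2 * atf4 (fun a b c e =>
    askew (fun a b => dot (fun v => A v c a) (fun v => A b e v)) a b) a b c e
  + aweyl a b c e.
Definition gauss3 a b c : K := askew (fun a b => cov2 0 aPA a b c) a b
  + 3^-1 * askew (fun a b => dot (fun p => A p c a) (fun p => adelta b p)) a b
  - acotton a b c.
Definition gauss2 a : K := cov0 (-2) anormsq a
  + 2 * adot2 H (fun p v => A a p v) (fun p v => adelta p v)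
  - 8 * tr (fun p v => acotton a p v).
Definition codazzi3 a b c e : K := askew (fun a b => cov3 2 A a b c e) a b
  - n%:R^-1 * (askew (fun a b => h e a * adelta b c) a b
               + askew (fun a b => h c a * adelta b e) a b).
Definition codazzi2 a b : K := askew (fun a b => cov1 (-2) adelta2 a b) a b
  + 4 * askew (fun a b => dot (fun p => P p a) (fun p => adelta b p)) a b
  - 2 * askew (fun a b => adot2 H (fun c p => A c p a) (fun c p => cov2 0 P b c p)) a b.

Definition tensors_eq : Prop :=
  [/\ forall a b, E a b = - n%:R^-1 * adelta a b + aPA a b,
      forall a b, G a b = - n%:R^-1 * adelta a b - aPA a b &
      forall a, F a = (n%:R * (n%:R - 1))^-1 * adelta2 a
        + (n%:R - 1)^-1 * adot2 H (fun p v => A a p v) (fun p v => P p v - aPA p v)].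

(* The coefficients are given by hand and the premise is left to [ring]. *)
Lemma lc1 (c a b x y : K) : a = b -> x - y = c * (a - b) -> x = y.
Proof. by move=> -> /eqP; rewrite subrr mulr0 subr_eq0 => /eqP. Qed.

Lemma lc2 (c c' a b a' b' x y : K) : a = b -> a' = b' ->
  x - y = c * (a - b) + c' * (a' - b') -> x = y.
Proof. by move=> -> -> /eqP; rewrite !subrr !mulr0 addr0 subr_eq0 => /eqP. Qed.

Lemma lc3 (c c' c'' a b a' b' a'' b'' x y : K) : a = b -> a' = b' -> a'' = b'' ->
  x - y = c * (a - b) + c' * (a' - b') + c'' * (a'' - b'') -> x = y.
Proof.
by move=> -> -> -> /eqP; rewrite !subrr !mulr0 !addr0 subr_eq0 => /eqP.
Qed.

Lemma nB_unit m : (m < n)%N -> (n%:R - m%:R : K) \is a GRing.unit.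
Proof. by move=> lt_mn; rewrite -natrB ?(ltnW lt_mn) // -subnSK. Qed.

Lemma n_unit : (n%:R : K) \is a GRing.unit.
Proof. by have := nB_unit (ltnW n_gt1); rewrite subr0. Qed.

Lemma nB1_unit : (n%:R - 1 : K) \is a GRing.unit.
Proof. exact: nB_unit n_gt1. Qed.

Lemma halfE : 2 * 2^-1 = 1 :> K.
Proof. exact: divrr two_unit. Qed.

Lemma nVE : n%:R * n%:R^-1 = 1 :> K.
Proof. exact: divrr n_unit. Qed.

Lemma nB1VE : (n%:R - 1) * (n%:R - 1)^-1 = 1 :> K.
Proof. exact: divrr nB1_unit. Qed.

Lemma d_nV a : d a n%:R^-1 = 0.
Proof. by rewrite -(ltn_predK n_gt1) d_natV. Qed.

Lemma askewE T a b : 2 * askew T a b = T a b - T b a.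
Proof. by rewrite mulrA halfE mul1r. Qed.

Lemma akulkarniE T a b c e : akulkarni T a b c e = kn h T a b c e.
Proof. by rewrite /akulkarni mulrBr !askewE /kn; ring. Qed.

Lemma tr_A23 c : tr (A c) = 0.
Proof. by rewrite -(A_tf c); apply: eq_tr => a b; rewrite A_sym12 A_sym23. Qed.

Lemma cov3_sym23 w a b c e : cov3 w A a b c e = cov3 w A a c b e.
Proof.
rewrite /cov3 (A_sym12 b c e).
under [X in _ - X - _ - _]eq_bigr do rewrite A_sym12.
under [X in _ - X - _ = _]eq_bigr do rewrite A_sym12.
under [X in _ - _ - X = _]eq_bigr do rewrite A_sym12.
ring.
Qed.

Lemma cov3_sym34 w a b c e : cov3 w A a b c e = cov3 w A a b e c.
Proof.
rewrite /cov3 (A_sym23 b c e).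
under [X in _ - X - _ - _]eq_bigr do rewrite A_sym23.
under [X in _ - X - _ = _]eq_bigr do rewrite A_sym23.
under [X in _ - _ - X = _]eq_bigr do rewrite A_sym23.
ring.
Qed.

Lemma cov1_0 w a b : cov1 w (fun=> 0) a b = 0.
Proof. by rewrite /cov1 /cov0 d_0 big1 => [|s _]; rewrite ?mulr0 ?subr0. Qed.

Lemma tr_cov3 a c : tr (cov3 2 A a c) = 0.
Proof.
rewrite -(cov1_tr (w' := 0)) ?subrr //.
by rewrite (cov1_ext _ _ _ tr_A23) cov1_0.
Qed.

Lemma adelta_sym a b : adelta a b = adelta b a.
Proof. by apply: eq_tr => c e; rewrite cov3_sym23. Qed.

Lemma tr_dotA1 v : tr (fun a b => dot (A a b) v) = 0.
Proof.
apply: etrans (esym (_ : dot (fun p => tr (fun a b => A a b p)) v = _)) _.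
  rewrite dotC // dot_tr; apply: eq_tr => a b; exact: dotC.
by rewrite (eq_dot _ A_tf (fun=> erefl)) dot0l.
Qed.

(* V = E + G and T = 2 P - (E - G). *)
Let V a b := S a b - Q a b.
Let T a b := S a b + Q a b.

Lemma T_sym a b : T a b = T b a. Proof. by rewrite /T S_sym Q_sym. Qed.

Lemma VE a b : V a b = E a b + G a b.
Proof. by rewrite /V SE QE; ring. Qed.

Lemma TE a b : T a b = 2 * P a b - (E a b - G a b).
Proof. by rewrite /T SE QE; ring. Qed.

Lemma tr_V : tr V = 0.
Proof. by rewrite (eq_tr _ VE) trD. Qed.

(** * Codazzi and Gauss parts of Y *)

Definition cod a b c e := 2 * (cov3 2 A a b c e - cov3 2 A b a c e)
  + (h a c * V b e - h b c * V a e) + (h a e * V b c - h b e * V a c).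

Definition gau a b c e := 2 * arlow a b c e
  + 2 * (dot (A a c) (A b e) - dot (A b c) (A a e)) - kn h T a b c e.

(** With [2 S = T + V] and [2 Q = T - V], the terms in [V] are symmetric in [c] and [e] and those in
    [T] are skew. Doubling avoids halves. *)
Lemma curvY_split a b c e : 2 * curvY a b c e = gau a b c e - cod a b c e.
Proof.
by rewrite /curvY /gau /cod /kn /T /V (h_sym c a) (h_sym c b) (h_sym e a) (h_sym e b); ring.
Qed.

Lemma cod_sym a b c e : cod a b c e = cod a b e c.
Proof. by rewrite /cod cov3_sym34 (cov3_sym34 _ b); ring. Qed.

Lemma cod_skew a b c e : cod a b c e = - cod b a c e.
Proof. rewrite /cod; ring. Qed.

Lemma gau_skew12 a b c e : gau a b c e = - gau b a c e.
Proof. rewrite /gau (rlow_skew12 a b) /kn; ring. Qed.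

Lemma gau_skew34 a b c e : gau a b c e = - gau a b e c.
Proof.
by rewrite /gau rlow_skew (dotC H_sym (A a e)) (dotC H_sym (A b e)) /kn; ring.
Qed.

(** If [gau = cod], both are symmetric and skew in the last two indices, hence zero as 2 is
    invertible. *)
Lemma curvY0 : (forall a b c e, curvY a b c e = 0) <->
  (forall a b c e, cod a b c e = 0) /\ (forall a b c e, gau a b c e = 0).
Proof.
split=> [Y0 | [c0 g0] a b c e]; last first.
  by apply: (mulrI two_unit); rewrite curvY_split c0 g0 subrr mulr0.
have gc a b c e : gau a b c e = cod a b c e.
  by apply/eqP; rewrite -subr_eq0 -curvY_split Y0 mulr0.
have g0 a b c e : gau a b c e = 0.
  by apply: (opp_eq0 two_unit); rewrite {1}gau_skew34 !gc cod_sym.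
by split=> // a b c e; rewrite -gc.
Qed.

(** Since [tr V = 0], the metric terms add up to [n V - V + V]; the trace of the second derivative
    of [A] vanishes because [A] is trace-free. *)
Lemma tr_cod b e : tr (fun a c => cod a b c e) = 2 * adelta b e + n%:R * V b e.
Proof.
rewrite 2!trD trZl (trB H (fun a c => cov3 2 A a b c e)).
rewrite (trB H (fun a c => h a c * _)) (trB H (fun a c => h a e * _)).
rewrite (tr_hl h_sym hH) (tr_hr H_sym hH).
rewrite (trZr H (V b e) h) (trZl H (h b e) V) (tr_h h_sym H_sym hH) tr_V.
have -> : tr (fun a c => cov3 2 A a b c e) = adelta b e.
  by apply: eq_tr => a c; rewrite cov3_sym34.
have -> : tr (fun a c => cov3 2 A b a c e) = 0.
  rewrite -[RHS](tr_cov3 b e); apply: eq_tr => a c.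
  by rewrite cov3_sym34 cov3_sym23.
ring.
Qed.

Lemma tr_gau b e : tr (fun a c => gau a b c e) =
  2 * aric b e - 2 * aAA b e - (n%:R - 2) * T b e - tr T * h b e.
Proof.
rewrite trB trD !trZl trB tr_rlow tr_kn //; last exact: T_sym.
rewrite tr_dotA1 //.
have -> : tr (fun a c => dot (A b c) (A a e)) = aAA b e.
  rewrite /aAA dot2E // -[RHS]trC //; apply: eq_tr => a c.
  by apply: eq_dot => // p; rewrite A_sym12.
ring.
Qed.

Let B a b := E a b - G a b.

Lemma tr_T : tr T = 2 * tr P - tr B.
Proof. by rewrite (eq_tr _ TE) trB trZl. Qed.

Lemma nB2_unit : n <> 2%N -> (n%:R - 2 : K) \is a GRing.unit.
Proof. by move=> /eqP n2; apply: nB_unit; rewrite ltn_neqAle eq_sym n2. Qed.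

(** Inverts the trace map of [tr_kn]. It is applied to Ricci and [P], and to [aAA] and [aPA]: the
    latter is the Schouten-type tensor of the quadratic term. *)
Lemma schouten_tr (r p : 'I_n -> 'I_n -> K) : n <> 2%N ->
  (forall a b, p a b = (n%:R - 2)^-1 * (r a b - tr r / (2 * (n%:R - 1)) * h a b)) ->
  forall a b, (n%:R - 2) * p a b + tr p * h a b = r a b.
Proof.
move=> n2 pE a b; have uE := divrr (nB2_unit n2).
have wE : 2 * (n%:R - 1) * (2 * (n%:R - 1))^-1 = 1 :> K.
  by rewrite divrr // unitrM two_unit nB1_unit.
have trp : tr p = tr r * (2 * (n%:R - 1))^-1.
  rewrite (eq_tr _ pE) trZl trB trZl (tr_h h_sym H_sym hH).
  set u := (n%:R - 2)^-1 in uE *; set w := (2 * (n%:R - 1))^-1 in wE *.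
  by apply: (lc2 (c := tr r * w) (c' := - u * tr r) uE wE); ring.
rewrite trp pE; set u := (n%:R - 2)^-1 in uE *; set w := (2 * _)^-1 in wE *.
by apply: (lc1 (c := r a b - tr r * w * h a b) uE); ring.
Qed.

Lemma tr_aPA2 : n = 2%N -> 2 * tr aPA = anormsq.
Proof.
move=> n2; rewrite (eq_tr H (T' := fun a b => 4^-1 * anormsq * h a b)) => [|a b].
2: by rewrite /aPA {1}n2.
rewrite trZl (tr_h h_sym H_sym hH) n2.
have e : 4 * 4^-1 = 1 :> K by apply: divrr; apply: (nat_unit 3).
by apply: (lc1 (c := anormsq) e); ring.
Qed.

Lemma aPA_n3 : n <> 2%N -> forall a b,
  aPA a b = (n%:R - 2)^-1 * (aAA a b - tr aAA / (2 * (n%:R - 1)) * h a b).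
Proof. by rewrite /aPA; case: eqP. Qed.

Lemma aPA_n2 : n = 2%N -> forall a b, 4 * aPA a b = anormsq * h a b.
Proof.
move=> n2 a b; rewrite /aPA {1}n2 eqxx.
have e : 4 * 4^-1 = 1 :> K by apply: divrr; apply: (nat_unit 3).
by apply: (lc1 (c := anormsq * h a b) e); ring.
Qed.

Lemma cod_V : (forall a b c e, cod a b c e = 0) ->
  forall a b, V a b = - (2 * n%:R^-1) * adelta a b.
Proof.
move=> c0 b e; have e0 : 2 * adelta b e + n%:R * V b e = 0.
  by rewrite -tr_cod (eq_tr _ (fun a c => c0 a b c e)) tr0.
by apply: (lc2 (c := n%:R^-1) (c' := - V b e) e0 nVE); ring.
Qed.

(** For [n >= 3], expressing Ricci by [P] in the trace of [gau] leaves [(n - 2) B + tr B h = 2 aAA],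
    which one more trace solves for [B]. For [n = 2] the double trace and [P_moebius] give
    [tr B = anormsq], and [EG_tf] says that [B] is a pure trace. *)
Lemma gau_B : (forall a b c e, gau a b c e = 0) -> forall a b, B a b = 2 * aPA a b.
Proof.
move=> g0; have e0 b e : 2 * aric b e - 2 * aAA b e - (n%:R - 2) * (2 * P b e - B b e)
    - (2 * tr P - tr B) * h b e = 0.
  by rewrite -TE -tr_T -tr_gau (eq_tr _ (fun a c => g0 a b c e)) tr0.
have tr_e0 : 2 * tr aric - 2 * anormsq - (n%:R - 2) * (2 * tr P - tr B)
    - (2 * tr P - tr B) * n%:R = 0.
  have := eq_tr H e0; rewrite tr0 3!trB !trZl (trB H (fun b e => 2 * P b e)) trZl.
  by rewrite (tr_h h_sym H_sym hH).
have [n2|n2] := eqVneq n 2%N; move=> a b.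
  have n2K : n%:R = 2 :> K by rewrite n2.
  have hB : tr B = anormsq.
    apply: (mulrI two_unit); move: tr_e0; rewrite P_moebius // n2K => e.
    by apply: (lc2 (c := 1) (c' := 2 * tr aric) e halfE); ring.
  have := EG_tf n2 a b; rewrite -/(B a b) -/(tr B) hB => eB.
  apply: (mulrI two_unit); rewrite mulrA (_ : 2 * 2 = 4); last by ring.
  rewrite aPA_n2 //; apply: (lc2 (c := 2) (c' := anormsq * h a b) eB nVE).
  rewrite n2K; ring.
move/eqP: n2 => n2.
have e1 p q : (n%:R - 2) * B p q + tr B * h p q = 2 * aAA p q.
  have eP := schouten_tr n2 (P_schouten n2) p q.
  by apply: (lc2 (c := 1) (c' := 2) (e0 p q) eP); ring.
have trB0 : 2 * (n%:R - 1) * tr B = 2 * anormsq.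
  have := eq_tr H e1; rewrite trD (trZl H (n%:R - 2)) (trZl H (tr B)) (trZl H 2).
  by rewrite (tr_h h_sym H_sym hH) => e; apply: (lc1 (c := 1) e); rewrite /anormsq; ring.
have uE := divrr (nB2_unit n2).
have wE : 2 * (n%:R - 1) * (2 * (n%:R - 1))^-1 = 1 :> K.
  by rewrite divrr // unitrM two_unit nB1_unit.
rewrite aPA_n3 // -/anormsq; apply: (mulrI (nB2_unit n2)).
set u := (n%:R - 2)^-1 in uE *; set w := (2 * _)^-1 in wE *.
rewrite (_ : _ * (2 * _) = 2 * (aAA a b - anormsq * w * h a b)); last first.
  by apply: (lc1 (c := 2 * (aAA a b - anormsq * w * h a b)) uE); ring.
have tB : tr B = 2 * w * anormsq.
  by apply: (lc2 (c := w) (c' := - tr B) trB0 wE); ring.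
by apply: (lc2 (c := 1) (c' := - h a b) (e1 a b) tB); ring.
Qed.

Lemma flat_EG : (forall a b c e, curvY a b c e = 0) ->
  (forall a b, E a b = - n%:R^-1 * adelta a b + aPA a b) /\
  (forall a b, G a b = - n%:R^-1 * adelta a b - aPA a b).
Proof.
move=> /curvY0[c0 g0]; split=> a b; apply: (mulrI two_unit);
  have := cod_V c0 a b; rewrite VE => eV; have := gau_B g0 a b; rewrite /B => eB.
- by apply: (lc2 (c := 1) (c' := 1) eV eB); ring.
- by apply: (lc2 (c := 1) (c' := -1) eV eB); ring.
Qed.

(** * The combinations X - Z and X + Z *)

Definition gp a b c := curvX a b c - curvZ a b c.
Definition cp a b c := - (curvX a b c + curvZ a b c).

(** [F] enters X and Z in the same way and cancels here; the derivatives of [Q] and [S] add up to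
    that of [T]. *)
Lemma gpE a b c : gp a b c = (cov2 0 T a b c - cov2 0 T b a c)
  + (dot (A a c) (V b) - dot (A b c) (V a)).
Proof.
rewrite /gp /curvX /curvZ !cov2D /V !dotBr // (dotC H_sym (S a)) (dotC H_sym (S b)).
ring.
Qed.

(** The roles of [T] and [V] are exchanged with respect to [gpE], and [F] doubles. The sign in [cp]
    gives [V] and [F] positive coefficients. *)
Lemma cpE a b c : cp a b c = (cov2 0 V a b c - cov2 0 V b a c)
  + (dot (A a c) (T b) - dot (A b c) (T a)) + 2 * (h a c * F b - h b c * F a).
Proof.
rewrite /cp /curvX /curvZ !cov2B /T !dotDr // (dotC H_sym (S a)) (dotC H_sym (S b)).
ring.
Qed.

Lemma gp_skew a b c : gp a b c = - gp b a c.
Proof. by rewrite !gpE; ring. Qed.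

Lemma cp_skew a b c : cp a b c = - cp b a c.
Proof. by rewrite !cpE; ring. Qed.

Lemma cov0_0 w a : cov0 w 0 a = 0.
Proof. by rewrite /cov0 d_0; ring. Qed.

Lemma tr_dotC U W : tr (fun a b => dot (U b) (W a)) = adot2 H U W.
Proof. by rewrite dot2E -[RHS](trC H_sym). Qed.

Lemma tr_cp b : tr (fun a c => cp a b c) =
  tr (fun a c => cov2 0 V a b c) - adot2 H (A b) T + 2 * (n%:R - 1) * F b.
Proof.
rewrite (eq_tr _ (fun a c => cpE a b c)) 2!trD trZl.
rewrite (trB H (fun a c => cov2 0 V a b c)) (trB H (fun a c => dot (A a c) _)).
rewrite (trB H (fun a c => h a c * _)) (tr_hr H_sym hH) (trZr H (F b) h).
rewrite (tr_h h_sym H_sym hH) tr_dotA1 tr_dotC.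
rewrite (_ : tr (fun a c => cov2 0 V b a c) = 0); last first.
  by rewrite -(cov0_tr V b (w' := -2)) ?tr_V ?cov0_0 // sub0r.
ring.
Qed.

Section Normalized.
Hypothesis EeqN : forall a b, E a b = - n%:R^-1 * adelta a b + aPA a b.
Hypothesis GeqN : forall a b, G a b = - n%:R^-1 * adelta a b - aPA a b.

Lemma TN a b : T a b = 2 * (P a b - aPA a b).
Proof. by rewrite TE EeqN GeqN; ring. Qed.

Lemma VN a b : V a b = - (2 * n%:R^-1) * adelta a b.
Proof. by rewrite VE EeqN GeqN; ring. Qed.

Lemma cov2_TN a b c : cov2 0 T a b c = 2 * (cov2 0 P a b c - cov2 0 aPA a b c).
Proof. by rewrite (cov2_ext _ _ _ _ TN) cov2Zl ?d_nat // cov2B. Qed.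

Lemma d_2nV a : d a (- (2 * n%:R^-1)) = 0.
Proof. by rewrite d_N dM d_nat d_nV; ring. Qed.

Lemma cov2_VN a b c : cov2 0 V a b c = - (2 * n%:R^-1) * cov2 0 adelta a b c.
Proof. by rewrite (cov2_ext _ _ _ _ VN) cov2Zl ?d_2nV. Qed.

Lemma dot_VN u a : dot u (V a) = - (2 * n%:R^-1) * dot u (adelta a).
Proof. by rewrite (eq_dot _ (fun=> erefl) (VN a)) dotZr. Qed.

Lemma tr_cpN b : tr (fun a c => cp a b c) = - (2 * n%:R^-1) * adelta2 b
  - 2 * adot2 H (A b) (fun p v => P p v - aPA p v) + 2 * (n%:R - 1) * F b.
Proof.
rewrite tr_cp (eq_tr _ (fun a c => cov2_VN a b c)) trZl.
by rewrite (eq_dot2 H (fun _ _ => erefl) TN) dot2ZR.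
Qed.

(** [F] occurs in the trace with the invertible coefficient [2 (n - 1)], so the stated formula is
    this trace equation solved for [F]. *)
Lemma F_cp b : tr (fun a c => cp a b c) = 0 <->
  F b = (n%:R * (n%:R - 1))^-1 * adelta2 b
        + (n%:R - 1)^-1 * adot2 H (fun p v => A b p v) (fun p v => P p v - aPA p v).
Proof.
rewrite tr_cpN invrM ?n_unit ?nB1_unit //.
set D2 := adelta2 b; set DD := adot2 _ _ _.
have wE := nB1VE; set w := (n%:R - 1)^-1 in wE *.
split=> e.
  apply: (mulrI two_unit).
  by apply: (lc2 (c := w) (c' := - 2 * F b) e wE); ring.
rewrite e; apply: (lc1 (c := 2 * (n%:R^-1 * D2 + DD)) wE); ring.
Qed.

Lemma cod_codazzi3 a b c e : cod a b c e = 4 * codazzi3 a b c e.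
Proof.
have e1 := askewE (fun a b => cov3 2 A a b c e) a b.
have e2 := askewE (fun a b => h e a * adelta b c) a b.
have e3 := askewE (fun a b => h c a * adelta b e) a b.
rewrite /cod /codazzi3 !VN (h_sym a c) (h_sym b c) (h_sym a e) (h_sym b e).
by apply: (lc3 (c := - 2) (c' := 2 * n%:R^-1) (c'' := 2 * n%:R^-1) e1 e2 e3); ring.
Qed.

(** The quadratic term [Z] has Ricci-type trace [- aAA / 2], so taking its trace-free part subtracts
    [kn] of [- aPA / 2]. Together with the [kn P] inside Weyl this makes up [- kn T], because
    [T = 2 (P - aPA)]. *)
Lemma gau_gauss4 a b c e : n <> 2%N -> gau a b c e = 2 * gauss4 a b c e.
Proof.
move=> n2; rewrite /gauss4 /atf4 /aweyl !akulkarniE.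
pose Z a b c e := 2^-1 * (dot (A a c) (A b e) - dot (A b c) (A a e)).
have ZE p q r s : askew (fun a b => dot (fun v => A v r a) (fun v => A b s v)) p q
    = Z p q r s.
  rewrite /Z /askew; congr (_ * (_ - _)); apply: eq_dot => v //;
  by rewrite A_sym12 A_sym23 A_sym12.
have trZ q s : tr (fun p r => Z p q r s) = - 2^-1 * aAA q s.
  rewrite trZl trB tr_dotA1 (_ : tr _ = aAA q s) ?sub0r ?mulrN ?mulNr //.
  rewrite /aAA dot2E // -[RHS]trC //; apply: eq_tr => p r.
  by apply: eq_dot => // v; rewrite A_sym12.
rewrite ZE (eq_kn h (Q' := fun p q => - 2^-1 * aPA p q)) => [|p q]; last first.
  rewrite (eq_tr _ (fun _ _ => ZE _ _ _ _)) trZ.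
  rewrite (eq_tr _ (fun p q => etrans (eq_tr _ (fun _ _ => ZE _ _ _ _)) (trZ p q))) trZl.
  by rewrite aPA_n3 //; ring.
have hE := halfE; rewrite /gau /Z /kn !TN; set w := 2^-1 in hE *.
set AA1 := dot _ _; set AA2 := dot _ _.
pose k := AA1 - AA2 + kn h aPA a b c e.
by apply: (lc1 (c := - 2 * k) hE); rewrite /k /kn; ring.
Qed.

(** By [skew4_dim2] only the double trace matters; it cancels as [tr P] is half the scalar curvature
    and [tr aPA] half of [anormsq]. *)
Lemma gau0_n2 : n = 2%N -> forall a b c e, gau a b c e = 0.
Proof.
move=> n2; have n2K : n%:R = 2 :> K by rewrite n2.
apply: (skew4_dim2 two_unit n2 hH gau_skew12 gau_skew34).
rewrite (eq_tr _ (fun b e => tr_gau b e)) 3!trB !trZl (tr_h h_sym H_sym hH).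
rewrite -/anormsq (eq_tr _ TN) trZl trB n2K P_moebius //.
by apply: (lc2 (c := - 2 * tr aric) (c' := 2) halfE (tr_aPA2 n2)); ring.
Qed.

(** Ricci and [aAA] are both recovered from their Schouten-type tensors, so [gau] is trace-free. As
    for the Weyl tensor, in dimension 3 this forces zero. *)
Lemma gau0_n3 : n = 3%N -> forall a b c e, gau a b c e = 0.
Proof.
move=> n3; have n2 : n <> 2%N by rewrite n3.
apply: (skew4_dim3 two_unit n3 hH H_sym gau_skew12 gau_skew34) => b e.
rewrite tr_gau (eq_tr _ TN) trZl trB TN.
have e1 := schouten_tr n2 (P_schouten n2) b e.
have e2 := schouten_tr n2 (aPA_n3 n2) b e.
by apply: (lc2 (c := - 2) (c' := 2) e1 e2); ring.
Qed.

Lemma gp_gauss3 a b c : n = 3%N -> gp a b c = - 4 * gauss3 a b c.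
Proof.
move=> n3; have n3K : n%:R = 3 :> K by rewrite n3.
rewrite gpE !cov2_TN !dot_VN n3K /gauss3 /acotton /askew.
have E1 x y : dot (fun p => A p c x) (fun p => adelta y p) = dot (A x c) (adelta y).
  by apply: eq_dot => // p; rewrite A_sym23 A_sym12 A_sym23.
rewrite !E1; have hE := halfE; set w := 2^-1 in hE *.
set k1 := dot _ _; set k2 := dot _ _.
set p1 := cov2 _ _ _ _ _; set p2 := cov2 _ _ _ _ _.
set p3 := cov2 _ _ _ _ _; set p4 := cov2 _ _ _ _ _.
by apply: (lc1 (c := 2 * (p2 - p4 + 3^-1 * (k1 - k2) - (p1 - p3))) hE); ring.
Qed.

(** In dimension 2 [aPA] is [anormsq h / 4]. With [h] parallel, the derivative of its trace and its
    divergence are one half and one quarter of the derivative of [anormsq]: these are [e1] and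
    [e2]. *)
Lemma gp_gauss2 a : n = 2%N -> gauss2 a = - 2 * tr (gp a).
Proof.
move=> nn2; have n2K : n%:R = 2 :> K by rewrite nn2.
rewrite (eq_tr _ (gpE a)) trD (trB H (fun b c => cov2 0 T a b c)).
rewrite (trB H (fun b c => dot (A a c) _)).
rewrite (eq_tr _ (fun b c => cov2_TN a b c)) (eq_tr _ (fun b c => cov2_TN b a c)).
rewrite !trZl (trB H (fun b c => cov2 0 P a b c)) (trB H (fun b c => cov2 0 P b a c)).
rewrite (eq_tr _ (fun b c => dot_VN (A a c) b)) (eq_tr _ (fun b c => dot_VN (A b c) a)).
rewrite !trZl tr_dotA1 tr_dotC.
rewrite /gauss2; have -> : 8 * tr (fun p v => acotton a p v) =
    4 * (tr (fun b c => cov2 0 P a b c) - tr (fun b c => cov2 0 P b a c)).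
  rewrite -trB -!trZl; apply: eq_tr => b c.
  by rewrite -(askewE (fun a b => cov2 0 P a b c)) /acotton; ring.
have e1 : 2 * tr (fun b c => cov2 0 aPA a b c) = cov0 (-2) anormsq a.
  rewrite -(cov0_tr aPA a (w' := -2)) ?sub0r // -(tr_aPA2 nn2).
  by rewrite [in RHS]mulr_natl mulr2n cov0D; ring.
have e2 : 4 * tr (fun b c => cov2 0 aPA b a c) = cov0 (-2) anormsq a.
  rewrite -trZl -[RHS](tr_hr H_sym hH a (fun b => cov0 (-2) anormsq b)).
  apply: eq_tr => b c; rewrite -(cov2Zl (k := 4)) ?d_nat //.
  rewrite (_ : cov2 0 _ b a c = cov2 0 (fun p q => h p q * anormsq) b a c).
  2: by apply: cov2_ext => p q; rewrite aPA_n2 // mulrC.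
  by rewrite (cov2Zr (w1 := 2) (w2 := -2)) ?subrr // cov2_h mul0r add0r.
have hE := halfE; rewrite n2K; set w := 2^-1 in hE *.
set k1 := tr _ in e1 *; set k2 := tr _ in e2 *.
set k3 := adot2 _ _ _.
by apply: (lc3 (c := - 2) (c' := 1) (c'' := - 2 * k3) e1 e2 hE); ring.
Qed.

Hypothesis FeqN : forall a, F a = (n%:R * (n%:R - 1))^-1 * adelta2 a
  + (n%:R - 1)^-1 * adot2 H (fun p v => A a p v) (fun p v => P p v - aPA p v).

Lemma cov3_dot w1 w2 w (B' : 'I_n -> 'I_n -> 'I_n -> K) (T' : 'I_n -> 'I_n -> K)
    a b c e : w = w1 + w2 - 2 ->
  cov3 w (fun b c e => dot (B' b c) (T' e)) a b c e =
  dot (cov3 w1 B' a b c) (T' e) + dot (B' b c) (cov2 w2 T' a e).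
Proof.
move=> ew; rewrite {1}/cov3 (cov0_dot _ _ _ ew).
rewrite (_ : dot (cov3 w1 B' a b c) (T' e) = dot (cov1 w1 (B' b c) a) (T' e)
  - \sum_(p < n) Gm p a b * dot (B' p c) (T' e)
  - \sum_(p < n) Gm p a c * dot (B' b p) (T' e)); last first.
  rewrite (_ : \sum_(p < n) Gm p a b * _ =
    dot (fun f => \sum_(p < n) Gm p a b * B' p c f) (T' e)); last first.
    by symmetry; apply: etrans (dot_suml _ _ _) _; apply: eq_bigr => p _; rewrite dotZl.
  rewrite (_ : \sum_(p < n) Gm p a c * _ =
    dot (fun f => \sum_(p < n) Gm p a c * B' b p f) (T' e)); last first.
    by symmetry; apply: etrans (dot_suml _ _ _) _; apply: eq_bigr => p _; rewrite dotZl.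
  by rewrite -!dotBl //; apply: eq_dot => // f; rewrite /cov3 /cov1; ring.
rewrite (_ : dot (B' b c) (cov2 w2 T' a e) = dot (B' b c) (cov1 w2 (T' e) a)
  - \sum_(p < n) Gm p a e * dot (B' b c) (T' p)); last first.
  rewrite (_ : \sum_(p < n) Gm p a e * _ =
    dot (B' b c) (fun f => \sum_(p < n) Gm p a e * T' p f)); last first.
    by symmetry; apply: etrans (dot_sumr H_sym _ _) _; apply: eq_bigr => p _; rewrite dotZr.
  by rewrite -dotBr //; apply: eq_dot => // f; rewrite /cov2 /cov1; ring.
ring.
Qed.

Lemma cov1_dot2 (T' : 'I_n -> 'I_n -> K) a b :
  cov1 (-2) (fun b => adot2 H (A b) T') a b =
  adot2 H (cov3 2 A a b) T' + adot2 H (A b) (cov2 0 T' a).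
Proof.
rewrite (cov1_ext _ _ _ (fun b => dot2E H (A b) T')) (cov1_tr _ _ _ (w := 0)) ?sub0r //.
rewrite !dot2E -trD; apply: eq_tr => c e.
by rewrite (cov3_dot (w1 := 2) (w2 := 0)) // addr0 subrr.
Qed.

(** Being a pure trace, [aPA] drops out of [F] and of the skew part of the [S], [Q] contraction. The
    coefficient 4 in [codazzi2] has two equal sources: the derivative of [A] inside that of [F], and
    the contraction of [S] with [Q]. *)
Lemma codazzi2_N a b : n = 2%N -> (forall a b c e, cod a b c e = 0) ->
  curvN a b = - codazzi2 a b.
Proof.
move=> nn2 c0; have n2K : n%:R = 2 :> K by rewrite nn2.
have FE c : F c = 2^-1 * adelta2 c + adot2 H (A c) P.
  rewrite FeqN n2K (_ : 2 - 1 = 1 :> K); last by ring.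
  rewrite mulr1 invr1 mul1r dot2BR //; congr (_ + _).
  have -> : adot2 H (A c) aPA = 0.
    apply: (mulrI (nat_unit 3)); rewrite mulr0 -dot2ZR //.
    rewrite (eq_dot2 H (fun _ _ => erefl) (aPA_n2 nn2)) dot2ZR //.
    by rewrite dot2_h // tr_A23 mulr0.
  by rewrite subr0.
have nF x y : cov1 (-2) F x y = 2^-1 * cov1 (-2) adelta2 x y
    + (adot2 H (cov3 2 A x y) P + adot2 H (A y) (cov2 0 P x)).
  by rewrite (cov1_ext _ _ _ FE) cov1D cov1Zl ?d_natV // cov1_dot2.
have hE := halfE.
have VN2 x y : V x y = - adelta x y by rewrite VN n2K hE mulN1r.
have dV x y : adot2 H (fun c e => h x c * V y e) P = - dot (adelta y) (P x).
  rewrite dot2E; transitivity (tr (fun c e => h x c * dot (V y) (P e))).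
    by apply: eq_tr => c e; rewrite dotZl.
  rewrite (tr_hl' hH x (fun e => dot (V y) (P e))).
  by rewrite (eq_dot _ (VN2 y) (fun=> erefl)) dotNl.
have dV' x y : adot2 H (fun c e => h x e * V y c) P = - dot (adelta y) (P x).
  by rewrite -dV (dot2_sym H _ P_sym).
(* [cod = 0] trades the skew part of the derivative of [A] for products of [h] and [V], and
   [V = - adelta] when [n = 2]. *)
have e1 : 2 * (adot2 H (cov3 2 A a b) P - adot2 H (cov3 2 A b a) P) =
    2 * (dot (adelta b) (P a) - dot (adelta a) (P b)).
  rewrite !(dot2C H_sym (cov3 _ _ _ _)) -(dot2BR H) -(dot2ZR H).
  rewrite (eq_dot2 H (fun _ _ => erefl) (T' := fun c e =>
    (h b c * V a e - h a c * V b e) + (h b e * V a c - h a e * V b c))) => [|c e].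
    rewrite dot2DR // (dot2BR H P (fun c e => h b c * V a e)).
    rewrite (dot2BR H P (fun c e => h b e * V a c)) !(dot2C H_sym P) !dV !dV'.
    ring.
  by move: (c0 a b c e); rewrite /cod => eq0; apply: (lc1 (c := 1) eq0); ring.
(* With [S] and [Q] equal to [P - aPA] minus and plus [adelta / 2], only the cross terms are skew;
   those with [aPA] cancel because [adelta] is symmetric. *)
have e2 : dot (S a) (Q b) - dot (S b) (Q a) =
    dot (adelta b) (P a) - dot (adelta a) (P b).
  have SN x y : S x y = (P x y - aPA x y) - 2^-1 * adelta x y.
    by rewrite SE GeqN n2K; ring.
  have QN x y : Q x y = (P x y - aPA x y) + 2^-1 * adelta x y.
    by rewrite QE EeqN n2K; ring.
  have dPA x y : 4 * dot (adelta y) (aPA x) = anormsq * adelta x y.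
    rewrite -dotZr // (eq_dot _ (fun=> erefl) (aPA_n2 nn2 x)) dotZr //.
    by rewrite dot_hr // adelta_sym.
  have dSQ x y : dot (S x) (Q y) =
      dot (fun c => P x c - aPA x c) (fun c => P y c - aPA y c)
      + 2^-1 * (dot (adelta y) (P x) - dot (adelta y) (aPA x))
      - 2^-1 * (dot (adelta x) (P y) - dot (adelta x) (aPA y))
      - 2^-1 * 2^-1 * dot (adelta x) (adelta y).
    rewrite (eq_dot _ (SN x) (QN y)) (dotBl _ _ (fun c => P x c - aPA x c)) //.
    rewrite !(dotDr _ _ (fun c => P y c - aPA y c)) // !dotZr // !dotZl //.
    rewrite (dotC H_sym (fun c => P x c - aPA x c) (adelta y)) !dotBr //.
    ring.
  have dPA' : dot (adelta b) (aPA a) = dot (adelta a) (aPA b).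
    by apply: (mulrI (nat_unit 3)); rewrite !dPA adelta_sym.
  rewrite !dSQ (dotC H_sym (fun c => P b c - _)) (dotC H_sym (adelta b) (adelta a)).
  rewrite dPA'.
  by apply: (lc1 (c := dot (adelta b) (P a) - dot (adelta a) (P b)) hE); ring.
rewrite /curvN e2 !nF /codazzi2.
have s2 := askewE (fun a b => dot (fun p => P p a) (fun p => adelta b p)) a b.
have s3 := askewE (fun a b => adot2 H (fun c p => A c p a) (fun c p => cov2 0 P b c p)) a b.
have P1 x y : dot (fun p => P p x) (fun p => adelta y p) = dot (adelta y) (P x).
  by rewrite dotC //; apply: eq_dot => // p; rewrite P_sym.
have A1 x y : adot2 H (fun c p => A c p x) (fun c p => cov2 0 P y c p) =
    adot2 H (A x) (cov2 0 P y).
  by apply: eq_dot2 => // c p; rewrite A_sym23 A_sym12.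
rewrite !P1 in s2; rewrite !A1 in s3.
move: e1 s2 s3; rewrite [askew (fun a b => cov1 _ _ _ _) _ _]/askew.
set k2 := askew _ _ _; set k3 := askew _ _ _ => e1 s2 s3.
apply: (mulrI two_unit).
by apply: (lc3 (c := - 1) (c' := 4) (c'' := - 2) e1 s2 s3); ring.
Qed.

End Normalized.

(** * Traces of the Jacobi identity *)

Lemma curvX_skew a b c : curvX a b c = - curvX b a c.
Proof. by rewrite /curvX; ring. Qed.

Lemma curvZ_skew a b c : curvZ a b c = - curvZ b a c.
Proof. by rewrite /curvZ; ring. Qed.

Lemma curvN_skew a b : curvN a b = - curvN b a.
Proof. by rewrite /curvN; ring. Qed.

Let xi b := tr (fun e c => curvX b e c).
Let zeta b := tr (fun e c => curvZ b e c).

Lemma tr_curvX12 a : tr (fun e c => curvX e a c) = - xi a.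
Proof. by rewrite /xi -trN; apply: eq_tr => e c; apply: curvX_skew. Qed.

Lemma tr_curvZ12 a : tr (fun e c => curvZ e a c) = - zeta a.
Proof. by rewrite /zeta -trN; apply: eq_tr => e c; apply: curvZ_skew. Qed.

Section Bianchi.
Hypothesis Y0 : forall a b c e, curvY a b c e = 0.
Hypothesis cp0 : forall b, tr (fun a c => cp a b c) = 0.

Lemma xi_zeta b : zeta b = - xi b.
Proof.
have := cp0 b; rewrite trN (trD H (fun a c => curvX a b c)) tr_curvX12 tr_curvZ12.
by rewrite -opprD opprK => /eqP; rewrite addrC addr_eq0 => /eqP.
Qed.

(** The contraction of [bianchi2_XZ] over [e] and [c]; contracting over [e] and [f] gives its
    companion with X and Z exchanged. *)
Lemma bianchi_traceZ a b f : (n%:R - 2) * curvZ a b f + curvX a b f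
  + (xi b * h a f - xi a * h b f) = 0.
Proof.
have := eq_tr H (fun e c => bianchi2_XZ e a b c f Y0); rewrite tr0 => eq0.
have {}eq0 : n%:R * curvZ a b f + curvX a b f + (curvZ b a f + xi b * h a f)
    + (curvZ b a f - xi a * h b f) = 0.
  rewrite -eq0 2!trD (trD H (fun e c => h e c * _)) (trD H (fun e c => h a c * _)).
  rewrite (trD H (fun e c => h b c * _)).
  rewrite (tr_hr H_sym hH a (fun e => curvZ b e f)).
  rewrite (tr_hr H_sym hH b (fun e => curvZ e a f)).
  rewrite (trZr H (h a f) (fun e c => curvX b e c)).
  rewrite (trZr H (h b f) (fun e c => curvX e a c)) tr_curvX12.
  rewrite (trZr H (curvZ a b f) h) (tr_h h_sym H_sym hH).
  rewrite [in RHS](_ : tr (fun e c => curvX a b c * h e f) = curvX a b f).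
    by rewrite mulNr.
  rewrite -[RHS](tr_hl h_sym hH f (fun c => curvX a b c)).
  by apply: eq_tr => e c; rewrite mulrC.
by rewrite -eq0 (curvZ_skew b a); ring.
Qed.

Lemma bianchi_traceX a b c : curvZ a b c + (n%:R - 2) * curvX a b c
  + (zeta b * h a c - zeta a * h b c) = 0.
Proof.
have := eq_tr H (fun e f => bianchi2_XZ e a b c f Y0); rewrite tr0 => eq0.
have {}eq0 : curvZ a b c + n%:R * curvX a b c + (zeta b * h a c + curvX b a c)
    + (- zeta a * h b c + curvX b a c) = 0.
  rewrite -eq0 2!trD (trD H (fun e f => h e c * _)) (trD H (fun e f => h a c * _)).
  rewrite (trD H (fun e f => h b c * _)).
  rewrite (tr_hl h_sym hH c (fun f => curvZ a b f)).
  rewrite (trZl H (curvX a b c) h) (tr_h h_sym H_sym hH).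
  rewrite (trZl H (h a c) (fun e f => curvZ b e f)).
  rewrite (trZl H (h b c) (fun e f => curvZ e a f)) tr_curvZ12.
  have XE x y : tr (fun e f => curvX x e c * h y f) = curvX x y c.
    rewrite -[RHS](tr_hr H_sym hH y (fun e => curvX x e c)).
    by apply: eq_tr => e f; rewrite mulrC.
  rewrite XE [in RHS](_ : tr (fun e f => curvX e a c * h b f) = curvX b a c).
    by rewrite [curvX a b c * _]mulrC [zeta b * _]mulrC mulNr mulrN [zeta a * _]mulrC.
  rewrite -[RHS](tr_hr H_sym hH b (fun e => curvX e a c)).
  by apply: eq_tr => e f; rewrite mulrC.
by rewrite -eq0 (curvX_skew b a); ring.
Qed.

(** In the sum of the two traces the [xi] and [zeta] terms cancel, because the trace of [cp]
    vanishes, and [(n - 1) (X + Z)] is left. *)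
Lemma curvXZ a b c : curvX a b c + curvZ a b c = 0.
Proof.
apply: (mulrI nB1_unit); rewrite mulr0.
have e1 := bianchi_traceZ a b c; have e2 := bianchi_traceX a b c.
by rewrite !xi_zeta in e2; apply: (lc2 (c := 1) (c' := 1) e1 e2); ring.
Qed.

(** With [Z = - X] a trace of the Jacobi identity expresses [(n - 3) X] by [xi] and [h]. Its own
    trace reads [2 (n - 2) xi = 0], and then [n - 3] can be divided out. *)
Lemma curvX0_n4 : (4 <= n)%N -> forall a b c, curvX a b c = 0.
Proof.
move=> n4; have n3U : (n%:R - 3 : K) \is a GRing.unit by apply: nB_unit.
have n2U : (n%:R - 2 : K) \is a GRing.unit by apply: nB_unit; apply: ltn_trans n4.
have e a b c : (n%:R - 3) * curvX a b c = xi b * h a c - xi a * h b c.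
  have e1 := bianchi_traceX a b c; have e2 := curvXZ a b c.
  by rewrite !xi_zeta in e1; apply: (lc2 (c := 1) (c' := - 1) e1 e2); ring.
have xi0 a : xi a = 0.
  have := eq_tr H (e a); rewrite trZl (trB H (fun b c => xi b * _)).
  rewrite (trZl H (xi a) h) (tr_h h_sym H_sym hH).
  rewrite (_ : tr (fun b c => xi b * h a c) = xi a); last first.
    rewrite -[RHS](tr_hr H_sym hH a xi); by apply: eq_tr => p q; rewrite mulrC.
  rewrite -/(xi a) => e1; apply: (mulrI two_unit); apply: (mulrI n2U).
  by apply: (lc1 (c := 1) e1); ring.
by move=> a b c; apply: (mulrI n3U); rewrite e !xi0; ring.
Qed.

(** By skewness the trace of [bianchi2_N] is [(n - 2) curvN]. *)
Lemma curvN0 : (3 <= n)%N -> (forall a b c, curvX a b c = 0) ->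
  forall a b, curvN a b = 0.
Proof.
move=> n3 X0 a b.
have n2U : (n%:R - 2 : K) \is a GRing.unit by apply: nB_unit.
have := eq_tr H (fun e c => bianchi2_N e a b c Y0 X0); rewrite tr0 2!trD.
rewrite (trZr H (curvN a b) h) (tr_h h_sym H_sym hH).
rewrite (tr_hr H_sym hH a (curvN b)) (tr_hr H_sym hH b (curvN^~ a)) => e.
have e' := curvN_skew b a.
apply: (mulrI n2U); apply: (lc2 (c := 1) (c' := - 2) e e'); ring.
Qed.

End Bianchi.

Theorem curvature_zeroP :
  [/\ forall a b c, curvX a b c = 0, forall a b c e, curvY a b c e = 0,
      forall a b, curvN a b = 0 & forall a b c, curvZ a b c = 0]
  <->
  tensors_eq
  /\ [/\ (4 <= n)%N -> forall a b c e, gauss4 a b c e = 0,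
         n = 3%N -> forall a b c, gauss3 a b c = 0 &
         n = 2%N -> forall a, gauss2 a = 0]
  /\ ((3 <= n)%N -> forall a b c e, codazzi3 a b c e = 0)
  /\ (n = 2%N -> forall a b, codazzi2 a b = 0).
Proof.
have fourU : (4 : K) \is a GRing.unit by apply: (nat_unit 3).
split=> [[X0 Y0 N0 Z0]|[[EN GN FN] [[G4 G3 G2] [C3 C2]]]].
  have [EN GN] := flat_EG Y0; have [c0 g0] := curvY0.1 Y0.
  have gp0 a b c : gp a b c = 0 by rewrite /gp X0 Z0 subrr.
  have cp0 a b c : cp a b c = 0 by rewrite /cp X0 Z0 addr0 oppr0.
  have FN a := (F_cp EN GN a).1 (etrans (eq_tr H (fun b c => cp0 b a c)) (tr0 H)).
  split; first by split.
  split; split=> nn.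
  - move=> a b c e; apply: (mulrI two_unit).
    by rewrite mulr0 -(gau_gauss4 EN GN) // => n2; rewrite n2 in nn.
  - move=> a b c; apply: (mulrI fourU); apply: oppr_inj.
    by rewrite mulr0 oppr0 -mulNr -(gp_gauss3 EN GN).
  - by move=> a; rewrite (gp_gauss2 EN GN) // (eq_tr _ (gp0 a)) tr0 mulr0.
  - by move=> a b c e; apply: (mulrI fourU); rewrite mulr0 -(cod_codazzi3 EN GN).
  - by move=> a b; apply: oppr_inj; rewrite -(codazzi2_N EN GN FN) // N0 oppr0.
(* The formula for [F] is used through this trace in all dimensions: in dimension 2 it kills [cp],
   in the others it feeds the Jacobi argument. *)
have tr_cp0 b : tr (fun a c => cp a b c) = 0 by apply/(F_cp EN GN).
have [n2|n2] := eqVneq n 2%N.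
  have c0 a b c e : cod a b c e = 0.
    (* The first two indices are exchanged so that the contraction required is that of [tr_cod]; it
       vanishes by the formula for [V]. *)
    apply: (skew3_dim2 two_unit n2 hH (D := fun a b c => cod b a c e)) => [p q r|p].
      exact: cod_skew.
    rewrite tr_cod (VN EN GN).
    have eN := nVE; apply: (lc1 (c := - 2 * adelta p e) eN); ring.
  have g0 := gau0_n2 EN GN n2.
  have Y0 : forall a b c e, curvY a b c e = 0 by apply/curvY0.
  have gp0 := skew3_dim2 two_unit n2 hH gp_skew (fun a => _ : tr (gp a) = 0).
  have cp0 a b c : cp a b c = 0.
    apply: (skew3_dim2 two_unit n2 hH (D := fun a b c => cp b a c)) => [p q r|p] //.
    exact: cp_skew.
  have {}gp0 : forall a b c, gp a b c = 0.
    apply: gp0 => a; apply: (mulrI two_unit); apply: oppr_inj.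
    by rewrite -mulNr -(gp_gauss2 EN GN) // G2 // mulr0 oppr0.
  have X0 a b c : curvX a b c = 0.
    apply: (mulrI two_unit).
    by apply: (lc2 (c := 1) (c' := - 1) (gp0 a b c) (cp0 a b c)); rewrite /gp /cp; ring.
  split=> // [a b|a b c].
    by rewrite (codazzi2_N EN GN FN) // C2 // oppr0.
  by apply: (lc2 (c := - 1) (c' := 1) (gp0 a b c) (X0 a b c)); rewrite /gp; ring.
have n3 : (3 <= n)%N by rewrite ltn_neqAle eq_sym n2.
have n2' : n <> 2%N by apply/eqP.
have c0 a b c e : cod a b c e = 0 by rewrite (cod_codazzi3 EN GN) C3 ?mulr0.
have [n3'|n3'] := eqVneq n 3%N.
  have Y0 : forall a b c e, curvY a b c e = 0.
    by apply/curvY0; split=> //; apply: (gau0_n3 EN GN n3').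
  have XZ := curvXZ Y0 tr_cp0.
  (* The Gauss equation gives X - Z = 0 and the Jacobi identity X + Z = 0. *)
  have X0 a b c : curvX a b c = 0.
    have e1 : gp a b c = 0 by rewrite (gp_gauss3 EN GN) // G3 // mulr0.
    apply: (mulrI two_unit).
    by apply: (lc2 (c := 1) (c' := 1) e1 (XZ a b c)); rewrite /gp; ring.
  split=> // [|a b c]; first exact: curvN0.
  by have := XZ a b c; rewrite X0 add0r.
have n4 : (4 <= n)%N by rewrite ltn_neqAle eq_sym n3'.
have Y0 : forall a b c e, curvY a b c e = 0.
  by apply/curvY0; split=> // a b c e; rewrite (gau_gauss4 EN GN) // G4 // mulr0.
have X0 := curvX0_n4 Y0 tr_cp0 n4.
split=> // [|a b c]; first exact: curvN0.
by have := curvXZ Y0 tr_cp0 a b c; rewrite X0 add0r.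
Qed.

(** * Lowering the index of mu *)

Definition low (m : 'I_n -> K) b := \sum_(c < n) h b c * m c.

Lemma raise_low m b : \sum_(c < n) H b c * low m c = m b.
Proof.
rewrite -[RHS](sum_delta b m).
under eq_bigr do rewrite mulr_sumr.
rewrite exchange_big; apply: eq_bigr => e _ /=.
rewrite -(Hh h_sym H_sym hH) mulr_suml; by apply: eq_bigr => c _; rewrite mulrA.
Qed.

Lemma low_raise m b : low (fun c => \sum_(e < n) H c e * m e) b = m b.
Proof.
rewrite -[RHS](sum_delta b m) /low.
under eq_bigr do rewrite mulr_sumr.
rewrite exchange_big; apply: eq_bigr => e _ /=.
rewrite -hH mulr_suml; by apply: eq_bigr => c _; rewrite mulrA.
Qed.

Lemma dot_low u m : dot u (low m) = \sum_(c < n) u c * m c.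
Proof.
rewrite -[in RHS](eq_bigr _ (fun c _ => congr1 ( *%R (u c)) (raise_low m c))).
apply: eq_bigr => c _; rewrite mulr_sumr; by apply: eq_bigr => e _; ring.
Qed.

Lemma cov1_low w w' m a b : w' = w + 2 -> cov1 w' (low m) a b = low (covV w m a) b.
Proof.
move=> ->.
rewrite /low /cov1 /covV /cov0 d_sum.
rewrite (eq_bigr (fun c => h b c * (d a (m c) - w * th a * m c)
   + (w + 2) * th a * (h b c * m c)
   + ((\sum_(e < n) Gm e a b * h e c) * m c
      + (\sum_(e < n) Gm e a c * h b e) * m c))); last first.
  by move=> c _; rewrite dM nabla_h; ring.
rewrite !big_split /= -mulr_sumr.
rewrite (_ : \sum_(c < n) (\sum_(e < n) Gm e a b * h e c) * m c =
    \sum_(e < n) Gm e a b * \sum_(c < n) h e c * m c); last first.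
  under eq_bigr do rewrite mulr_suml.
  rewrite exchange_big; apply: eq_bigr => e _; rewrite mulr_sumr.
  by apply: eq_bigr => c _; rewrite mulrA.
rewrite (_ : \sum_(c < n) (\sum_(e < n) Gm e a c * h b e) * m c =
    \sum_(e < n) h b e * \sum_(c < n) Gm e a c * m c); last first.
  under eq_bigr do rewrite mulr_suml.
  rewrite exchange_big; apply: eq_bigr => e _; rewrite mulr_sumr.
  by apply: eq_bigr => c _; ring.
under [in RHS]eq_bigr do rewrite mulrDr.
rewrite big_split /=; ring.
Qed.

(** Follows [bold_nabla] term by term, including a [- 0] for the first row of [tildeA], so that the
    two can be matched structurally. *)
Definition uconn a (U : aslots) := Tract
  (cov0 1 (ts U) a - \sum_(c < n) h a c * tm U c - 0)
  (fun b => covV (-1) (tm U) a b + (a == b)%:R * tp U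
     + (\sum_(c < n) H b c * P a c) * ts U
     - ((\sum_(c < n) H b c * E a c) * ts U
        + \sum_(c < n) (\sum_(e < n) H b e * A a c e) * tm U c))
  (cov0 (-1) (tp U) a - \sum_(c < n) P a c * tm U c
   - (F a * ts U + \sum_(c < n) G a c * tm U c)).

Definition lowt U := Tract (ts U) (low (tm U)) (tp U).

Lemma lowD u v b : low (fun c => u c + v c) b = low u b + low v b.
Proof. by rewrite -big_split; apply: eq_bigr => c _; rewrite mulrDr. Qed.

Lemma lowB u v b : low (fun c => u c - v c) b = low u b - low v b.
Proof. by rewrite -sumrB; apply: eq_bigr => c _; rewrite mulrBr. Qed.

Lemma lowZr u f b : low (fun c => u c * f) b = low u b * f.
Proof. by rewrite mulr_suml; apply: eq_bigr => c _; rewrite mulrA. Qed.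

(** Lowering commutes with the derivative since [h] is parallel, and its weight 2 turns the weight
    -1 of mu into 1. *)
Lemma lowt_uconn a U : lowt (uconn a U) = conn a (lowt U).
Proof.
rewrite /lowt /conn /=; congr Tract.
- by rewrite subr0.
- apply: boolp.funext => b.
  rewrite lowB 2!lowD (lowD (fun c => _ * ts U)).
  rewrite !lowZr !low_raise (cov1_low (w := -1)); last by ring.
  rewrite dot_low QE.
  have -> : low (fun c => (a == c)%:R) b = h a b.
    by rewrite h_sym -[RHS](sum_delta a (h b)); apply: eq_bigr => c _; rewrite mulrC.
  have -> : low (fun b => \sum_(c < n) (\sum_(e < n) H b e * A a c e) * tm U c) b =
      \sum_(c < n) A a b c * tm U c.
    transitivity (\sum_(c < n) low (fun f => \sum_(e < n) H f e * A a c e) b * tm U c).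
      rewrite /low; under eq_bigr do rewrite mulr_sumr.
      rewrite exchange_big; apply: eq_bigr => c _; rewrite mulr_suml.
      by apply: eq_bigr => f _; rewrite mulrA.
    by apply: eq_bigr => c _; rewrite low_raise A_sym23.
  ring.
- rewrite dot_low; under [in RHS]eq_bigr do rewrite SE mulrDl.
  rewrite big_split /=; ring.
Qed.

(** The invertible map [low] conjugates [uconn] to [conn], whose commutators are tensorial. The
    sections [(1, 0, 0)] and [(0, m, 0)] then isolate the four coefficients. *)
Theorem uconn_flatP :
  (forall U a b, [/\ ts (uconn a (uconn b U)) = ts (uconn b (uconn a U)),
     forall c, tm (uconn a (uconn b U)) c = tm (uconn b (uconn a U)) c &
     tp (uconn a (uconn b U)) = tp (uconn b (uconn a U))])
  <-> [/\ forall a b c, curvX a b c = 0, forall a b c e, curvY a b c e = 0,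
      forall a b, curvN a b = 0 & forall a b c, curvZ a b c = 0].
Proof.
have lowuu U a b : lowt (uconn a (uconn b U)) = conn a (conn b (lowt U)).
  by rewrite !lowt_uconn.
split=> [flat | [X0 Y0 N0 Z0] U a b].
  have cflat U a b : conn a (conn b U) = conn b (conn a U).
    pose U' := Tract (ts U) (fun c => \sum_(e < n) H c e * tm U e) (tp U).
    have -> : U = lowt U'.
      by case: U @U' => s m f /=; congr Tract; apply: boolp.funext => b'; rewrite low_raise.
    have [fs fm fp] := flat U' a b.
    by rewrite -!lowuu /lowt fs fp; congr Tract; congr low; apply: boolp.funext.
  have XY a b c U : curvX a b c * ts U + dot (curvY a b c) (tm U) = 0.
    by rewrite -conn_tm cflat subrr.
  have NZ a b U : curvN a b * ts U + dot (curvZ a b) (tm U) = 0.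
    by rewrite -conn_tp cflat subrr.
  split=> [a b c|a b c|a b|a b].
  - by have := XY a b c (Tract 1 (fun=> 0) 0); rewrite /= dot0r // mulr1 addr0.
  - apply: (dot_nondeg H_sym hH) => m.
    by have := XY a b c (Tract 0 m 0); rewrite /= mulr0 add0r.
  - by have := NZ a b (Tract 1 (fun=> 0) 0); rewrite /= dot0r // mulr1 addr0.
  - apply: (dot_nondeg H_sym hH) => m.
    by have := NZ a b (Tract 0 m 0); rewrite /= mulr0 add0r.
have cflat W a' b' : conn a' (conn b' W) = conn b' (conn a' W).
  have fs := conn_ts a' b' W.
  have fm c : tm (conn a' (conn b' W)) c = tm (conn b' (conn a' W)) c.
    apply/eqP; rewrite -subr_eq0 conn_tm X0 mul0r add0r.
    by rewrite (eq_dot _ (Y0 a' b' c) (fun=> erefl)) dot0l.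
  have fp : tp (conn a' (conn b' W)) = tp (conn b' (conn a' W)).
    apply/eqP; rewrite -subr_eq0 conn_tp N0 mul0r add0r.
    by rewrite (eq_dot _ (Z0 a' b') (fun=> erefl)) dot0l.
  case: (conn a' (conn b' W)) (conn b' (conn a' W)) fs fm fp => [s m f] [s' m' f'] /=.
  by move=> -> fm ->; congr Tract; apply: boolp.funext.
have e := cflat (lowt U) a b; rewrite -!lowuu in e.
split=> [|c|]; [exact: (congr1 ts e)| |exact: (congr1 tp e)].
by rewrite -[LHS]raise_low -[RHS]raise_low (congr1 tm e : low _ = low _).
Qed.
End WeylCalculus.

(** * The Levi-Civita connection of a conformal scale *)

Section LeviCivita.
Variables (K : comUnitRingType) (n : nat) (d : 'I_n -> K -> K).
Hypothesis dD : forall a x y, d a (x + y) = d a x + d a y.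
Hypothesis dM : forall a x y, d a (x * y) = d a x * y + x * d a y.
Hypothesis dC : forall a b x, d a (d b x) = d b (d a x).
Hypothesis nat_unit : forall m, (m.+1%:R : K) \is a GRing.unit.
Variables (h H : 'I_n -> 'I_n -> K) (kap : K).
Hypothesis h_sym : forall a b, h a b = h b a.
Hypothesis H_sym : forall a b, H a b = H b a.
Hypothesis hH : forall a b, \sum_(c < n) h a c * H c b = (a == b)%:R.
Hypothesis kap_unit : kap \is a GRing.unit.

Definition lc_theta a := d a kap / kap.
Definition lc_metric a b := (kap ^+ 2)^-1 * h a b.
Definition lc_gamma c a b := 2^-1 * \sum_(e < n) (kap ^+ 2 * H c e) *
  (d a (lc_metric b e) + d b (lc_metric a e) - d e (lc_metric a b)).

Lemma lc_metric_sym a b : lc_metric a b = lc_metric b a.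
Proof. by rewrite /lc_metric h_sym. Qed.

Lemma lc_gamma_sym c a b : lc_gamma c a b = lc_gamma c b a.
Proof.
by congr (_ * _); apply: eq_bigr => e _; rewrite (lc_metric_sym a b); ring.
Qed.

Lemma d_inv a x : x \is a GRing.unit -> d a x^-1 = - (x^-1 * x^-1 * d a x).
Proof.
move=> Ux; apply: (mulrI Ux).
have e1 : d a (x * x^-1) = 0 by rewrite divrr // (d_1 dM).
have e2 : x * x^-1 = 1 by rewrite divrr.
rewrite dM in e1.
by apply: (lc2 (c := 1) (c' := x^-1 * d a x) e1 e2); ring.
Qed.

Lemma lc_theta_closed a b : d a (lc_theta b) = d b (lc_theta a).
Proof. by rewrite /lc_theta !dM !d_inv // dC; ring. Qed.

(** The Koszul formula. The factor [kap ^+ 2] appears because the index is lowered with [h] and not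
    with the metric of the scale. *)
Lemma lc_gamma_low a b c : 2 * \sum_(e < n) lc_gamma e a b * h e c =
  kap ^+ 2 * (d a (lc_metric b c) + d b (lc_metric a c) - d c (lc_metric a b)).
Proof.
have hE : 2 * 2^-1 = 1 :> K by apply: divrr; apply: (nat_unit 1).
rewrite -(sum_delta c (fun e => d a (lc_metric b e) + d b (lc_metric a e) - d e (lc_metric a b))).
rewrite !mulr_sumr.
under [RHS]eq_bigr => e _ do rewrite -hH mulr_suml mulr_sumr.
rewrite exchange_big; apply: eq_bigr => f _ /=.
rewrite /lc_gamma mulrA mulrA hE mul1r mulr_suml; apply: eq_bigr => e _.
by rewrite (h_sym f c); ring.
Qed.

(** Two Koszul formulas add up to the derivative of [lc_metric]; the term with [lc_theta] comes from
    differentiating the factor between [lc_metric] and [h]. *)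
Lemma lc_nabla_h a b c : d a (h b c) = 2 * lc_theta a * h b c
  + \sum_(e < n) lc_gamma e a b * h e c + \sum_(e < n) lc_gamma e a c * h b e.
Proof.
apply: (mulrI (nat_unit 1)); rewrite !mulrDr lc_gamma_low.
under [X in _ + 2 * X]eq_bigr do rewrite (h_sym b).
rewrite lc_gamma_low (lc_metric_sym c b).
have U2 : kap ^+ 2 \is a GRing.unit by rewrite unitrX.
have dm : kap ^+ 2 * d a (lc_metric b c) = d a (h b c) - 2 * lc_theta a * h b c.
  rewrite /lc_metric dM d_inv // expr2 dM /lc_theta invrM //.
  have e : kap * kap^-1 = 1 by rewrite divrr.
  (* With [x = kap * kap^-1], the difference involves [x^2 - 1] and [x^3 - 1]; the coefficient
     collects the cofactors [x + 1] and [x^2 + x + 1] of [x - 1]. *)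
  apply: (lc1 (c := d a (h b c) * (kap * kap^-1 + 1) - 2 * d a kap * h b c * kap^-1
    * (kap * kap * (kap^-1 * kap^-1) + kap * kap^-1 + 1)) e); ring.
rewrite mulrBr !mulrDr dm; ring.
Qed.
End LeviCivita.

Local Open Scope classical_set_scope.
Local Open Scope ring_scope.

(** * Smooth functions on an open set *)

(** Allows a function to be replaced by a formula valid only on an open set, which is all that is
    known of components in a chart. *)
Lemma near_eq_differentiable (R : numFieldType) (V W : normedModType R)
    (f g : V -> W) (x : V) :
  (\near x, f x = g x) -> differentiable f x -> differentiable g x.
Proof.
move=> fg df; have fgx : f x = g x := nbhs_singleton fg.
have dgE : g \o shift x = cst (g x) + 'd f x +o_ 0 id.
  have /diff_locallyP[_ /eqaddoP dfE] := df.
  apply/eqaddoP => e e0; have := dfE e e0.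
  have : \forall h \near 0, f (h + x) = g (h + x).
    by move: fg; rewrite (near_shift 0) subr0.
  apply: filter_app2; near=> h => fgh.
  by rewrite !fctE /= fgx fgh.
have dE : 'd g x = 'd f x :> (V -> W).
  by apply: diff_unique => //; apply: diff_continuous.
apply/diff_locallyP; rewrite dE; split=> //; exact: diff_continuous.
Unshelve. all: by end_near. Qed.

Section SmoothFunctions.
Variables (R : realType) (n : nat) (D : set 'rV[R]_n).
Hypothesis oD : open D.
Implicit Types (f g : 'rV[R]_n -> R) (x : 'rV[R]_n).

Lemma near_D f g x : D x -> (forall y, D y -> f y = g y) -> \near x, f x = g x.
Proof.
move=> Dx fg; have : nbhs x D by apply: open_nbhs_nbhs.
by apply: filterS => y; apply: fg.
Qed.

Lemma eq_pd f g a x : D x -> (forall y, D y -> f y = g y) -> pd a f x = pd a g x.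
Proof. by move=> Dx fg; apply: near_eq_derive; apply: near_D. Qed.

(** [smooth_on] offers no order to induct on. Counting derivatives reduces closure under each
    operation to lower order, through the formula for its first derivative. *)
Fixpoint Ck k f : Prop := (forall x, D x -> differentiable f x) /\
  if k is k'.+1 then forall a, Ck k' (pd a f) else True.

Lemma smoothP f : smooth_on D f <-> forall k, Ck k f.
Proof.
split=> [sf k|]; last first.
  (* [foldr] takes the derivative of the last index first, hence the induction from the end of the
     list. *)
  move=> Cf s; elim/last_ind: s f Cf => [|s a IH] f Cf x Dx.
    by have [+ _] := Cf 0%N; apply.
  rewrite foldr_rcons; apply: IH => // k.
  by have [_ +] := Cf k.+1; apply.
elim: k f sf => [|k IH] f sf; split=> //; try exact: (sf [::]).
move=> a; apply: IH => s x Dx; rewrite -foldr_rcons; exact: sf.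
Qed.

Lemma eq_Ck k f g : (forall x, D x -> f x = g x) -> Ck k f -> Ck k g.
Proof.
elim: k f g => [|k IH] f g fg [df pf]; split=> //;
  try by move=> x Dx; apply: near_eq_differentiable (df x Dx); apply: near_D.
by move=> a; apply: IH (pf a) => x Dx; apply: eq_pd.
Qed.

Lemma CkW k f : Ck k.+1 f -> Ck k f.
Proof.
elim: k f => [|k IH] f [df pf]; first by split.
by split=> // a; apply: IH; apply: pf.
Qed.

Lemma pdD f g a x : differentiable f x -> differentiable g x ->
  pd a (fun y => f y + g y) x = pd a f x + pd a g x.
Proof. by move=> df dg; apply: deriveD; apply: diff_derivable. Qed.

Lemma pdN f a x : differentiable f x -> pd a (fun y => - f y) x = - pd a f x.
Proof. by move=> df; apply: deriveN; apply: diff_derivable. Qed.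

Lemma pdM f g a x : differentiable f x -> differentiable g x ->
  pd a (fun y => f y * g y) x = pd a f x * g x + f x * pd a g x.
Proof.
move=> df dg; rewrite /pd deriveM; [|exact: diff_derivable..].
by rewrite addrC [in RHS]mulrC.
Qed.

Lemma pdV f a x : differentiable f x -> f x != 0 ->
  pd a (fun y => (f y)^-1) x = - (pd a f x * (f x)^-1 * (f x)^-1).
Proof.
move=> df f0; rewrite /pd deriveV //; last exact: diff_derivable.
by rewrite -[LHS]/(_ * _) expr2 invfM mulNr mulrC mulrA.
Qed.

Lemma pd_cst (c : R) a x : pd a (fun=> c) x = 0.
Proof. exact: derive_cst. Qed.

Lemma pd_ln f a x : differentiable f x -> 0 < f x ->
  pd a (fun y => ln (f y)) x = pd a f x / f x.
Proof.
move=> df f0; have dln := is_derive1_ln f0.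
have dl' : derivable (@ln R) (f x) 1 by [].
have /derivable1_diffP dl := dl'.
rewrite /pd deriveE; last exact: differentiable_comp.
rewrite (diff_comp df dl) /= (deriv1E dl') derive1E derive_val.
by rewrite -deriveE.
Qed.

Lemma CkD k f g : Ck k f -> Ck k g -> Ck k (fun x => f x + g x).
Proof.
have dD (p q : 'rV[R]_n -> R) : (forall x, D x -> differentiable p x) ->
    (forall x, D x -> differentiable q x) ->
    forall x, D x -> differentiable (fun y => p y + q y) x.
  by move=> dp dq x Dx; apply: differentiableD; [apply: dp|apply: dq].
elim: k f g => [|k IH] f g [df pf] [dg pg]; split=> //; try exact: dD.
move=> a; apply: eq_Ck (IH _ _ (pf a) (pg a)) => x Dx.
by rewrite pdD //; [apply: df|apply: dg].
Qed.

Lemma CkN k f : Ck k f -> Ck k (fun x => - f x).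
Proof.
have dN (p : 'rV[R]_n -> R) : (forall x, D x -> differentiable p x) ->
    forall x, D x -> differentiable (fun y => - p y) x.
  by move=> dp x Dx; apply: differentiableN; apply: dp.
elim: k f => [|k IH] f [df pf]; split=> //; try exact: dN.
move=> a; apply: eq_Ck (IH _ (pf a)) => x Dx.
by rewrite pdN //; apply: df.
Qed.

Lemma CkM k f g : Ck k f -> Ck k g -> Ck k (fun x => f x * g x).
Proof.
have dM (p q : 'rV[R]_n -> R) : (forall x, D x -> differentiable p x) ->
    (forall x, D x -> differentiable q x) ->
    forall x, D x -> differentiable (fun y => p y * q y) x.
  by move=> dp dq x Dx; apply: differentiableM; [apply: dp|apply: dq].
elim: k f g => [|k IH] f g Cf Cg.
  by split=> //; apply: dM; [case: Cf|case: Cg].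
have [[df pf] [dg pg]] := (Cf, Cg); split; first exact: dM.
move=> a; apply: eq_Ck (CkD (IH _ _ (pf a) (CkW Cg)) (IH _ _ (CkW Cf) (pg a))).
by move=> x Dx; rewrite pdM //; [apply: df|apply: dg].
Qed.

(** The derivative of [1/f] contains [1/f] again, but only one order lower is needed there. *)
Lemma CkV k f : (forall x, D x -> f x != 0) -> Ck k f -> Ck k (fun x => (f x)^-1).
Proof.
move=> f0.
have dV : (forall x, D x -> differentiable f x) ->
    forall x, D x -> differentiable (fun y => (f y)^-1) x.
  by move=> df x Dx; apply: differentiableV; [apply: df|apply: f0].
elim: k => [|k IH] Cf; first by split=> //; apply: dV; case: Cf.
have [df pf] := Cf; split; first exact: dV.
have CV := IH (CkW Cf).
move=> a; apply: eq_Ck (CkN (CkM (CkM (pf a) CV) CV)) => x Dx.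
by rewrite pdV //; [apply: df|apply: f0].
Qed.

Lemma Ck_cst k (c : R) : Ck k (fun=> c).
Proof.
elim: k c => [|k IH] c; split=> //; try by move=> x _; apply: differentiable_cst.
by move=> a; apply: eq_Ck (IH 0) => x _; rewrite pd_cst.
Qed.

Lemma eq_smooth f g : (forall x, D x -> f x = g x) -> smooth_on D f -> smooth_on D g.
Proof. by move=> fg /smoothP sf; apply/smoothP => k; apply: eq_Ck (sf k). Qed.

Lemma smoothD f g : smooth_on D f -> smooth_on D g ->
  smooth_on D (fun x => f x + g x).
Proof. by move=> /smoothP sf /smoothP sg; apply/smoothP => k; apply: CkD. Qed.

Lemma smoothN f : smooth_on D f -> smooth_on D (fun x => - f x).
Proof. by move=> /smoothP sf; apply/smoothP => k; apply: CkN. Qed.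

Lemma smoothM f g : smooth_on D f -> smooth_on D g ->
  smooth_on D (fun x => f x * g x).
Proof. by move=> /smoothP sf /smoothP sg; apply/smoothP => k; apply: CkM. Qed.

Lemma smoothV f : (forall x, D x -> f x != 0) -> smooth_on D f ->
  smooth_on D (fun x => (f x)^-1).
Proof. by move=> f0 /smoothP sf; apply/smoothP => k; apply: CkV. Qed.

Lemma smooth_cst (c : R) : smooth_on D (fun=> c).
Proof. by apply/smoothP => k; apply: Ck_cst. Qed.

Lemma smooth_pd f a : smooth_on D f -> smooth_on D (pd a f).
Proof. by move=> sf s x Dx; rewrite -foldr_rcons; apply: sf. Qed.

Lemma smooth_diff f x : smooth_on D f -> D x -> differentiable f x.
Proof. by move=> sf Dx; apply: (sf [::]). Qed.

End SmoothFunctions.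

(** * Symmetry of second derivatives *)

Section Schwarz.
Variables (R : realType) (V : normedModType R).
Implicit Types (f : V -> R) (u v x y : V).

Lemma is_derive_line f y v (s : R) : differentiable f (s *: v + y) ->
  is_derive s 1 (fun t : R => f (t *: v + y)) ('D_v f (s *: v + y)).
Proof.
move=> df; have E : (fun h : R => h^-1 *: (f ((h *: 1 + s) *: v + y) - f (s *: v + y)))
    = (fun h : R => h^-1 *: (f (h *: v + (s *: v + y)) - f (s *: v + y))).
  by apply/funext => h; rewrite scalerDl addrA /GRing.scale /= mulr1.
have dv : derivable f (s *: v + y) v by apply: diff_derivable.
apply: DeriveDef; first by move: dv; rewrite /derivable /= E.
by rewrite /derive /= E.
Qed.

Lemma MVT_line f y v (h : R) : 0 < h ->
  (forall s, 0 <= s <= h -> differentiable f (s *: v + y)) ->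
  exists2 s, 0 <= s <= h & f (h *: v + y) - f y = h * 'D_v f (s *: v + y).
Proof.
move=> h0 df.
have [|| s] := @MVT R (fun t => f (t *: v + y)) (fun s => 'D_v f (s *: v + y)) 0 h h0.
- move=> s; rewrite in_itv /= => /andP[s0 sh].
  by apply: is_derive_line; apply: df; rewrite !ltW.
- apply: derivable_within_continuous => s; rewrite in_itv /= => sh.
  by have [] := is_derive_line (df s sh).
rewrite in_itv /= scale0r add0r subr0 mulrC => /andP[s0 sh] ->.
by exists s => //; rewrite !ltW.
Qed.

(** The mean value theorem is applied along [u] to [f (h *: v + y) - f y], then along [v] to
    ['D_u f]. The bound on [h] keeps the whole parallelogram inside the ball. *)
Lemma second_difference f x u v (h r : R) : 0 < h -> h * (`|u| + `|v|) < r ->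
  (forall y, `|x - y| < r -> differentiable f y /\ differentiable ('D_u f) y) ->
  exists2 y, `|x - y| < r &
    f (h *: u + (h *: v + x)) - f (h *: v + x) - (f (h *: u + x) - f x) =
    h * (h * 'D_v ('D_u f) y).
Proof.
move=> h0 hr df.
have ball (s t : R) : 0 <= s <= h -> 0 <= t <= h -> `|x - (s *: u + (t *: v + x))| < r.
  move=> /andP[s0 sh] /andP[t0 th]; apply: le_lt_trans hr.
  rewrite addrA [_ + x]addrC opprD addNKr normrN mulrDr.
  apply: le_trans (ler_normD _ _) _; rewrite !normrZ.
  by apply: lerD; apply: ler_wpM2r => //; rewrite ger0_norm.
have hh : 0 <= h <= h by rewrite lexx ltW.
have h00 : 0 <= (0 : R) <= h by rewrite lexx ltW.
have bu s : 0 <= s <= h -> `|x - (s *: u + x)| < r.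
  by move=> /ball/(_ h00); rewrite scale0r add0r.
have dsh y : differentiable (fun z => h *: v + z) y.
  by apply: (@differentiableD _ _ _ (cst (h *: v)) id).
pose g y := f (h *: v + y) - f y.
have dg y : differentiable f (h *: v + y) -> differentiable f y -> differentiable g y.
  move=> d1 d2; apply: differentiableB => //.
  exact: differentiable_comp (dsh y) d1.
have Dg y : differentiable f (h *: v + y) -> differentiable f y ->
    'D_u g y = 'D_u f (h *: v + y) - 'D_u f y.
  move=> d1 d2; have d3 : derivable (fun y => f (h *: v + y)) y u.
    by apply: diff_derivable; exact: differentiable_comp (dsh y) d1.
  have d4 : derivable f y u by apply: diff_derivable.
  have E : (fun t : R => t^-1 *: (f (h *: v + (t *: u + y)) - f (h *: v + y))) =
      (fun t : R => t^-1 *: (f (t *: u + (h *: v + y)) - f (h *: v + y))).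
    by apply/funext => t; rewrite addrCA.
  by rewrite (deriveB d3 d4) /derive /= E.
have dfu s : 0 <= s <= h -> differentiable f (s *: u + x) by move=> /bu/df[].
have dfuv s : 0 <= s <= h -> differentiable f (h *: v + (s *: u + x)).
  by move=> /ball/(_ hh)/df[]; rewrite addrCA.
have [s sh e1] : exists2 s, 0 <= s <= h & g (h *: u + x) - g x = h * 'D_u g (s *: u + x).
  apply: MVT_line => // s sh; apply: dg; [exact: dfuv|exact: dfu].
have [t th e2] : exists2 t, 0 <= t <= h &
    'D_u f (h *: v + (s *: u + x)) - 'D_u f (s *: u + x) =
    h * 'D_v ('D_u f) (t *: v + (s *: u + x)).
  apply: (@MVT_line ('D_u f)) => [//|t th]; rewrite addrCA.
  exact: (df _ (ball _ _ sh th)).2.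
exists (t *: v + (s *: u + x)); first by rewrite addrCA; apply: ball.
rewrite -e2 -(Dg _ (dfuv _ sh) (dfu _ sh)) -e1 /g [h *: u + (h *: v + x)]addrCA; ring.
Qed.

(** The second difference is symmetric in [u] and [v], so the two mixed derivatives agree at some
    points [y] and [z] close to [x]; continuity carries this to [x]. *)
Theorem schwarz f x u v :
  (\near x, differentiable f x) -> (\near x, differentiable ('D_u f) x) ->
  (\near x, differentiable ('D_v f) x) ->
  {for x, continuous ('D_v ('D_u f))} -> {for x, continuous ('D_u ('D_v f))} ->
  'D_v ('D_u f) x = 'D_u ('D_v f) x.
Proof.
move=> df du dv cuv cvu.
set a := 'D_v ('D_u f) x; set b := 'D_u ('D_v f) x.
apply/eqP; rewrite -subr_eq0 -normr_le0; apply/ler_addgt0Pl => e e0; rewrite addr0.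
have e2 : 0 < e / 2 by lra.
have : nbhs x [set y | [/\ differentiable f y, differentiable ('D_u f) y,
    differentiable ('D_v f) y, `|a - 'D_v ('D_u f) y| < e / 2 &
    `|b - 'D_u ('D_v f) y| < e / 2]].
  have F : Filter (nbhs x) by exact: nbhs_filter.
  have Pu : nbhs x [set y | `|a - 'D_v ('D_u f) y| < e / 2].
    by move/cvgrPdist_lt: cuv; apply.
  have Pv : nbhs x [set y | `|b - 'D_u ('D_v f) y| < e / 2].
    by move/cvgrPdist_lt: cvu; apply.
  have := filterI df (filterI du (filterI dv (filterI Pu Pv))).
  move=> /(_ F F F F); apply: (@filterS _ _ F) => y [h1 [h2 [h3 [h4 h5]]]].
  exact (And5 h1 h2 h3 h4 h5).
move/nbhs_normP => [r r0 rP].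
have [h h0 hr] : exists2 h : R, 0 < h & h * (`|u| + `|v|) < r.
  have N0 : 0 <= `|u| + `|v| by rewrite addr_ge0.
  exists (r / (`|u| + `|v| + 1)); first by rewrite divr_gt0 // ltr_wpDl.
  by rewrite mulrAC ltr_pdivrMr ?ltr_wpDl // ltr_pM2l // ltrDl.
have [|y yr e3] := @second_difference f x u v h r h0 hr.
  move=> y /rP[d1 d2 _ _ _]; exact (conj d1 d2).
have hr' : h * (`|v| + `|u|) < r by rewrite addrC.
have [|z zr e4] := @second_difference f x v u h r h0 hr'.
  move=> z /rP[d1 _ d3 _ _]; exact (conj d1 d3).
have [_ _ _ ya _] := rP y yr; have [_ _ _ _ zb] := rP z zr.
move: e3 e4 ya zb; set p := 'D_v ('D_u f) y; set q := 'D_u ('D_v f) z => e3 e4 ya zb.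
have hn : h != 0 by rewrite gt_eqF.
have pq : p = q.
  apply: (mulfI hn); apply: (mulfI hn).
  by rewrite -[LHS]e3 -[RHS]e4 [h *: u + (h *: v + x)]addrCA; ring.
rewrite (_ : a - b = (a - p) - (b - q)); last by rewrite pq; ring.
apply: le_trans (ler_normB _ _) _; rewrite [e]splitr.
exact (lerD (ltW ya) (ltW zb)).
Qed.

End Schwarz.

Lemma pd_comm (R : realType) (n : nat) (D : set 'rV[R]_n) f a b x :
  open D -> smooth_on D f -> D x -> pd a (pd b f) x = pd b (pd a f) x.
Proof.
move=> oD sf Dx; have nD : nbhs x D by apply: open_nbhs_nbhs.
apply: schwarz.
- by apply: filterS nD => y; apply: smooth_diff.
- by apply: filterS nD => y; apply: smooth_diff; apply: smooth_pd.
- by apply: filterS nD => y; apply: smooth_diff; apply: smooth_pd.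
- apply: differentiable_continuous; apply: (smooth_diff (D := D)) => //.
  by do 2!apply: smooth_pd.
- apply: differentiable_continuous; apply: (smooth_diff (D := D)) => //.
  by do 2!apply: smooth_pd.
Qed.

(** The marked point ensures [1 != 0] in the ring of functions below, as its ring structure
    demands. *)
Record domain (R : realType) (n : nat) := Domain {
  dset :> set 'rV[R]_n;
  dset_open : open dset;
  dpoint : 'rV[R]_n;
  dpointP : dset dpoint
}.

(* Functions are cut off outside the domain, so that Leibniz equality is
   equality on the domain. *)
Record sfun (R : realType) (n : nat) (D : domain R n) := SFun {
  sval :> 'rV[R]_n -> R;
  sval_smooth : smooth_on D sval;
  sval_out : forall x, ~ dset D x -> sval x = 0
}.

(** * The ring of smooth functions on a domain *)

Section SmoothRing.
Variables (R : realType) (n : nat) (D : domain R n).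
Let oD : open D := @dset_open _ _ D.
Local Notation S := (sfun D).
Implicit Types (F G : S) (f g : 'rV[R]_n -> R).

Lemma sfunP F G : (forall x, dset D x -> F x = G x) -> F = G.
Proof.
move=> FG; have fg : sval F = sval G.
  apply/funext => x; have [/FG //|nDx] := pselect (dset D x).
  by rewrite !sval_out.
case: F G fg {FG} => [f sf of_] [g sg og] /= fg; subst g.
by congr SFun; apply: Prop_irrelevance.
Qed.

Definition cut f x : R := if pselect (dset D x) then f x else 0.

Lemma cutE f x : dset D x -> cut f x = f x.
Proof. by rewrite /cut; case: pselect. Qed.

Lemma cut_smooth f : smooth_on D f -> smooth_on D (cut f).
Proof. by move=> sf; apply: (eq_smooth oD _ sf) => x Dx; rewrite cutE. Qed.

Lemma cut_out f x : ~ dset D x -> cut f x = 0.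
Proof. by rewrite /cut; case: pselect. Qed.

Definition mk f (sf : smooth_on D f) : S := SFun (cut_smooth sf) (@cut_out f).

Lemma mkE f (sf : smooth_on D f) x : dset D x -> mk sf x = f x.
Proof. exact: cutE. Qed.

HB.instance Definition _ := gen_eqMixin S.
HB.instance Definition _ := gen_choiceMixin S.

Definition sadd F G := mk (smoothD oD (sval_smooth F) (sval_smooth G)).
Definition sopp F := mk (smoothN oD (sval_smooth F)).
Definition smul F G := mk (smoothM oD (sval_smooth F) (sval_smooth G)).
Definition scst c := mk (smooth_cst oD c).

Definition sunit F : bool := `[< forall x, dset D x -> F x != 0 >].

(** Functions with a zero in the domain are returned unchanged, the value that the unit ring
    interface prescribes off the units. *)
Definition sinv F : S :=
  if pselect (forall x, dset D x -> F x != 0) is left F0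
  then mk (smoothV oD F0 (sval_smooth F)) else F.

Definition sder a F := mk (smooth_pd a (sval_smooth F)).

Fact saddA : associative sadd.
Proof. by move=> F G E; apply: sfunP => x Dx; rewrite !mkE // addrA. Qed.
Fact saddC : commutative sadd.
Proof. by move=> F G; apply: sfunP => x Dx; rewrite !mkE // addrC. Qed.
Fact sadd0 : left_id (scst 0) sadd.
Proof. by move=> F; apply: sfunP => x Dx; rewrite !mkE // add0r. Qed.
Fact saddN : left_inverse (scst 0) sopp sadd.
Proof. by move=> F; apply: sfunP => x Dx; rewrite !mkE // addNr. Qed.
HB.instance Definition _ := GRing.isZmodule.Build S saddA saddC sadd0 saddN.

Fact smulA : associative smul.
Proof. by move=> F G E; apply: sfunP => x Dx; rewrite !mkE // mulrA. Qed.
Fact smulC : commutative smul.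
Proof. by move=> F G; apply: sfunP => x Dx; rewrite !mkE // mulrC. Qed.
Fact smul1 : left_id (scst 1) smul.
Proof. by move=> F; apply: sfunP => x Dx; rewrite !mkE // mul1r. Qed.
Fact smulD : left_distributive smul +%R.
Proof. by move=> F G E; apply: sfunP => x Dx; rewrite !mkE // mulrDl. Qed.
Fact s1_neq0 : scst 1 != 0.
Proof.
apply/eqP => /(congr1 (fun F : S => F (dpoint D))); rewrite !mkE //; try exact: dpointP.
by move/eqP; rewrite oner_eq0.
Qed.
HB.instance Definition _ :=
  GRing.Zmodule_isComNzRing.Build S smulA smulC smul1 smulD s1_neq0.

Fact smulV : {in sunit, left_inverse 1 sinv *%R}.
Proof.
move=> F /asboolP F0; apply: sfunP => x Dx; rewrite mkE // /sinv.
by case: pselect => // F0'; rewrite !mkE // mulVf // F0.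
Qed.
Fact sunitP F G : G * F = 1 -> sunit F.
Proof.
move=> GF; apply/asboolP => x Dx; apply/eqP => F0.
move/(congr1 (fun F : S => F x)): GF; rewrite !mkE // F0 mulr0.
by move/esym/eqP; rewrite oner_eq0.
Qed.
Fact sinv_out : {in [predC sunit], sinv =1 id}.
Proof. by move=> F; rewrite inE /sinv; case: pselect => // F0 /asboolP. Qed.
HB.instance Definition _ :=
  GRing.ComNzRing_hasMulInverse.Build S smulV sunitP sinv_out.

Lemma s0E x : dset D x -> (0 : S) x = 0. Proof. exact: mkE. Qed.
Lemma s1E x : dset D x -> (1 : S) x = 1. Proof. exact: mkE. Qed.
Lemma sDE F G x : dset D x -> (F + G) x = F x + G x. Proof. exact: mkE. Qed.
Lemma sNE F x : dset D x -> (- F) x = - F x. Proof. exact: mkE. Qed.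
Lemma sME F G x : dset D x -> (F * G) x = F x * G x. Proof. exact: mkE. Qed.
Lemma snatE m x : dset D x -> (m%:R : S) x = m%:R.
Proof.
move=> Dx; elim: m => [|m IH]; first by rewrite s0E.
by rewrite !mulrSr sDE // IH s1E.
Qed.
Lemma sVE F x : F \is a GRing.unit -> dset D x -> (F^-1) x = (F x)^-1.
Proof.
move=> UF Dx; have /asboolP/(_ x Dx) F0 := UF.
apply: (mulfI F0); rewrite divff // -sME // divrr // s1E //.
Qed.
Lemma sderE a F x : dset D x -> sder a F x = pd a F x. Proof. exact: mkE. Qed.

Lemma snat_unit m : (m.+1%:R : S) \is a GRing.unit.
Proof. by apply/asboolP => x Dx; rewrite snatE // pnatr_eq0. Qed.

Lemma sderD a F G : sder a (F + G) = sder a F + sder a G.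
Proof.
apply: sfunP => x Dx; rewrite sDE // !sderE //.
rewrite -(pdD a (smooth_diff (sval_smooth F) Dx) (smooth_diff (sval_smooth G) Dx)).
by apply: (eq_pd oD) => // y Dy; rewrite sDE.
Qed.

Lemma sderM a F G : sder a (F * G) = sder a F * G + F * sder a G.
Proof.
apply: sfunP => x Dx; rewrite sDE // !sME // !sderE //.
rewrite -(pdM a (smooth_diff (sval_smooth F) Dx) (smooth_diff (sval_smooth G) Dx)).
by apply: (eq_pd oD) => // y Dy; rewrite sME.
Qed.

Lemma sderC a b F : sder a (sder b F) = sder b (sder a F).
Proof.
apply: sfunP => x Dx.
have E p q : pd p (sder q F) x = pd p (pd q F) x.
  by apply: (eq_pd oD p Dx) => y Dy; exact: sderE.
have e1 := etrans (sderE a (sder b F) Dx) (E a b).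
have e2 := etrans (sderE b (sder a F) Dx) (E b a).
exact (etrans e1 (etrans (pd_comm a b oD (sval_smooth F) Dx) (esym e2))).
Qed.

(** The bridge between components and ring elements: [f] is arbitrary outside the domain, and
    partial derivatives respect the relation because the domain is open. *)
Definition rep f F := forall x, dset D x -> f x = F x.

Lemma rep_mk f (sf : smooth_on D f) : rep f (mk sf).
Proof. by move=> x Dx; rewrite mkE. Qed.

Lemma rep_pd a f F : rep f F -> rep (pd a f) (sder a F).
Proof. by move=> r x Dx; rewrite sderE //; apply: (eq_pd oD). Qed.

Lemma rep_nat m : rep (fun=> m%:R) m%:R.
Proof. by move=> x Dx; rewrite snatE. Qed.

Lemma repD f F g G : rep f F -> rep g G -> rep (fun x => f x + g x) (F + G).
Proof. by move=> rf rg x Dx; rewrite sDE // rf // rg. Qed.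

Lemma repN f F : rep f F -> rep (fun x => - f x) (- F).
Proof. by move=> rf x Dx; rewrite sNE // rf. Qed.

Lemma repB f F g G : rep f F -> rep g G -> rep (fun x => f x - g x) (F - G).
Proof. by move=> rf rg; apply: repD => //; apply: repN. Qed.

Lemma repM f F g G : rep f F -> rep g G -> rep (fun x => f x * g x) (F * G).
Proof. by move=> rf rg x Dx; rewrite sME // rf // rg. Qed.

Lemma repV f F : rep f F -> F \is a GRing.unit -> rep (fun x => (f x)^-1) (F^-1).
Proof. by move=> rf UF x Dx; rewrite sVE // rf. Qed.

Lemma rep_sum m (f : 'I_m -> 'rV[R]_n -> R) (F : 'I_m -> S) :
  (forall i, rep (f i) (F i)) ->
  rep (fun x => \sum_(i < m) f i x) (\sum_(i < m) F i).
Proof.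
move=> rf x Dx.
rewrite (big_morph (fun F : S => F x) (fun F G => sDE F G Dx) (s0E Dx)).
by apply: eq_bigr => i _; apply: rf.
Qed.

End SmoothRing.

(** * Tensor calculus in a chart *)

Section Transfer.
Variables (R : realType) (n : nat) (D : domain R n) (g : geom R n).
Variables (h H : 'I_n -> 'I_n -> sfun D) (th : 'I_n -> sfun D)
  (Gm : 'I_n -> 'I_n -> 'I_n -> sfun D).
Hypothesis rh : forall a b, rep (bh g a b) (h a b).
Hypothesis rH : forall a b, rep (fun x => bhinv g a b x) (H a b).
Hypothesis rth : forall a, rep (fun x => pd a (ks g) x / ks g x) (th a).
Hypothesis rG : forall e a b, rep (fun x => christoffel g e a b x) (Gm e a b).
Local Notation der := (@sder R n D).
Local Notation N0 := (cov0 der th).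
Local Notation N1 := (cov1 der th Gm).
Local Notation N2 := (cov2 der th Gm).
Local Notation N3 := (cov3 der th Gm).

Lemma rep0 : rep (fun=> 0) (0 : sfun D). Proof. exact: (@rep_nat R n D 0). Qed.
Lemma rep1 : rep (fun=> 1) (1 : sfun D). Proof. exact: (@rep_nat R n D 1). Qed.

Lemma rep_natV m : (0 < m)%N -> rep (fun=> m%:R^-1) (m%:R^-1 : sfun D).
Proof. by case: m => // m _; apply: repV (@rep_nat R n D m.+1) _; apply: snat_unit. Qed.

Lemma rep_bool (b : bool) : rep (fun=> b%:R) (b%:R : sfun D).
Proof. exact: (@rep_nat R n D b). Qed.

Lemma rep_nabla0 (w : R) W f F a : rep (fun=> w) W -> rep f F ->
  rep (fun x => nabla0 g w f a x) (N0 W F a).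
Proof.
move=> rw rf; apply: repB; first exact: rep_pd.
by apply: repM => //; apply: repM.
Qed.

Lemma rep_nabla1 (w : R) W T T' a b : rep (fun=> w) W ->
  (forall a, rep (T a) (T' a)) -> rep (fun x => nabla1 g w T a b x) (N1 W T' a b).
Proof.
move=> rw rT; apply: repB; first exact: rep_nabla0.
by apply: rep_sum => e; apply: repM.
Qed.

Lemma rep_nabla2 (w : R) W T T' a b c : rep (fun=> w) W ->
  (forall a b, rep (T a b) (T' a b)) ->
  rep (fun x => nabla2 g w T a b c x) (N2 W T' a b c).
Proof.
move=> rw rT; apply: repB; last by apply: rep_sum => e; apply: repM.
by apply: repB; [exact: rep_nabla0|apply: rep_sum => e; apply: repM].
Qed.

Lemma rep_nabla3 (w : R) W T T' a b c e : rep (fun=> w) W ->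
  (forall a b c, rep (T a b c) (T' a b c)) ->
  rep (fun x => nabla3 g w T a b c e x) (N3 W T' a b c e).
Proof.
move=> rw rT; apply: repB; last by apply: rep_sum => p; apply: repM.
apply: repB; last by apply: rep_sum => p; apply: repM.
by apply: repB; [exact: rep_nabla0|apply: rep_sum => p; apply: repM].
Qed.

Lemma rep_nablaV (w : R) W V V' a c : rep (fun=> w) W ->
  (forall a, rep (V a) (V' a)) ->
  rep (fun x => nablaV g w V a c x) (covV der th Gm W V' a c).
Proof.
move=> rw rV; apply: repD; first exact: rep_nabla0.
by apply: rep_sum => e; apply: repM.
Qed.

Lemma rep_tr2 (T : 'I_n -> 'I_n -> 'rV[R]_n -> R) (T' : 'I_n -> 'I_n -> sfun D) :
  (forall a b, rep (T a b) (T' a b)) ->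
  rep (fun x => tr2 g x (fun a b => T a b x)) (atr H T').
Proof. by move=> rT; do 2!(apply: rep_sum => ?); apply: repM. Qed.

Lemma rep_ip1 (u v : 'I_n -> 'rV[R]_n -> R) (u' v' : 'I_n -> sfun D) :
  (forall a, rep (u a) (u' a)) -> (forall a, rep (v a) (v' a)) ->
  rep (fun x => ip1 g x (fun a => u a x) (fun a => v a x)) (adot H u' v').
Proof.
by move=> ru rv; do 2!(apply: rep_sum => ?); apply: repM => //; apply: repM.
Qed.

Lemma rep_ip2 (T U : 'I_n -> 'I_n -> 'rV[R]_n -> R) (T' U' : 'I_n -> 'I_n -> sfun D) :
  (forall a b, rep (T a b) (T' a b)) -> (forall a b, rep (U a b) (U' a b)) ->
  rep (fun x => ip2 g x (fun a b => T a b x) (fun a b => U a b x)) (adot2 H T' U').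
Proof.
move=> rT rU; do 4!(apply: rep_sum => ?).
by apply: repM => //; apply: repM => //; apply: repM.
Qed.

Lemma rep_skew2 (T : 'I_n -> 'I_n -> 'rV[R]_n -> R) (T' : 'I_n -> 'I_n -> sfun D) a b :
  (forall a b, rep (T a b) (T' a b)) ->
  rep (fun x => skew2 (fun a b => T a b x) a b) (askew T' a b).
Proof. by move=> rT; apply: repM; [exact: (rep_natV (m := 2))|exact: repB]. Qed.

Lemma rep_riem a b c e : rep (fun x => riem g a b c e x) (ariem der th Gm a b c e).
Proof.
by apply: repB; apply: rep_nablaV; try exact: rep0;
  move=> p; apply: rep_nablaV; try exact: rep0; move=> q; apply: rep_bool.
Qed.

Lemma rep_riem_low a b c e :
  rep (fun x => riem_low g a b c e x) (arlow der h th Gm a b c e).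
Proof. by apply: rep_sum => p; apply: repM => //; apply: rep_riem. Qed.

Lemma rep_ric b e : rep (fun x => ric g b e x) (aric der th Gm b e).
Proof. by apply: rep_sum => p; apply: rep_riem. Qed.

Lemma rep_scal : rep (fun x => scal g x) (atr H (aric der th Gm)).
Proof. by apply: rep_tr2 => a b; apply: rep_ric. Qed.

Lemma rep_nB_V m : (m < n)%N -> rep (fun=> (n%:R - m%:R)^-1) ((n%:R - m%:R)^-1 : sfun D).
Proof.
move=> mn; apply: repV; first by apply: repB; apply: rep_nat.
by apply: nB_unit => // k; apply: snat_unit.
Qed.

Lemma rep_n1_V : (1 < n)%N -> rep (fun=> (n%:R - 1)^-1) ((n%:R - 1)^-1 : sfun D).
Proof. exact: (@rep_nB_V 1). Qed.

Lemma rep_2n1_V : (1 < n)%N ->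
  rep (fun=> (2 * (n%:R - 1))^-1) ((2 * (n%:R - 1))^-1 : sfun D).
Proof.
move=> n1; apply: repV.
  by apply: repM; [exact: rep_nat|apply: repB; [exact: rep_nat|exact: rep1]].
rewrite unitrM (@snat_unit R n D 1) /=.
by apply: (nB_unit (@snat_unit R n D)) n1.
Qed.

(** One shape serves the Schouten tensor, [PA] and the trace correction in [tf4]. *)
Lemma rep_schouten (r s : 'rV[R]_n -> R) (r' s' : sfun D) a b : (2 < n)%N ->
  rep r r' -> rep s s' ->
  rep (fun x => (n%:R - 2)^-1 * (r x - s x / (2 * (n%:R - 1)) * bh g a b x))
      ((n%:R - 2)^-1 * (r' - s' / (2 * (n%:R - 1)) * h a b)).
Proof.
move=> n2 rr rs; apply: repM; first exact: (@rep_nB_V 2).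
apply: repB => //; apply: repM => //; apply: repM => //.
by apply: rep_2n1_V; apply: ltn_trans n2.
Qed.

Section Cubic.
Variables (A : 'I_n -> 'I_n -> 'I_n -> 'rV[R]_n -> R)
  (A' : 'I_n -> 'I_n -> 'I_n -> sfun D).
Hypothesis rA : forall a b c, rep (A a b c) (A' a b c).

Lemma rep_delta a b : rep (delta g A a b) (adelta der H th Gm A' a b).
Proof.
by apply: rep_tr2 => p q; apply: rep_nabla3 => //; apply: rep_nat.
Qed.

Lemma rep_delta2 a : rep (delta2 g A a) (adelta2 der H th Gm A' a).
Proof.
by apply: rep_tr2 => p q; apply: rep_nabla2 => [|b c]; [exact: rep0|exact: rep_delta].
Qed.

Lemma rep_AA a b : rep (AA g A a b) (aAA H A' a b).
Proof. by apply: rep_ip2 => p q. Qed.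

Lemma rep_normsq : rep (normsq g A) (anormsq H A').
Proof. by apply: rep_tr2 => p q; apply: rep_AA. Qed.

Lemma rep_PA a b : (1 < n)%N -> rep (PA g A a b) (aPA h H A' a b).
Proof.
move=> n1; rewrite /PA /aPA.
have [n2|n2] := eqVneq n 2%N.
  by apply: repM => //; apply: repM; [exact: (rep_natV (m := 4))|exact: rep_normsq].
apply: rep_schouten; [by rewrite ltn_neqAle eq_sym n2|exact: rep_AA|exact: rep_normsq].
Qed.

End Cubic.

Lemma rep_kulkarni (Q : 'I_n -> 'I_n -> 'rV[R]_n -> R)
    (Q' : 'I_n -> 'I_n -> sfun D) a b c e :
  (forall a b, rep (Q a b) (Q' a b)) ->
  rep (fun x => kulkarni g x (fun a b => Q a b x) a b c e) (akulkarni h Q' a b c e).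
Proof.
move=> rQ; apply: repM; first exact: rep_nat.
by apply: repB; apply: rep_skew2 => p q; apply: repM.
Qed.

Lemma rep_tf4 (T : 'I_n -> 'I_n -> 'I_n -> 'I_n -> 'rV[R]_n -> R)
    (T' : 'I_n -> 'I_n -> 'I_n -> 'I_n -> sfun D) a b c e :
  (2 < n)%N -> (forall a b c e, rep (T a b c e) (T' a b c e)) ->
  rep (fun x => tf4 g x (fun a b c e => T a b c e x) a b c e) (atf4 h H T' a b c e).
Proof.
move=> n2 rT; apply: repB => //; apply: rep_kulkarni => p q.
apply: rep_schouten => //; first by apply: rep_tr2.
by apply: rep_tr2 => r s; apply: rep_tr2.
Qed.

Section Deformation.
Variables (P E G : 'I_n -> 'I_n -> 'rV[R]_n -> R)
  (A : 'I_n -> 'I_n -> 'I_n -> 'rV[R]_n -> R) (F : 'I_n -> 'rV[R]_n -> R).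
Variables (P' E' G' : 'I_n -> 'I_n -> sfun D)
  (A' : 'I_n -> 'I_n -> 'I_n -> sfun D) (F' : 'I_n -> sfun D).
Hypothesis rP : forall a b, rep (P a b) (P' a b).
Hypothesis rE : forall a b, rep (E a b) (E' a b).
Hypothesis rGG : forall a b, rep (G a b) (G' a b).
Hypothesis rA : forall a b c, rep (A a b c) (A' a b c).
Hypothesis rF : forall a, rep (F a) (F' a).

Lemma rep_cotton a b c : rep (fun x => cotton g P a b c x) (acotton der th Gm P' a b c).
Proof. by apply: rep_skew2 => p q; apply: rep_nabla2 => //; exact: rep0. Qed.

Lemma rep_weyl a b c e : rep (fun x => weyl g P a b c e x) (aweyl der h th Gm P' a b c e).
Proof. by apply: repB; [exact: rep_riem_low|exact: rep_kulkarni]. Qed.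

Lemma rep_gauss4 a b c m : (2 < n)%N ->
  rep (fun x => 2 * tf4 g x (fun a b c m =>
         skew2 (fun a b => ip1 g x (fun v => A v c a x) (fun v => A b m v x)) a b) a b c m
       + weyl g P a b c m x)
      (gauss4 der h H th Gm A' P' a b c m).
Proof.
move=> n2; apply: repD; last exact: rep_weyl.
apply: repM; first exact: rep_nat.
apply: (rep_tf4 (T := fun a b c m x => skew2 (fun a b => ip1 g x (fun v => A v c a x)
  (fun v => A b m v x)) a b)) => // p q r s.
by apply: (rep_skew2 (T := fun a b x => ip1 g x (fun v => A v r a x)
  (fun v => A b s v x))) => t u; apply: rep_ip1.
Qed.

Lemma rep_gauss3 a b c : (1 < n)%N ->
  rep (fun x => skew2 (fun a b => nabla2 g 0 (PA g A) a b c x) a b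
       + 3^-1 * skew2 (fun a b => ip1 g x (fun m => A m c a x)
                                         (fun m => delta g A b m x)) a b
       - cotton g P a b c x)
      (gauss3 der h H th Gm A' P' a b c).
Proof.
move=> n1; apply: repB; last exact: rep_cotton.
apply: repD.
  by apply: rep_skew2 => p q; apply: rep_nabla2 => [|r s]; [exact: rep0|exact: rep_PA].
apply: repM; first exact: (rep_natV (m := 3)).
apply: (rep_skew2 (T := fun a b x => ip1 g x (fun m => A m c a x)
   (fun m => delta g A b m x))) => p q.
by apply: rep_ip1 => // r; apply: rep_delta.
Qed.

Lemma rep_gauss2 a :
  rep (fun x => nabla0 g (-2) (normsq g A) a x
       + 2 * ip2 g x (fun m v => A a m v x) (fun m v => delta g A m v x)
       - 8 * tr2 g x (fun m v => cotton g P a m v x))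
      (gauss2 der H th Gm A' P' a).
Proof.
apply: repB.
  apply: repD.
    by apply: rep_nabla0; [apply: repN; exact: rep_nat|exact: rep_normsq].
  apply: repM; first exact: rep_nat.
  by apply: rep_ip2 => // p q; apply: rep_delta.
apply: repM; first exact: rep_nat.
by apply: rep_tr2 => p q; apply: rep_cotton.
Qed.

Lemma rep_codazzi3 a b c m : (0 < n)%N ->
  rep (fun x => skew2 (fun a b => nabla3 g 2 A a b c m x) a b
       - n%:R^-1 * (skew2 (fun a b => bh g m a x * delta g A b c x) a b
                    + skew2 (fun a b => bh g c a x * delta g A b m x) a b))
      (codazzi3 der h H th Gm A' a b c m).
Proof.
move=> n0; apply: repB.
  by apply: rep_skew2 => p q; apply: rep_nabla3 => //; exact: rep_nat.
apply: repM; first exact: rep_natV.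
by apply: repD; apply: rep_skew2 => p q; apply: repM => //; apply: rep_delta.
Qed.

Lemma rep_codazzi2 a b :
  rep (fun x => skew2 (fun a b => nabla1 g (-2) (delta2 g A) a b x) a b
       + 4 * skew2 (fun a b => ip1 g x (fun m => P m a x)
                                      (fun m => delta g A b m x)) a b
       - 2 * skew2 (fun a b => ip2 g x (fun c m => A c m a x)
                                      (fun c m => nabla2 g 0 P b c m x)) a b)
      (codazzi2 der H th Gm A' P' a b).
Proof.
apply: repB; first apply: repD.
- apply: rep_skew2 => p q; apply: rep_nabla1; first by apply: repN; exact: rep_nat.
  by move=> r; apply: rep_delta2.
- apply: repM; first exact: rep_nat.
  apply: (rep_skew2 (T := fun a b x => ip1 g x (fun m => P m a x)
    (fun m => delta g A b m x))) => p q.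
  by apply: rep_ip1 => // r; apply: rep_delta.
- apply: repM; first exact: rep_nat.
  apply: (rep_skew2 (T := fun a b x => ip2 g x (fun c m => A c m a x)
    (fun c m => nabla2 g 0 P b c m x))) => p q.
  by apply: rep_ip2 => // r s; apply: rep_nabla2 => //; exact: rep0.
Qed.

Definition rep_slots (s : slots R n) (S : aslots (sfun D) n) : Prop :=
  [/\ rep (sigma s) (ts S), forall a, rep (mu s a) (tm S a) & rep (phi s) (tp S)].

Lemma rep_bold_nabla a s S : rep_slots s S ->
  rep_slots (bold_nabla g P E G A F a s) (uconn der h H th Gm A' F' P' E' G' a S).
Proof.
move=> [rs rm rp]; split=> [|b|].
- apply: repB; last exact: rep0.
  apply: repB; first by apply: rep_nabla0 => //; exact: rep1.
  by apply: rep_sum => c; apply: repM.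
- apply: repB; last first.
    apply: repD; first by apply: repM => //; apply: rep_sum => c; apply: repM.
    by apply: rep_sum => c; apply: repM => //; apply: rep_sum => e; apply: repM.
  apply: repD; last by apply: repM => //; apply: rep_sum => c; apply: repM.
  apply: repD; last by apply: repM => //; apply: rep_bool.
  by apply: rep_nablaV => //; apply: repN; exact: rep1.
- apply: repB; last first.
    by apply: repD; [apply: repM|apply: rep_sum => c; apply: repM].
  apply: repB; last by apply: rep_sum => c; apply: repM.
  by apply: rep_nabla0 => //; apply: repN; exact: rep1.
Qed.

End Deformation.
End Transfer.

Lemma invmx_uniq (K : comUnitRingType) n (A B : 'M[K]_n) : A *m B = 1%:M -> invmx A = B.
Proof.
by move=> AB; have [UA _] := mulmx1_unit AB; rewrite -[LHS]mulmx1 -AB mulKmx.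
Qed.

Lemma rep_eqP (R : realType) n (D : domain R n) f g (F G : sfun D) :
  rep f F -> rep g G -> F = G <-> (forall x, dset D x -> f x = g x).
Proof.
move=> rf rg; split=> [FG x Dx | fg]; first by rewrite rf // rg // FG.
by apply: sfunP => x Dx; rewrite -rf // -rg // fg.
Qed.

Lemma rep_eq0P (R : realType) n (D : domain R n) f (F : sfun D) :
  rep f F -> F = 0 <-> (forall x, dset D x -> f x = 0).
Proof. move=> rf; exact: (rep_eqP rf (@rep_nat _ _ _ 0)). Qed.

Section Evaluation.
Variables (R : realType) (n : nat) (D : domain R n) (x : 'rV[R]_n).
Hypothesis Dx : dset D x.

(** The membership proof is an argument because evaluation is a ring morphism only at points of the
    domain: outside, [1] evaluates to 0. *)
Definition eval of dset D x := fun F : sfun D => F x.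

Fact eval_zmod : zmod_morphism (eval Dx).
Proof. by move=> F G; rewrite /eval sDE // sNE. Qed.
Fact eval_monoid : monoid_morphism (eval Dx).
Proof. by split; [exact: s1E|move=> F G; exact: sME]. Qed.
HB.instance Definition _ := GRing.isZmodMorphism.Build _ _ (eval Dx) eval_zmod.
HB.instance Definition _ := GRing.isMonoidMorphism.Build _ _ (eval Dx) eval_monoid.

End Evaluation.

(** * Conformal structure, scales and tractors in a chart *)

Section Chart.
Variables (R : realType) (n : nat) (M : manifold R n) (C : conformal M)
  (k : scale M) (i : chart M) (x0 : 'rV[R]_n).
Hypothesis img_x0 : img i x0.

Definition chart_domain : domain R n := Domain (@coord_open _ _ M i : open (img i)) img_x0.
Local Notation D := chart_domain.
Local Notation K := (sfun D).
Local Notation g := (local C k i).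

Definition ch a b : K := mk (@ten2_smooth _ _ _ _ C i a b : smooth_on D _).
Definition ckappa (k' : scale M) : K := mk (@dens_smooth _ _ _ _ k' i : smooth_on D _).
Definition cH a b : K := invmx (\matrix_(a, b) ch a b) a b.

Lemma rep_ch a b : rep (C i a b) (ch a b). Proof. exact: rep_mk. Qed.

Lemma rep_ckappa (k' : scale M) : rep (k' i) (ckappa k'). Proof. exact: rep_mk. Qed.

Lemma ckappa_unit k' : ckappa k' \is a GRing.unit.
Proof.
by apply/asboolP => x Dx; rewrite mkE // gt_eqF //; apply: kappa_gt0.
Qed.

Lemma ch_sym a b : ch a b = ch b a.
Proof. by apply: sfunP => x Dx; rewrite -!rep_ch //; apply: cmetric_sym. Qed.

(** The determinant has absolute value 1 at every point of the image, so it is a unit of the ring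
    and the inverse metric has smooth entries. *)
Lemma ch_unit : \matrix_(a, b) ch a b \in unitmx.
Proof.
rewrite unitmxE; apply/asboolP => x Dx.
rewrite -[X in X != 0]/(eval Dx _) -det_map_mx (_ : map_mx _ _ = \matrix_(a, b) C i a b x).
  by rewrite -normr_eq0 cmetric_det // oner_eq0.
by apply/matrixP => a b; rewrite !mxE; exact: (esym (rep_ch a b Dx)).
Qed.

Lemma ch_cH a b : \sum_(c < n) ch a c * cH c b = (a == b)%:R.
Proof.
have := mulmxV ch_unit => /matrixP/(_ a b); rewrite !mxE => <-.
by apply: eq_bigr => c _; rewrite !mxE.
Qed.

Lemma cH_sym a b : cH a b = cH b a.
Proof.
rewrite /cH -[in LHS](_ : (\matrix_(a, b) ch a b)^T = \matrix_(a, b) ch a b).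
  by rewrite -trmx_inv mxE.
by apply/matrixP => c e; rewrite !mxE ch_sym.
Qed.

Lemma ch_cH_at x a b : dset D x -> \sum_(c < n) C i a c x * cH c b x = (a == b)%:R.
Proof.
move=> Dx; have /(congr1 (eval Dx)) := ch_cH a b.
rewrite rmorph_nat rmorph_sum => <-; apply: eq_bigr => c _.
by rewrite rmorphM /eval /= (rep_ch a c Dx).
Qed.

Lemma rep_cH a b : rep (fun x => bhinv g a b x) (cH a b).
Proof.
move=> x Dx; rewrite /bhinv (invmx_uniq (B := \matrix_(a, b) cH a b x)) ?mxE //.
apply/matrixP => c e; rewrite !mxE -(ch_cH_at c e Dx).
by apply: eq_bigr => p _; rewrite !mxE.
Qed.

Let der := @sder R n D.

Definition ctheta k' := lc_theta der (ckappa k').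
Definition cgamma := lc_gamma der ch cH (ckappa k).

Lemma rep_ctheta (k' : scale M) a : rep (fun x => pd a (k' i) x / k' i x) (ctheta k' a).
Proof.
apply: repM; first by apply: rep_pd; apply: rep_ckappa.
by apply: repV; [exact: rep_ckappa|exact: ckappa_unit].
Qed.

Lemma rep_metric a b : rep (fun x => metric g a b x) (lc_metric ch (ckappa k) a b).
Proof.
apply: repM; last exact: rep_ch.
apply: (repV (f := fun x => k i x ^+ 2)); last by rewrite unitrX // ckappa_unit.
by rewrite expr2; apply: (repM (f := k i) (g := k i)); apply: rep_ckappa.
Qed.

Lemma rep_inv_metric a b : rep (fun x => invmx (\matrix_(e, f) metric g e f x) a b)
  (ckappa k ^+ 2 * cH a b).
Proof.
move=> x Dx; have k0 : k i x != 0 by rewrite gt_eqF //; apply: kappa_gt0.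
rewrite (invmx_uniq (B := \matrix_(a, b) (k i x ^+ 2 * cH a b x))).
  by rewrite mxE !sME // -(rep_ckappa k Dx) expr2.
apply/matrixP => c e; rewrite !mxE -(ch_cH_at c e Dx).
apply: eq_bigr => p _; rewrite !mxE -[metric _ _ _ _]/((k i x ^+ 2)^-1 * C i c p x).
by rewrite mulrCA mulrA mulrA divff ?mul1r // expf_neq0.
Qed.

Lemma rep_cgamma e a b : rep (fun x => christoffel g e a b x) (cgamma e a b).
Proof.
apply: repM; first exact: (@rep_natV _ _ _ 2).
apply: rep_sum => f; apply: repM; first exact: rep_inv_metric.
apply: repB; first apply: repD.
- by apply: rep_pd; apply: rep_metric.
- by apply: rep_pd; apply: rep_metric.
- by apply: rep_pd; apply: rep_metric.
Qed.

Lemma rep_dUpsilon (k1 k2 : scale M) a :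
  rep (pd a (Upsilon k1 k2 i)) (ctheta k1 a - ctheta k2 a).
Proof.
move=> x Dx.
have d1 : differentiable (k1 i) x by apply: (smooth_diff (D := D)) Dx; apply: dens_smooth.
have d2 : differentiable (k2 i) x by apply: (smooth_diff (D := D)) Dx; apply: dens_smooth.
have p1 : 0 < k1 i x by apply: kappa_gt0.
have p2 : 0 < k2 i x by apply: kappa_gt0.
have n2 : k2 i x != 0 by rewrite gt_eqF.
have d2V : differentiable (fun y => (k2 i y)^-1) x by apply: differentiableV.
rewrite [LHS](pd_ln a (differentiableM d1 d2V)); last by rewrite /= divr_gt0.
rewrite [X in X / _](pdM a d1 d2V) (pdV a d2 n2) sDE // sNE //.
rewrite -(rep_ctheta k1 a Dx) -(rep_ctheta k2 a Dx).
rewrite [X in _ / X](_ : _ = k1 i x / k2 i x) //; field; rewrite n2 gt_eqF //.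
Qed.

(** [flat] only tests sections given in all scales at once, so arbitrary slots in the scale [k] have
    to be extended. The transformation law from [k] prescribes them in the scale [k']; the law
    between two further scales then holds because the one-forms [dU] are additive. *)
Lemma tractor_exists (S : aslots K n) :
  exists U : tractor C i, rep_slots (U k) S.
Proof.
pose dU (k' : scale M) a : K := ctheta k a - ctheta k' a.
pose Sk (k' : scale M) := Tract (ts S)
  (fun a => tm S a + (\sum_(c < n) cH a c * dU k' c) * ts S)
  (tp S - \sum_(c < n) dU k' c * tm S c - 2^-1 * adot cH (dU k') (dU k') * ts S).
pose sl (k' : scale M) : slots R n := Slots (ts (Sk k')) (tm (Sk k')) (tp (Sk k')).
have sm k' : [/\ smooth_on (img i) (sigma (sl k')),
    forall a, smooth_on (img i) (mu (sl k') a) & smooth_on (img i) (phi (sl k'))].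
  by split=> [|a|]; exact: (@sval_smooth _ _ D).
have law k1 k2 x : img i x ->
    let dU := fun a => pd a (Upsilon k1 k2 i) x in
    [/\ sigma (sl k2) x = sigma (sl k1) x,
      forall a, mu (sl k2) a x = mu (sl k1) a x
        + (\sum_(c < n) bhinv (local C k1 i) a c x * dU c) * sigma (sl k1) x &
      phi (sl k2) x = phi (sl k1) x - \sum_(c < n) dU c * mu (sl k1) c x
        - 2^-1 * ip1 (local C k1 i) x dU dU * sigma (sl k1) x].
  move=> Dx dUx.
    pose Hx a b := bhinv g a b x.
  have Hx_sym a b : Hx a b = Hx b a by rewrite /Hx !(rep_cH _ _ Dx) cH_sym.
  (* Only numbers are kept from here on: the form from [k1] to [k2] is the difference of those from
     [k], and the rest is algebra. *)
  have [u [dUE dUxE]] : exists u : scale M -> 'I_n -> R,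
      (forall k' c, dU k' c x = u k' c) /\ (forall c, dUx c = u k2 c - u k1 c).
    exists (fun k' c => dU k' c x); split=> // c.
    by rewrite /dUx (rep_dUpsilon k1 k2 c Dx) /dU !sDE // !sNE //; ring.
  have mE k' a : mu (sl k') a x = tm S a x + (\sum_(c < n) Hx a c * u k' c) * ts S x.
    rewrite -[LHS]/((tm S a + (\sum_(c < n) cH a c * dU k' c) * ts S : K) x).
    rewrite sDE // sME //; congr (_ + _ * _).
    have r c : rep (fun x => bhinv g a c x * dU k' c x) (cH a c * dU k' c).
      by apply: repM => //; apply: rep_cH.
    by rewrite -(rep_sum r Dx); apply: eq_bigr => c _; rewrite dUE.
  have pE k' : phi (sl k') x = tp S x - \sum_(c < n) u k' c * tm S c x
      - 2^-1 * adot Hx (u k') (u k') * ts S x.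
    rewrite -[LHS]/((tp S - \sum_(c < n) dU k' c * tm S c
      - 2^-1 * adot cH (dU k') (dU k') * ts S : K) x).
    rewrite !sDE // !sNE // !sME //.
    rewrite -(@rep_natV _ _ D 2 isT x Dx).
    have r c : rep (fun x => dU k' c x * tm S c x) (dU k' c * tm S c).
      by apply: repM.
    rewrite -(rep_sum r Dx).
    have r2 := rep_ip1 rep_cH (fun a => (fun _ _ => erefl) : rep (dU k' a) (dU k' a))
      (fun a => (fun _ _ => erefl) : rep (dU k' a) (dU k' a)).
    rewrite -(r2 x Dx); congr (_ - _ - _ * _ * _).
      by apply: eq_bigr => c _; rewrite dUE.
    by apply: eq_dot => c; exact: dUE.
  split=> [//|a|].
    rewrite !mE; have -> : \sum_(c < n) bhinv (local C k1 i) a c x * dUx c =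
        \sum_(c < n) Hx a c * u k2 c - \sum_(c < n) Hx a c * u k1 c.
      by rewrite -sumrB; apply: eq_bigr => c _; rewrite dUxE mulrBr.
    rewrite /=; ring.
  have -> : ip1 (local C k1 i) x dUx dUx =
      adot Hx (fun c => u k2 c - u k1 c) (fun c => u k2 c - u k1 c).
    by apply: eq_dot.
  have -> : \sum_(c < n) dUx c * mu (sl k1) c x =
      \sum_(c < n) u k2 c * tm S c x - \sum_(c < n) u k1 c * tm S c x
      + adot Hx (fun c => u k2 c - u k1 c) (u k1) * ts S x.
    rewrite /adot mulr_suml -sumrB -big_split; apply: eq_bigr => c _ /=.
    rewrite -[X in _ * X]/(mu (sl k1) c x) mE dUxE mulrDr; congr (_ + _); first by ring.
    rewrite mulr_suml mulr_suml mulr_sumr; apply: eq_bigr => e _; ring.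
  rewrite !pE !dotBl // !dotBr // (dotC Hx_sym (u k1) (u k2)) /=.
  by field.
(* In the scale [k] itself the correction is zero, and the prescribed slots are recovered. *)
have dU0 a : dU k a = 0 by rewrite /dU subrr.
exists (Tractor sm law); split=> [x Dx|a x Dx|x Dx].
- by [].
- rewrite -[LHS]/((tm S a + (\sum_(c < n) cH a c * dU k c) * ts S : K) x).
  by rewrite big1 ?mul0r ?addr0 // => c _; rewrite dU0 mulr0.
- rewrite -[LHS]/((tp S - \sum_(c < n) dU k c * tm S c
    - 2^-1 * adot cH (dU k) (dU k) * ts S : K) x).
  rewrite big1 => [|c _]; last by rewrite dU0 mul0r.
  rewrite subr0 (eq_dot _ dU0 dU0) dot0l ?mulr0 ?mul0r ?subr0 //; exact: cH_sym.
Qed.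

Let gamma_sym := lc_gamma_sym der cH (ckappa k) ch_sym.
Let theta_closed := lc_theta_closed (@sderM R n D) (@sderC R n D) (ckappa_unit k).
Let nabla_ch := lc_nabla_h (@sderM R n D) (@snat_unit R n D) ch_sym ch_cH (ckappa_unit k).

(** Collects what the algebra has to know of [rho]: in dimension 2 from the axioms of a Moebius
    structure, otherwise from the Schouten formula and the symmetry of Ricci. *)
Lemma rho_rep (Mo : n = 2%N -> mobius C) : (1 < n)%N ->
  exists P : 'I_n -> 'I_n -> K,
  [/\ forall a b, rep (rho Mo k i a b) (P a b), forall a b, P a b = P b a,
    n <> 2%N -> forall a b, P a b = (n%:R - 2)^-1 *
      (aric der (ctheta k) cgamma a b
       - atr cH (aric der (ctheta k) cgamma) / (2 * (n%:R - 1)) * ch a b) &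
    n = 2%N -> atr cH P = 2^-1 * atr cH (aric der (ctheta k) cgamma)].
Proof.
move=> n1; rewrite /rho; case: eqP => [n2|n2].
  exists (fun a b => mk (@ten2_smooth _ _ _ _ (mob (Mo n2) k) i a b : smooth_on D _)).
  split=> // [a b|a b|_]; first exact: rep_mk.
    by apply: sfunP => x Dx; rewrite !mkE //; apply: mob_sym.
  apply/(rep_eqP (rep_tr2 rep_cH (fun a b => rep_mk _))
    (repM (@rep_natV _ _ D 2 isT) (rep_scal rep_cH (rep_ctheta k) rep_cgamma))).
  by move=> x Dx; apply: mob_trace.
exists (fun a b => (n%:R - 2)^-1 * (aric der (ctheta k) cgamma a b
  - atr cH (aric der (ctheta k) cgamma) / (2 * (n%:R - 1)) * ch a b)).
split=> // a b.
- apply: rep_schouten => //; first exact: rep_ch.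
  + by rewrite ltn_neqAle eq_sym n1 andbT; apply/eqP.
  + by apply: rep_ric; [exact: rep_ctheta|exact: rep_cgamma].
  + by apply: rep_scal; [exact: rep_cH|exact: rep_ctheta|exact: rep_cgamma].
- rewrite ch_sym (ric_sym (@sderD R n D) (@sderM R n D) (@sderC R n D)
    (@snat_unit R n D) ch_sym cH_sym ch_cH gamma_sym theta_closed nabla_ch) //.
Qed.

(** * The equivalence in one chart *)

Section Equivalence.
Variables (Mo : n = 2%N -> mobius C) (E G : tensor2 M 0) (F : covector M (-2))
  (A : tensor3 M 2).
Hypothesis n_gt1 : (1 < n)%N.
Hypothesis Esym : symmetric2 E.
Hypothesis Gsym : symmetric2 G.
Hypothesis Asym : symmetric3 A.
Hypothesis Atf : forall x, img i x -> forall c,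
  tr2 g x (fun a b => A i a b c x) = 0.
Hypothesis EGtrace : forall x, img i x ->
  tr2 g x (fun a b => E i a b x) + tr2 g x (fun a b => G i a b x) = 0.
Hypothesis EGtf : n = 2%N -> forall x, img i x -> forall a b,
  tf2 g x (fun a b => E i a b x - G i a b x) a b = 0.

Let E' a b : K := mk (@ten2_smooth _ _ _ _ E i a b : smooth_on D _).
Let G' a b : K := mk (@ten2_smooth _ _ _ _ G i a b : smooth_on D _).
Let F' a : K := mk (@cov_smooth _ _ _ _ F i a : smooth_on D _).
Let A' a b c : K := mk (@ten3_smooth _ _ _ _ A i a b c : smooth_on D _).

Let rE a b : rep (E i a b) (E' a b). Proof. exact: rep_mk. Qed.
Let rG a b : rep (G i a b) (G' a b). Proof. exact: rep_mk. Qed.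
Let rF a : rep (F i a) (F' a). Proof. exact: rep_mk. Qed.
Let rA a b c : rep (A i a b c) (A' a b c). Proof. exact: rep_mk. Qed.

Let conn_at := fun a => bold_nabla g (rho Mo k i) (E i) (G i) (A i) (F i) a.

Theorem chart_equivalence :
  (forall (U : tractor C i) x, img i x -> forall a b,
    let V := conn_at a (conn_at b (U k)) in let W := conn_at b (conn_at a (U k)) in
    [/\ sigma V x = sigma W x, forall c, mu V c x = mu W c x & phi V x = phi W x])
  <->
  (forall x, img i x ->
    let P := rho Mo k i in
    [/\ forall a b, E i a b x = - n%:R^-1 * delta g (A i) a b x + PA g (A i) a b x,
        forall a b, G i a b x = - n%:R^-1 * delta g (A i) a b x - PA g (A i) a b x &
        forall a, F i a x = (n%:R * (n%:R - 1))^-1 * delta2 g (A i) a x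
          + (n%:R - 1)^-1 * ip2 g x (fun m v => A i a m v x)
                                    (fun m v => P m v x - PA g (A i) m v x)])
  /\
  (forall x, img i x ->
    let P := rho Mo k i in
    [/\ (4 <= n)%N -> forall a b c m,
          2 * tf4 g x (fun a b c m =>
                skew2 (fun a b => ip1 g x (fun v => A i v c a x)
                                         (fun v => A i b m v x)) a b) a b c m
          + weyl g P a b c m x = 0,
        n = 3%N -> forall a b c,
          skew2 (fun a b => nabla2 g 0 (PA g (A i)) a b c x) a b
          + 3^-1 * skew2 (fun a b => ip1 g x (fun m => A i m c a x)
                                            (fun m => delta g (A i) b m x)) a b
          - cotton g P a b c x = 0 &
        n = 2%N -> forall a,
          nabla0 g (-2) (normsq g (A i)) a x
          + 2 * ip2 g x (fun m v => A i a m v x)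
                        (fun m v => delta g (A i) m v x)
          - 8 * tr2 g x (fun m v => cotton g P a m v x) = 0])
  /\
  (forall x, img i x ->
    let P := rho Mo k i in
    ((3 <= n)%N -> forall a b c m,
      skew2 (fun a b => nabla3 g 2 (A i) a b c m x) a b
      - n%:R^-1 * (skew2 (fun a b => C i m a x * delta g (A i) b c x) a b
                   + skew2 (fun a b => C i c a x * delta g (A i) b m x) a b) = 0)
    /\
    (n = 2%N -> forall a b,
      skew2 (fun a b => nabla1 g (-2) (delta2 g (A i)) a b x) a b
      + 4 * skew2 (fun a b => ip1 g x (fun m => P m a x)
                                     (fun m => delta g (A i) b m x)) a b
      - 2 * skew2 (fun a b => ip2 g x (fun c m => A i c m a x)
                                     (fun c m => nabla2 g 0 P b c m x)) a b = 0)).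
Proof.
have [P [rP P_sym P_sch P_mob]] := rho_rep Mo n_gt1.
have E_sym a b : E' a b = E' b a.
  by apply: sfunP => x Dx; rewrite -!rE //; apply: Esym.
have G_sym a b : G' a b = G' b a.
  by apply: sfunP => x Dx; rewrite -!rG //; apply: Gsym.
have A_sym12 a b c : A' a b c = A' b a c.
  by apply: sfunP => x Dx; rewrite -!rA //; apply: (Asym Dx a b c).1.
have A_sym23 a b c : A' a b c = A' a c b.
  by apply: sfunP => x Dx; rewrite -!rA //; apply: (Asym Dx a b c).2.
have A_tf c : atr cH (fun a b => A' a b c) = 0.
  by apply/(rep_eq0P (rep_tr2 rep_cH (fun a b => rA a b c))) => x Dx; apply: Atf.
have EG_tr : atr cH E' + atr cH G' = 0.
  by apply/(rep_eq0P (repD (rep_tr2 rep_cH rE) (rep_tr2 rep_cH rG))).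
have rEG a b : rep (fun x => E i a b x - G i a b x) (E' a b - G' a b) by apply: repB.
have rnV : rep (fun=> n%:R^-1) (n%:R^-1 : K) by apply: rep_natV; apply: ltnW.
have EG_tf : n = 2%N -> forall a b, E' a b - G' a b
    - n%:R^-1 * atr cH (fun a b => E' a b - G' a b) * ch a b = 0.
  move=> n2 a b; apply/(rep_eq0P (repB (rEG a b)
    (repM (repM rnV (rep_tr2 rep_cH rEG)) (rep_ch a b)))) => x Dx.
  exact: EGtf.
pose Q a b := P a b - E' a b; pose S a b := P a b + G' a b.
have Q_sym a b : Q a b = Q b a by rewrite /Q P_sym E_sym.
have S_sym a b : S a b = S b a by rewrite /S P_sym G_sym.
have QE a b : Q a b = P a b - E' a b by [].
have SE a b : S a b = P a b + G' a b by [].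
have KP := curvature_zeroP (@sderD R n D) (@sderM R n D) (@sderC R n D)
  (@snat_unit R n D) ch_sym cH_sym ch_cH gamma_sym theta_closed nabla_ch F'
  A_sym12 A_sym23 Q_sym S_sym n_gt1 QE SE P_sym A_tf EG_tr EG_tf P_sch P_mob.
have KF := uconn_flatP (@sderD R n D) (@sderM R n D) (@sderC R n D)
  ch_sym cH_sym ch_cH gamma_sym theta_closed nabla_ch F'
  A_sym12 A_sym23 Q_sym S_sym QE SE.
have rbold := rep_bold_nabla (g := g) rep_ch rep_cH (rep_ctheta k) rep_cgamma rP rE rG rA rF.
apply: iff_trans (iff_trans (iff_trans _ KF) KP) _.
  (* Flatness on tractors against flatness on formal slots: [tractor_exists] supplies a tractor for
     given slots, and [slot_smooth] makes slots out of a tractor. *)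
  split=> [fl S0 a b | fl U x Dx a b V W].
    have [U rU] := tractor_exists S0.
    have [r1 r2 r3] := rbold a _ _ (rbold b _ _ rU).
    have [r1' r2' r3'] := rbold b _ _ (rbold a _ _ rU).
    split=> [|c|].
    - by apply/(rep_eqP r1 r1') => x Dx; have [] := fl U x Dx a b.
    - by apply/(rep_eqP (r2 c) (r2' c)) => x Dx; have [_ + _] := fl U x Dx a b; apply.
    - by apply/(rep_eqP r3 r3') => x Dx; have [] := fl U x Dx a b.
  have [s1 s2 s3] := slot_smooth U k.
  pose S0 : aslots K n := Tract (mk (s1 : smooth_on D _))
    (fun a => mk (s2 a : smooth_on D _)) (mk (s3 : smooth_on D _)).
  have rU : rep_slots (U k) S0 by split=> [|c|]; exact: rep_mk.
  have [r1 r2 r3] := rbold a _ _ (rbold b _ _ rU).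
  have [r1' r2' r3'] := rbold b _ _ (rbold a _ _ rU).
  have [f1 f2 f3] := fl S0 a b.
  split=> [|c|].
  - exact: (rep_eqP r1 r1').1 f1 x Dx.
  - exact: (rep_eqP (r2 c) (r2' c)).1 (f2 c) x Dx.
  - exact: (rep_eqP r3 r3').1 f3 x Dx.
have rdelta a b : rep (delta g (A i) a b) (adelta der cH (ctheta k) cgamma A' a b).
  by apply: rep_delta => // *; [exact: rep_cH|exact: rep_ctheta|exact: rep_cgamma].
have rdelta2 a : rep (delta2 g (A i) a) (adelta2 der cH (ctheta k) cgamma A' a).
  by apply: rep_delta2 => // *; [exact: rep_cH|exact: rep_ctheta|exact: rep_cgamma].
have rPA a b : rep (PA g (A i) a b) (aPA ch cH A' a b).
  by apply: rep_PA => // *; [exact: rep_ch|exact: rep_cH].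
have rn1V := @rep_n1_V _ _ D n_gt1.
have rnn1V : rep (fun=> (n%:R * (n%:R - 1))^-1) ((n%:R * (n%:R - 1))^-1 : K).
  apply: repV; last first.
    by rewrite unitrM; apply/andP; split; [apply: n_unit|apply: nB1_unit] => //;
      exact: snat_unit.
  by apply: repM; [|apply: repB; [|exact: rep1]]; apply: rep_nat.
have eE a b := rep_eqP (rE a b) (repD (repM (repN rnV) (rdelta a b)) (rPA a b)).
have eG a b := rep_eqP (rG a b) (repB (repM (repN rnV) (rdelta a b)) (rPA a b)).
have eF a := rep_eqP (rF a) (repD (repM rnn1V (rdelta2 a)) (repM rn1V
  (rep_ip2 rep_cH (fun m v => rA a m v) (fun m v => repB (rP m v) (rPA m v))))).
have n3_of : (4 <= n)%N -> (2 < n)%N by apply: ltnW.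
have e4 n4 a b c m := rep_eq0P (rep_gauss4 (g := g) rep_ch rep_cH (rep_ctheta k)
  rep_cgamma rP rA a b c m (n3_of n4)).
have e3 a b c := rep_eq0P (rep_gauss3 (g := g) rep_ch rep_cH (rep_ctheta k)
  rep_cgamma rP rA a b c n_gt1).
have e2 a := rep_eq0P (rep_gauss2 (g := g) rep_cH (rep_ctheta k) rep_cgamma rP rA a).
have c3 a b c m := rep_eq0P (rep_codazzi3 (g := g) rep_ch rep_cH (rep_ctheta k)
  rep_cgamma rA a b c m (ltnW n_gt1)).
have c2 a b := rep_eq0P (rep_codazzi2 (g := g) rep_cH (rep_ctheta k)
  rep_cgamma rP rA a b).
split=> [[[EN GN FN] [[G4 G3 G2] [C3 C2]]] | [CI [CG CC]]].
  split; [|split] => x Dx.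
  - split=> [a b|a b|a].
    + exact: (eE a b).1 (EN a b) x Dx.
    + exact: (eG a b).1 (GN a b) x Dx.
    + exact: (eF a).1 (FN a) x Dx.
  - split=> [n4 a b c m|n3 a b c|n2 a].
    + exact: (e4 n4 a b c m).1 (G4 n4 a b c m) x Dx.
    + exact: (e3 a b c).1 (G3 n3 a b c) x Dx.
    + exact: (e2 a).1 (G2 n2 a) x Dx.
  - split=> [n3 a b c m|n2 a b].
    + exact: (c3 a b c m).1 (C3 n3 a b c m) x Dx.
    + exact: (c2 a b).1 (C2 n2 a b) x Dx.
split; [|split].
- split=> [a b|a b|a].
  + by apply: (eE a b).2 => x /CI[+ _ _]; apply.
  + by apply: (eG a b).2 => x /CI[_ + _]; apply.
  + by apply: (eF a).2 => x /CI[_ _]; apply.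
- split=> [n4 a b c m|n3 a b c|n2 a].
  + by apply: (e4 n4 a b c m).2 => x /CG[+ _ _]; apply.
  + by apply: (e3 a b c).2 => x /CG[_ + _]; apply.
  + by apply: (e2 a).2 => x /CG[_ _]; apply.
- split=> [n3 a b c m|n2 a b].
  + by apply: (c3 a b c m).2 => x /CC[+ _]; apply.
  + by apply: (c2 a b).2 => x /CC[_]; apply.
Qed.
End Equivalence.
End Chart.

Theorem proposition5p3 (R : realType) (n : nat) (hn : (2 <= n)%N)
  (M : manifold R n) (C : conformal M) (Mo : n = 2%N -> mobius C)
  (k : scale M)
  (E G : tensor2 M 0) (F : covector M (-2)) (A : tensor3 M 2)
  (Esym : symmetric2 E) (Gsym : symmetric2 G) (Asym : symmetric3 A)
  (Atf : forall i x, img i x -> forall c,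
    tr2 (local C k i) x (fun a b => A i a b c x) = 0)
  (EGtrace : forall i x, img i x ->
    tr2 (local C k i) x (fun a b => E i a b x)
    + tr2 (local C k i) x (fun a b => G i a b x) = 0)
  (EGtf : n = 2%N -> forall i x, img i x -> forall a b,
    tf2 (local C k i) x (fun a b => E i a b x - G i a b x) a b = 0) :
  flat C k (fun i =>
    bold_nabla (local C k i) (rho Mo k i) (E i) (G i) (A i) (F i))
  <->
  (* (i) *)
  (forall i x, img i x ->
    let g := local C k i in let P := rho Mo k i in
    [/\ forall a b, E i a b x = - n%:R^-1 * delta g (A i) a b x + PA g (A i) a b x,
        forall a b, G i a b x = - n%:R^-1 * delta g (A i) a b x - PA g (A i) a b x &
        forall a, F i a x = (n%:R * (n%:R - 1))^-1 * delta2 g (A i) a x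
          + (n%:R - 1)^-1 * ip2 g x (fun m v => A i a m v x)
                                    (fun m v => P m v x - PA g (A i) m v x)])
  /\
  (* (ii), Gauss equation *)
  (forall i x, img i x ->
    let g := local C k i in let P := rho Mo k i in
    [/\ (4 <= n)%N -> forall a b c m,
          2 * tf4 g x (fun a b c m =>
                skew2 (fun a b => ip1 g x (fun v => A i v c a x)
                                         (fun v => A i b m v x)) a b) a b c m
          + weyl g P a b c m x = 0,
        n = 3%N -> forall a b c,
          skew2 (fun a b => nabla2 g 0 (PA g (A i)) a b c x) a b
          + 3^-1 * skew2 (fun a b => ip1 g x (fun m => A i m c a x)
                                            (fun m => delta g (A i) b m x)) a b
          - cotton g P a b c x = 0 &
        n = 2%N -> forall a,
          nabla0 g (-2) (normsq g (A i)) a x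
          + 2 * ip2 g x (fun m v => A i a m v x)
                        (fun m v => delta g (A i) m v x)
          - 8 * tr2 g x (fun m v => cotton g P a m v x) = 0])
  /\
  (* (ii), Codazzi equation *)
  (forall i x, img i x ->
    let g := local C k i in let P := rho Mo k i in
    ((3 <= n)%N -> forall a b c m,
      skew2 (fun a b => nabla3 g 2 (A i) a b c m x) a b
      - n%:R^-1 * (skew2 (fun a b => C i m a x * delta g (A i) b c x) a b
                   + skew2 (fun a b => C i c a x * delta g (A i) b m x) a b) = 0)
    /\
    (n = 2%N -> forall a b,
      skew2 (fun a b => nabla1 g (-2) (delta2 g (A i)) a b x) a b
      + 4 * skew2 (fun a b => ip1 g x (fun m => P m a x)
                                     (fun m => delta g (A i) b m x)) a b
      - 2 * skew2 (fun a b => ip2 g x (fun c m => A i c m a x)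
                                     (fun c m => nabla2 g 0 P b c m x)) a b = 0)).
Proof.
(* The equivalence in a chart needs a point of its image. All conditions are quantified over such
   points, so charts with empty image cause no loss. *)
pose equiv i x (Dx : img i x) := chart_equivalence (k := k) Dx Mo F hn Esym Gsym
  Asym (Atf i) (EGtrace i) (fun n2 => EGtf n2 i).
split=> [fl | [CI [CG CC]] i U x Dx].
  split; [|split] => i x Dx; have [h1 [h2 h3]] := (equiv i x Dx).1 (fl i).
  - exact: h1 Dx.
  - exact: h2 Dx.
  - exact: h3 Dx.
exact: (equiv i x Dx).2 (conj (CI i) (conj (CG i) (CC i))) U x Dx.
Qed.
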